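(* Let $p>2$, $s\in(0,1)$, let $\Omega\subset\mathbb{R}^n$ be a bounded domain, and let $f\in L^{p'}_{\mathrm{loc}}((0,\infty);(X^{s,p}_0(\Omega,\Omega'))^* )$. Assume that $u$ and $v$ are both weak solutions of $$\partial_t u+(-\Delta_p)^s u=f\quad\text{in }\Omega\times(0,\infty)$$ (with the same $f$), and that $u-v\in L^p_{\mathrm{loc}}((0,\infty);W^{s,p}_0(\Omega))$. Then there is a constant $C=C(\Omega,n,p,s)$ such that for every $T>0$ $$\sup_{t\ge T}\|v(\cdot,t)-u(\cdot,t)\|_{L^\infty(\Omega)}\le C\,T^{-\frac{1}{p-2}}.$$
   Context: Notation: $p'=p/(p-1)$, $J_p(t)=|t|^{p-2}t$, $d\mu=|x-y|^{-n-sp}\,dx\,dy$. $\Omega'\subset\mathbb{R}^n$ is a bounded open set with $\Omega\Subset\Omega'$. Spaces: $[u]^p_{W^{s,p}(\mathbb{R}^n)}=\iint_{\mathbb{R}^n\times\mathbb{R}^n}|u(x)-u(y)|^p\,d\mu$ and $\|u\|^p_{W^{s,p}(\mathbb{R}^n)}=[u]^p_{W^{s,p}(\mathbb{R}^n)}+\|u\|^p_{L^p(\mathbb{R}^n)}$. $W^{s,p}_0(\Omega)$ is the closure of $C_0^\infty(\Omega)$ in the norm of $W^{s,p}(\mathbb{R}^n)$. The tail space is $L^{q}_{\alpha}(\mathbb{R}^n)=\{u\in L^q_{\mathrm{loc}}(\mathbb{R}^n):\int_{\mathbb{R}^n}\frac{|u|^q}{1+|x|^{n+\alpha}}dx<\infty\}$.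 $X^{s,p}_0(\Omega,\Omega')=\{v\in W^{s,p}(\Omega')\cap L^{p-1}_{sp}(\mathbb{R}^n): v=0\text{ on }\mathbb{R}^n\setminus\Omega\}$, regarded as a subspace of $W^{s,p}(\Omega')$; $(\cdot)^*$ denotes the dual space and $\langle\cdot,\cdot\rangle$ the duality pairing. Weak solution: $u$ is a weak solution of $\partial_t u+(-\Delta_p)^su=f$ in $\Omega\times(0,\infty)$ if for every closed interval $J=[T_0,T_1]\subset(0,\infty)$ one has $u\in L^p(J;W^{s,p}(\Omega'))\cap L^{p-1}(J;L^{p-1}_{sp}(\mathbb{R}^n))\cap C(J;L^2(\Omega))$ and $$-\int_J\int_\Omega u\,\partial_t\phi\,dx\,dt+\int_J\iint_{\mathbb{R}^n\times\mathbb{R}^n}J_p(u(x,t)-u(y,t))(\phi(x,t)-\phi(y,t))\,d\mu\,dt$$ $$=\int_\Omega u(x,T_0)\phi(x,T_0)\,dx-\int_\Omega u(x,T_1)\phi(x,T_1)\,dx+\int_J\langle f(\cdot,t),\phi(\cdot,t)\rangle\,dt$$ for every $\phi\in L^p(J;X^{s,p}_0(\Omega,\Omega'))\cap C^1(J;L^2(\Omega))$. *)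

(* Defs.v *)
From HB Require Import structures.
From mathcomp Require Import all_boot all_order all_algebra.
From mathcomp Require Import all_classical all_reals all_analysis.

Set Implicit Arguments.
Unset Strict Implicit.
Unset Printing Implicit Defensive.

Import Order.TTheory GRing.Theory Num.Theory.
Import numFieldNormedType.Exports.

Local Open Scope classical_set_scope.
Local Open Scope ring_scope.

(* R^n is ['rV[R]_n]; the library gives it its topology but no sigma-algebra.
   The sigma-algebra generated by the coordinate maps is the Borel one. Using it
   instead of its completion loses nothing for functions up to null sets. *)
Section measurable_rV.
Context {R : realType}.
Variable n : nat.

Definition coord_rV (i : 'I_n) (x : 'rV[R]_n) : measurableTypeR R := x ord0 i.

Let rV_set0 : g_sigma_preimage coord_rV set0.
Proof. exact: sigma_algebra0. Qed.

Let rV_setC A : g_sigma_preimage coord_rV A -> g_sigma_preimage coord_rV (~` A).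
Proof. exact: sigma_algebraC. Qed.

Let rV_bigcup (F : (set 'rV[R]_n)^nat) :
  (forall i, g_sigma_preimage coord_rV (F i)) ->
  g_sigma_preimage coord_rV (\bigcup_i (F i)).
Proof. exact: sigma_algebra_bigcup. Qed.

HB.instance Definition _ := @isMeasurable.Build
  (measure_tuple_display default_measure_display) 'rV[R]_n
  (g_sigma_preimage coord_rV) rV_set0 rV_setC rV_bigcup.

Lemma measurable_coord_rV (i : 'I_n) : measurable_fun [set: 'rV[R]_n] (coord_rV i).
Proof.
move=> _ Y mY; rewrite setTI; apply: sub_sigma_algebra => /=.
rewrite -bigcup_seq/=; exists i => /=; first by rewrite mem_index_enum.
by exists Y => //; rewrite setTI.
Qed.

Lemma measurable_fun_rV d (T : measurableType d) (f : T -> 'rV[R]_n) :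
  (forall i, measurable_fun [set: T] (coord_rV i \o f)) ->
  measurable_fun [set: T] f.
Proof.
move=> mf _ A mA; rewrite setTI.
suff : g_sigma_preimage coord_rV `<=` [set B | measurable (f @^-1` B)].
  exact.
apply: smallest_sub.
  split => /=.
  - by rewrite preimage_set0.
  - by move=> B mB; rewrite setTD preimage_setC; exact: measurableC.
  - by move=> F mF; rewrite preimage_bigcup; exact: bigcup_measurable.
rewrite -bigcup_seq/=; apply: bigcup_sub => i _ _ [B mB <-] /=.
rewrite setTI -comp_preimage.
by have := mf i measurableT B mB; rewrite setTI.
Qed.

End measurable_rV.

Section lebesgue_rV.
Context {R : realType}.

Definition cons_rV n (z : measurableTypeR R * 'rV[R]_n) : 'rV[R]_n.+1 :=
  row_mx (const_mx z.1 : 'rV_1) z.2.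

Lemma cons_rV0 n (z : measurableTypeR R * 'rV[R]_n) :
  coord_rV ord0 (cons_rV z) = z.1.
Proof.
rewrite /coord_rV /cons_rV.
have -> : ord0 = lshift n (ord0 : 'I_1) :> 'I_n.+1 by apply/val_inj.
by rewrite (row_mxEl (const_mx z.1 : 'rV_1)) mxE.
Qed.

Lemma cons_rV_lift n (z : measurableTypeR R * 'rV[R]_n) (i : 'I_n) :
  coord_rV (lift ord0 i) (cons_rV z) = coord_rV i z.2.
Proof.
rewrite /coord_rV /cons_rV.
have -> : lift ord0 i = rshift 1 i :> 'I_n.+1 by apply/val_inj.
by rewrite (row_mxEr (const_mx z.1 : 'rV_1)).
Qed.

Lemma measurable_cons_rV n : measurable_fun setT (@cons_rV n).
Proof.
apply: measurable_fun_rV => i; have [j ->|->] := unliftP ord0 i.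
  rewrite (_ : _ \o _ = coord_rV j \o snd); last first.
    by apply/funext => z /=; rewrite cons_rV_lift.
  by apply: measurableT_comp => //; exact: measurable_coord_rV.
rewrite (_ : _ \o _ = fst); first exact: measurable_fst.
by apply/funext => z /=; rewrite cons_rV0.
Qed.

Section step.
Variables (n : nat) (m : {sigma_finite_measure set 'rV[R]_n -> \bar R}).

Definition lebesgue_rV_step : set 'rV[R]_n.+1 -> \bar R :=
  pushforward (lebesgue_measure \x m)%E (@cons_rV n).

Let step_measurable (A : set 'rV[R]_n.+1) :
  measurable A -> measurable (@cons_rV n @^-1` A).
Proof.
by move=> mA; rewrite -[X in measurable X]setTI; exact: measurable_cons_rV.
Qed.

Let step0 : lebesgue_rV_step set0 = 0%E.
Proof. by rewrite /lebesgue_rV_step /pushforward preimage_set0 measure0. Qed.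

Let step_ge0 A : (0 <= lebesgue_rV_step A)%E.
Proof. by rewrite /lebesgue_rV_step /pushforward; exact: measure_ge0. Qed.

Let step_sigma_additive : semi_sigma_additive lebesgue_rV_step.
Proof.
move=> F mF tF mUF; rewrite /lebesgue_rV_step /pushforward preimage_bigcup.
apply: measure_semi_sigma_additive.
- by move=> i; exact: step_measurable.
- apply/trivIsetP => /= i j _ _ ij; rewrite -preimage_setI.
  by move/trivIsetP : tF => /(_ _ _ _ _ ij) ->//; rewrite preimage_set0.
- by rewrite -preimage_bigcup; exact: step_measurable.
Qed.

HB.instance Definition _ := isMeasure.Build _ _ _ lebesgue_rV_step
  step0 step_ge0 step_sigma_additive.

Let uncons_rV (x : 'rV[R]_n.+1) : measurableTypeR R * 'rV[R]_n :=
  (coord_rV ord0 x, rsubmx (x : 'rV_(1 + n))).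

Let cons_rVK : cancel (@cons_rV n) uncons_rV.
Proof.
by case=> a x; rewrite /uncons_rV cons_rV0 /cons_rV/= row_mxKr.
Qed.

Let measurable_uncons_rV : measurable_fun setT uncons_rV.
Proof.
apply/measurable_fun_pairP; split; first exact: measurable_coord_rV.
apply: measurable_fun_rV => i.
rewrite (_ : _ \o _ = coord_rV (lift ord0 i)); first exact: measurable_coord_rV.
apply/funext => x; rewrite /coord_rV /= mxE; congr (x _ _).
exact/val_inj.
Qed.

Let step_sigma_finite : sigma_finite setT lebesgue_rV_step.
Proof.
have /sigma_finiteP[F [TF ndF Foo]] := sigma_finiteT (@lebesgue_measure R).
have /sigma_finiteP[G [TG ndG Goo]] := sigma_finiteT m.
exists (fun k => uncons_rV @^-1` (F k `*` G k)).
  rewrite -preimage_bigcup (_ : \bigcup_k _ = setT) ?preimage_setT//.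
  rewrite -subTset => -[a x] _.
  have [i _ Fa] : (\bigcup_i F i) a by rewrite -TF.
  have [j _ Gx] : (\bigcup_i G i) x by rewrite -TG.
  exists (maxn i j) => //; split => /=.
    by move: a Fa; exact/subsetPset/ndF/leq_maxl.
  by move: x Gx; exact/subsetPset/ndG/leq_maxr.
move=> k; have [mF Fk] := Foo k; have [mG Gk] := Goo k; split.
  rewrite -[X in measurable X]setTI.
  by apply: measurable_uncons_rV => //; exact: measurableX.
rewrite /lebesgue_rV_step /pushforward -comp_preimage.
rewrite (_ : _ \o _ = id); last by apply/funext => z /=; rewrite cons_rVK.
by rewrite preimage_id product_measure1E// lte_mul_pinfty// ge0_fin_numE.
Qed.

HB.instance Definition _ := @Measure_isSigmaFinite.Build _ _ _
  lebesgue_rV_step step_sigma_finite.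

End step.

Fixpoint lebesgue_rV n : {sigma_finite_measure set 'rV[R]_n -> \bar R} :=
  if n is n'.+1 then lebesgue_rV_step (lebesgue_rV n') else \d_(0 : 'rV[R]_0).

(* The product rule on boxes, which determines the measure. *)
Lemma lebesgue_rV_box n (A : 'I_n -> set (measurableTypeR R)) :
  (forall i, measurable (A i)) ->
  lebesgue_rV n [set x | forall i, A i (coord_rV i x)] =
  (\prod_(i < n) lebesgue_measure (A i))%E.
Proof.
elim: n A => [|n IHn] A mA.
  by rewrite big_ord0 /= diracE mem_set//= => -[].
rewrite big_ord_recl /= -IHn; last by move=> i.
rewrite /lebesgue_rV_step /pushforward -product_measure1E//; last first.
  rewrite (_ : mkset _ = \bigcap_(i in [set: 'I_n])
      ([set: 'rV[R]_n] `&` coord_rV i @^-1` (A (lift ord0 i)))).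
    apply: fin_bigcap_measurable => // i _.
    exact: measurable_coord_rV.
  by apply/seteqP; split => [x Ax i _|x Ax i] /=; [split|have [] := Ax i I].
congr product_measure1; apply/seteqP; split => z /=.
  move=> Az; split => [|i]; first by have := Az ord0; rewrite cons_rV0.
  by have := Az (lift ord0 i); rewrite cons_rV_lift.
move=> [Az0 Az] i; have [j ->|->] := unliftP ord0 i.
  by rewrite cons_rV_lift.
by rewrite cons_rV0.
Qed.

End lebesgue_rV.

Section euclidean.
Context {R : realType} {n : nat}.
Implicit Types (x y : 'rV[R]_n) (D Om : set 'rV[R]_n).

(* The library norm of ['rV[R]_n] is the sup norm; it has the same topology but
   gives a different kernel. *)
Definition enorm x : R := Num.sqrt (\sum_(i < n) x ord0 i ^+ 2).

(* The density [|x - y|^(-n-sp)] of [dmu]; its value on the diagonal, a null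
   set, is irrelevant. *)
Definition frac_kernel (s p : R) (z : 'rV[R]_n * 'rV[R]_n) : R :=
  enorm (z.1 - z.2) `^ (- (n%:R + s * p)).

Definition domain Om : Prop := [/\ open Om, connected Om & Om !=set0].

Definition compactly_contained Om D : Prop :=
  compact (closure Om) /\ closure Om `<=` D.

Fixpoint iter_partial (l : seq 'I_n) (f : 'rV[R]_n -> R) : 'rV[R]_n -> R :=
  if l is i :: l' then fun x => 'D_(delta_mx ord0 i) (iter_partial l' f) x
  else f.

Definition smooth (f : 'rV[R]_n -> R) : Prop :=
  forall l : seq 'I_n, continuous (iter_partial l f) /\
    forall x i, derivable (iter_partial l f) x (delta_mx ord0 i).

Definition test_function Om : set ('rV[R]_n -> R) :=
  [set phi | smooth phi /\ compactly_contained [set x | phi x != 0] Om].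

End euclidean.

(* A linear space of functions with its norm. Elements are functions and not
   classes of a.e. equal ones, so the norm is only a seminorm. *)
Record normed_fun_space (R : realType) (V : lmodType R) := NormedFunSpace {
  fs_carrier :> V -> Prop;
  fs_norm : V -> \bar R }.

Section spaces.
Context {R : realType} {n : nat}.
Implicit Types (D Om : set 'rV[R]_n) (u v : 'rV[R]_n -> R) (s p q alpha : R).

Local Notation mu := (@lebesgue_rV R n).

(* The [L^q(D)] norm, [q = +oo] included: [u \_ D] is [u] on [D] and [0]
   elsewhere. *)
Definition Lnorm_on D (q : \bar R) u : \bar R :=
  Lnorm mu q (EFin \o (u \_ D)).

Definition L2 D : normed_fun_space ('rV[R]_n -> R) := NormedFunSpace
  [set u : 'rV[R]_n -> R | measurable_fun D u /\ (Lnorm_on D 2%:E u < +oo)%E]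
  (Lnorm_on D 2%:E).

(* The [p]-th power of the Gagliardo seminorm. *)
Definition gagliardo s p D u : \bar R :=
  (\int[mu \x mu]_(z in D `*` D)
     (`|u z.1 - u z.2| `^ p * frac_kernel s p z)%:E)%E.

Definition sobolev_norm s p D u : \bar R :=
  ((gagliardo s p D u + \int[mu]_(x in D) (`|u x| `^ p)%:E) `^ p^-1)%E.

Definition sobolev s p D : normed_fun_space ('rV[R]_n -> R) := NormedFunSpace
  [set u : 'rV[R]_n -> R | measurable_fun D u /\ (sobolev_norm s p D u < +oo)%E]
  (sobolev_norm s p D).

Definition sobolev0 s p Om : normed_fun_space ('rV[R]_n -> R) := NormedFunSpace
  [set u | sobolev s p setT u /\
     exists phi : nat -> 'rV[R]_n -> R, (forall k, test_function Om (phi k)) /\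
       sobolev_norm s p setT (phi k - u) @[k --> \oo] --> 0%E]
  (sobolev_norm s p setT).

Definition tail_norm q alpha u : \bar R :=
  ((\int[mu]_x (`|u x| `^ q / (1 + enorm x `^ (n%:R + alpha)))%:E) `^ q^-1)%E.

Definition tail_space q alpha : normed_fun_space ('rV[R]_n -> R) :=
  NormedFunSpace
    [set u : 'rV[R]_n -> R | [/\ measurable_fun setT u,
       forall K : set 'rV[R]_n, compact K ->
         (\int[mu]_(x in K) (`|u x| `^ q)%:E < +oo)%E &
       (tail_norm q alpha u < +oo)%E]]
    (tail_norm q alpha).

Definition X0 s p Om Om' : normed_fun_space ('rV[R]_n -> R) := NormedFunSpace
  [set v | [/\ sobolev s p Om' v, tail_space (p - 1) (s * p) v &
     {ae mu, forall x, (~` Om) x -> v x = 0}]]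
  (sobolev_norm s p Om').

End spaces.

Section dual.
Context {R : realType} {V : lmodType R}.
Implicit Types (E : normed_fun_space V) (l : V -> R^o).

Definition dual_norm E l : \bar R :=
  ereal_sup [set `|l v|%:E | v in [set v | E v /\ (fs_norm E v <= 1)%E]].

(* Functionals are total on [V]; only their values on [E] matter. The duality
   pairing is application. *)
Definition dual E : normed_fun_space (V -> R^o) := NormedFunSpace
  [set l | (forall (a : R) v w, E v -> E w -> l (a *: v + w) = a *: l v + l w) /\
     (dual_norm E l < +oo)%E]
  (dual_norm E).

End dual.

Section bochner.
Context {R : realType} {V : lmodType R}.
Implicit Types (J : set R) (E : normed_fun_space V) (u du : R -> V).

Definition simple_fun E u : Prop :=
  exists (m : nat) (A : 'I_m -> set R) (c : 'I_m -> V),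
    [/\ forall i, measurable (A i), forall i, E (c i) &
      forall t, u t = \sum_(i < m) \1_(A i) t *: c i].

(* Bochner measurability: limit a.e. of simple functions, in the norm of [E]. *)
Definition strongly_measurable J E u : Prop :=
  exists g : nat -> R -> V, (forall k, simple_fun E (g k)) /\
    {ae lebesgue_measure, forall t : measurableTypeR R, J t ->
      E (u t) /\ fs_norm E (g k t - u t) @[k --> \oo] --> 0%E}.

Definition bochner_Lp (q : R) J E : set (R -> V) :=
  [set u | strongly_measurable J E u /\
    (\int[lebesgue_measure]_(t in J) (fs_norm E (u t) `^ q) < +oo)%E].

Definition bochner_Lp_loc (q : R) E : set (R -> V) :=
  [set u | forall T0 T1, 0 < T0 -> T0 < T1 -> bochner_Lp q `[T0, T1] E u].

Definition C0_on J E : set (R -> V) :=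
  [set u | forall t, J t -> E (u t) /\
    fs_norm E (u r - u t) @[r --> within J (nbhs t)] --> 0%E].

(* [u] is [C^1] on [J] with derivative [du], one-sided at the end points. *)
Definition C1_on J E u du : Prop :=
  [/\ C0_on J E u, C0_on J E du & forall t, J t ->
    fs_norm E ((r - t)^-1 *: (u r - u t) - du t)
      @[r --> within J t^'] --> 0%E].

End bochner.

Section equation.
Context {R : realType} {n : nat}.
Implicit Types (Om : set 'rV[R]_n) (u v : R -> 'rV[R]_n -> R) (s p : R).

Local Notation mu := (@lebesgue_rV R n).
Local Notation leb := (@lebesgue_measure R).

Definition Jp p (t : R) : R := `|t| `^ (p - 2) * t.

Definition weak_solution s p Om Om' (f : R -> ('rV[R]_n -> R) -> R^o) u : Prop :=
  forall T0 T1 : R, 0 < T0 -> T0 < T1 -> let J := `[T0, T1]%classic in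
  [/\ bochner_Lp p J (sobolev s p Om') u,
      bochner_Lp (p - 1) J (tail_space (p - 1) (s * p)) u,
      C0_on J (L2 Om) u &
      forall phi dphi : R -> 'rV[R]_n -> R,
        bochner_Lp p J (X0 s p Om Om') phi -> C1_on J (L2 Om) phi dphi ->
        - (\int[leb]_(t in J) \int[mu]_(x in Om) (u t x * dphi t x))
        + \int[leb]_(t in J) \int[(mu \x mu)%E]_z
            (Jp p (u t z.1 - u t z.2) * (phi t z.1 - phi t z.2)
               * frac_kernel s p z)
        = \int[mu]_(x in Om) (u T0 x * phi T0 x)
          - \int[mu]_(x in Om) (u T1 x * phi T1 x)
          + \int[leb]_(t in J) (f t (phi t))].

End equation.

(* Main.v *)
(* With w = v - u, test both equations with functions phi that are constant in
   time, so that f cancels. For a level k take phi = 1_Om clip (w - k). Because w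
   vanishes off Om and some unit mass at bounded distance lies off Om, strong
   monotonicity of J_p gives the absorption
     form(v, phi) - form(u, phi) >= c k^(p-1) int phi,
   with c depending on Om, n, p, s only. For k(t) = A (t - a + kappa)^(-1/(p-2)),
   a subsolution of k' = -c k^(p-1), the energy
     E(t) = int_Om clip_prim (w(t) - k(t))
   is nonincreasing: on a short interval [r, t], convexity of clip_prim and the
   absorption at the frozen time t give E(t) <= E(r) + (error of freezing), and
   Bochner measurability bounds the error by int_[r,t] G + (t - r) G(t) with the
   integral of G arbitrarily small; the errors are summed over a grid of times
   at which G is at most its local mean. As kappa -> 0, k(a) -> oo and E(a) -> 0, so
   w(b) <= A (b - a)^(-1/(p-2)). Take a = b / 2 and exchange u and v. *)

From HB Require Import structures.
Require Import Defs.
From mathcomp Require Import all_boot all_order all_algebra.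
From mathcomp Require Import all_classical all_reals all_analysis.
From mathcomp Require Import measurable_realfun ring lra.

Import Order.TTheory GRing.Theory Num.Theory.
Import numFieldNormedType.Exports.

Local Open Scope classical_set_scope.
Local Open Scope ring_scope.

(** * Scalar inequalities *)

(** Solutions have no time derivative, and a test function built from [w t] is not known to be C^1
    in time. Trajectories in W^{s,p} are only Bochner measurable, so this comparison holds at almost
    all times and is small only in mean. Hence the times are picked from a set of full measure, and
    the end times are reached by L^2 continuity. Far from Om only powers p - 1 of u and v are
    integrable, so the test function has to be bounded; this is why [clip] replaces the positive
    part. Neither the norm of [u t] nor the form at [u t] is known to be measurable in t, so
    measurable majorants, or bounds from both sides, stand in for them. The moduli of freezing may
    depend on u, v and the larger domain D, because they disappear in the limit; the final constant
    is made of the absorption constant and p. *)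

Section real_inequalities.
Context {R : realType}.
Implicit Types (p q r x y a b : R).

Lemma le_powRl r x y : 0 <= r -> 0 <= x -> x <= y -> x `^ r <= y `^ r.
Proof.
move=> r0 x0 xy; apply: (ge0_ler_powR r0) => //; rewrite nnegrE//.
exact: le_trans xy.
Qed.

Lemma powRS r x : 0 <= r -> 0 <= x -> x `^ (r + 1) = x * x `^ r.
Proof.
move=> r0 x0; rewrite -(@mulr_powRB1 _ x (r + 1))//; first by rewrite addrK.
by rewrite ltr_wpDl.
Qed.

Lemma powRD_le q x y : 0 <= q -> 0 <= x -> 0 <= y ->
  (x + y) `^ q <= 2 `^ q * (x `^ q + y `^ q).
Proof.
move=> q0; wlog xy : x y / x <= y => [H x0 y0|x0 y0].
  have [xy|/ltW yx] := leP x y; first exact: H.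
  by rewrite addrC [X in _ * X]addrC; exact: H.
have : (x + y) `^ q <= (2 * y) `^ q.
  by apply: le_powRl => //; [exact: addr_ge0|rewrite mulr_natl mulr2n lerD2r].
move=> /le_trans; apply; rewrite powRM// ler_wpM2l ?powR_ge0//.
by rewrite lerDr powR_ge0.
Qed.

(** Writing z^q = z * z^(q-1) leaves only the monotonicity of z^(q-1). *)
Lemma powR_superadd q x y : 1 <= q -> 0 <= x -> 0 <= y ->
  x `^ q + y `^ q <= (x + y) `^ q.
Proof.
move=> q1 x0 y0; have q0 : 0 <= q - 1 by rewrite subr_ge0.
have e z : 0 <= z -> z `^ q = z * z `^ (q - 1).
  by move=> z0; rewrite -powRS// subrK.
rewrite !e ?addr_ge0// mulrDl lerD// ler_wpM2l// le_powRl//.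
  by rewrite lerDl.
by rewrite lerDr.
Qed.

(** Young's inequality for the product r * 1 with exponents q and q / (q - 1), multiplied by q. *)
Lemma powR_bernoulli q r : 1 < q -> 0 <= r -> 1 - r `^ q <= q * (1 - r).
Proof.
move=> q1 r0; have q0 : 0 < q by exact: lt_trans q1.
have := @conjugate_powR R r 1 q (q / (q - 1)) r0 ler01 q0.
rewrite divr_gt0 ?subr_gt0// => /(_ isT).
have -> : q^-1 + (q / (q - 1))^-1 = 1.
  by field; rewrite subr_eq0 !gt_eqF.
move=> /(_ erefl); rewrite mulr1 powR1 mul1r.
rewrite -(ler_pM2r q0) mulrDl divfK ?gt_eqF// => h.
have e : (q / (q - 1))^-1 * q = q - 1.
  by field; rewrite subr_eq0 !gt_eqF.
rewrite e in h; lra.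
Qed.

(** Homogeneity reduces this mean value bound to [powR_bernoulli] at b / a; no derivative is
    taken. *)
Lemma powR_lip q a b : 1 < q -> 0 <= b -> b <= a ->
  a `^ q - b `^ q <= q * (a - b) * a `^ (q - 1).
Proof.
move=> q1 b0 ba; have q0 : 0 < q by exact: lt_trans q1.
have [a0|a0] := leP a 0.
  have -> : b = a by apply/eqP; rewrite eq_le ba (le_trans a0).
  by rewrite !subrr mulr0 mul0r.
have q10 : 0 <= q - 1 by rewrite subr_ge0 ltW.
have ae : a `^ q = a * a `^ (q - 1) by rewrite -powRS ?subrK// ltW.
have be : b `^ q = a `^ q * (b / a) `^ q.
  by rewrite -powRM ?divr_ge0 ?(ltW a0)// mulrCA divff ?gt_eqF// mulr1.
have -> : q * (a - b) * a `^ (q - 1) = a `^ q * (q * (1 - b / a)).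
  by rewrite ae; field; rewrite gt_eqF.
rewrite be -{1}[a `^ q]mulr1 -mulrBr ler_wpM2l ?powR_ge0// powR_bernoulli//.
by rewrite divr_ge0// ltW.
Qed.

Lemma JpN p a : Jp p (- a) = - Jp p a.
Proof. by rewrite /Jp normrN mulrN. Qed.

Lemma Jp_ge0 p a : 2 < p -> 0 <= a -> Jp p a = a `^ (p - 1).
Proof.
move=> p2 a0; rewrite /Jp ger0_norm// mulrC -powRS//.
  by congr (_ `^ _); lra.
by lra.
Qed.

Lemma Jp0 p : Jp p 0 = 0. Proof. by rewrite /Jp mulr0. Qed.

(** For arguments of equal sign superadditivity of x^(p-1) gives the bound even without the factor
    1/2. For opposite signs the difference is a^(p-1) + |b|^(p-1), and the larger of a and |b| is at
    least (a - b) / 2. *)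
Lemma Jp_strong_mono p a b : 2 < p -> b <= a ->
  ((a - b) / 2) `^ (p - 1) <= Jp p a - Jp p b.
Proof.
move=> p2 ba; have q1 : 1 <= p - 1 by lra.
have pos x y : 0 <= y -> y <= x -> ((x - y) / 2) `^ (p - 1) <= Jp p x - Jp p y.
  move=> y0 yx; rewrite !Jp_ge0//; last exact: le_trans yx.
  have d0 : 0 <= x - y by rewrite subr_ge0.
  have := @powR_superadd (p - 1) y (x - y) q1 y0 d0.
  have -> : y + (x - y) = x by ring.
  move=> h; rewrite lerBrDr (le_trans _ h)// addrC lerD2l.
  apply: le_powRl; [lra..].
have [b0|b0] := leP 0 b; first exact: pos.
have [a0|a0] := leP a 0.
  have := pos (- b) (- a); rewrite !JpN => h.
  have -> : a - b = - b - - a by ring.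
  have -> : Jp p a - Jp p b = - Jp p b - - Jp p a by ring.
  by apply: h; lra.
have -> : Jp p b = - (- b) `^ (p - 1) by rewrite -Jp_ge0 ?JpN ?opprK//; lra.
rewrite opprK Jp_ge0 ?(ltW a0)//.
have [h|h] := leP a (- b).
  apply: (@le_trans _ _ ((- b) `^ (p - 1))); last by rewrite lerDr powR_ge0.
  by apply: le_powRl; lra.
apply: (@le_trans _ _ (a `^ (p - 1))); last by rewrite lerDl powR_ge0.
by apply: le_powRl; lra.
Qed.

Lemma Jp_mono p a b : 2 < p -> b <= a -> Jp p b <= Jp p a.
Proof.
by move=> p2 ba; rewrite -subr_ge0 (le_trans _ (Jp_strong_mono _ _ _ p2 ba))// powR_ge0.
Qed.

(** The same split by sign: [powR_lip] on one side of 0, superadditivity across it, where |a - b| =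
    |a| + |b|. *)
Lemma Jp_lip p a b : 2 < p ->
  `|Jp p a - Jp p b| <= (p - 1) * (`|a - b| * (`|a| + `|b|) `^ (p - 2)).
Proof.
move=> p2; have q1 : 1 < p - 1 by lra.
have e2 : p - 1 - 1 = p - 2 by ring.
wlog ba : a b / b <= a => [H|].
  have [ab|/ltW ab] := leP b a; first exact: H.
  by rewrite distrC [`|a - b|]distrC [`|a| + _]addrC; exact: H.
rewrite ger0_norm ?subr_ge0 ?Jp_mono// (@ger0_norm _ (a - b)) ?subr_ge0//.
rewrite mulrA.
have pos x y : 0 <= y -> y <= x ->
    Jp p x - Jp p y <= (p - 1) * (x - y) * (`|x| + `|y|) `^ (p - 2).
  move=> y0 yx; rewrite !Jp_ge0//; last exact: le_trans yx.
  apply: le_trans (powR_lip _ _ _ q1 y0 yx) _.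
  rewrite e2 ler_wpM2l// ?mulr_ge0 ?subr_ge0//; first by lra.
  by apply: le_powRl; [lra|lra|rewrite !ger0_norm//; lra].
have [b0|b0] := leP 0 b; first exact: pos.
have [a0|a0] := leP a 0.
  have := pos (- b) (- a); rewrite !JpN !normrN => h.
  have -> : a - b = - b - - a by ring.
  have -> : Jp p a - Jp p b = - Jp p b - - Jp p a by ring.
  by rewrite [`|a| + _]addrC; apply: h; lra.
have -> : Jp p b = - (- b) `^ (p - 1) by rewrite -Jp_ge0 ?JpN ?opprK//; lra.
rewrite opprK Jp_ge0 ?(ltW a0)//.
rewrite gtr0_norm// ltr0_norm//.
have b1 : 0 <= - b by lra.
have := powR_superadd _ _ _ (ltW q1) (ltW a0) b1.
move=> /le_trans; apply.
have -> : p - 1 = p - 2 + 1 by ring.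
rewrite powRS; [|lra|lra].
rewrite -[X in X <= _]mul1r -mulrA ler_wpM2r ?mulr_ge0 ?powR_ge0//; lra.
Qed.

(** A Young inequality with an explicit weight: if x <= d y the first term dominates, otherwise y <
    x / d and the second does. *)
Lemma powR_absorb r d x y : 0 <= r -> 0 < d -> 0 <= x -> 0 <= y ->
  x * y `^ r <= d * y `^ (r + 1) + d `^ (- r) * x `^ (r + 1).
Proof.
move=> r0 d0 x0 y0; rewrite !powRS//.
have [xy|xy] := leP x (d * y).
  apply: (@le_trans _ _ (d * (y * y `^ r))).
    by rewrite mulrA ler_wpM2r ?powR_ge0.
  by rewrite lerDl !mulr_ge0 ?powR_ge0.
apply: (@le_trans _ _ (d `^ (- r) * (x * x `^ r))); last first.
  by rewrite lerDr !mulr_ge0 ?powR_ge0// ltW.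
rewrite mulrCA ler_wpM2l//.
have : y `^ r <= (d^-1 * x) `^ r.
  apply: le_powRl => //; rewrite -(ler_pM2l d0) mulrA divff ?gt_eqF// mul1r.
  exact: ltW.
by rewrite powRM ?invr_ge0 ?(ltW d0)// -powR_inv1 ?(ltW d0)// -powRrM mulN1r.
Qed.

End real_inequalities.

(** * Null sets, integrals of possibly nonmeasurable functions, and finite-valued maps *)

Lemma ae_imply d (T : measurableType d) (R : realType)
    (mu : {measure set T -> \bar R}) (P Q : T -> Prop) :
  (forall x, P x -> Q x) -> {ae mu, forall x, P x} -> {ae mu, forall x, Q x}.
Proof. by move=> PQ; apply: filterS => x; exact: PQ. Qed.

Lemma ae_imply2 d (T : measurableType d) (R : realType)
    (mu : {measure set T -> \bar R}) (P Q S : T -> Prop) :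
  (forall x, P x -> Q x -> S x) -> {ae mu, forall x, P x} ->
  {ae mu, forall x, Q x} -> {ae mu, forall x, S x}.
Proof. by move=> PQS; apply: filterS2 => x; exact: PQS. Qed.

Lemma measurable_fun_powR d (T : measurableType d) (R : realType) (D : set T)
  (f : T -> R) (q : R) : measurable_fun D f -> measurable_fun D (fun x => f x `^ q).
Proof. exact: (@measurableT_comp _ _ _ _ _ _ (@powR R ^~ q)). Qed.

Section arbitrary_integrands.
Context d (T : measurableType d) (R : realType).
Variable mu : {measure set T -> \bar R}.
Import HBNNSimple.

(* No measurability: the integral of a nonnegative function is the supremum of
   the integrals of the simple functions below it. *)
Lemma ae_ge0_le_integral_any (D : set T) (f g : T -> \bar R) : measurable D ->
  (forall x, D x -> (0 <= f x)%E) -> (forall x, D x -> (0 <= g x)%E) ->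
  {ae mu, forall x, D x -> (f x <= g x)%E} ->
  (\int[mu]_(x in D) f x <= \int[mu]_(x in D) g x)%E.
Proof.
move=> mD f0 g0 [N [mN N0 fgN]].
rewrite (ge0_integralE _ f0) (ge0_integralE _ g0).
apply: ge_ereal_sup => _ [h hf <-].
have mNC : measurable (~` N) by exact: measurableC.
(* Setting h to 0 on the null set N keeps its integral and puts it below g everywhere, so it
   competes in the supremum for g. *)
pose h' : {nnsfun T >-> R} := mul_nnsfun h (indic_nnsfun R mNC).
have h'E x : h' x = h x * \1_(~` N) x by [].
have -> : sintegral mu h = sintegral mu h'.
  rewrite -!integralT_nnsfun; apply: ge0_ae_eq_integral => //.
  - exact/measurable_EFinP.
  - exact/measurable_EFinP.
  - by move=> x _; rewrite lee_fin.
  - by move=> x _; rewrite lee_fin.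
  exists N; split => // x /= H; apply: contrapT => Nx; apply: H => _.
  have e : h' x = h x by rewrite h'E indicE mem_set// mulr1.
  exact: (esym (congr1 EFin e)).
apply: ereal_sup_ubound; exists h' => // x.
have -> : (h' x)%:E = (h x * \1_(~` N) x)%:E by [].
rewrite indicE; have [Nx|Nx] := boolP (x \in ~` N); last first.
  rewrite mulr0 /patch; case: ifPn => // xD.
  by apply: g0; rewrite inE in xD.
rewrite mulr1; apply: le_trans (hf x) _; rewrite /patch.
case: ifPn => // xD; rewrite !inE in xD Nx.
by apply: contrapT => H; apply: Nx; apply: fgN => /= H'; apply: H; exact: H'.
Qed.

(** The integral of any f is that of its positive part minus that of its negative part, and each is
    monotone without measurability. The two bounds make both finite. Needed because the form along a
    trajectory is not known to be measurable in time. *)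
Lemma Rintegral_sandwich (D : set T) (f g1 g2 : T -> R) : measurable D ->
  mu.-integrable D (EFin \o g1) -> mu.-integrable D (EFin \o g2) ->
  {ae mu, forall x, D x -> g1 x <= f x <= g2 x} ->
  \int[mu]_(x in D) g1 x <= \int[mu]_(x in D) f x <= \int[mu]_(x in D) g2 x.
Proof.
move=> mD i1 i2 [N [mN N0 gfN]].
have ae (P : T -> Prop) : (forall x, ~ N x -> D x -> P x) ->
    {ae mu, forall x, D x -> P x}.
  move=> h; exists N; split => // x /= H; apply: contrapT => Nx; apply: H.
  exact: h.
have gf x : ~ N x -> D x -> (g1 x <= f x) /\ (f x <= g2 x).
  move=> Nx Dx; apply/andP; apply: contrapT => H; apply: Nx; apply: gfN => /= H'.
  by apply: H; exact: H'.
have le_pos (a b : T -> R) : (forall x, ~ N x -> D x -> a x <= b x) ->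
    (\int[mu]_(x in D) (EFin \o a)^\+ x <= \int[mu]_(x in D) (EFin \o b)^\+ x)%E.
  move=> ab; apply: ae_ge0_le_integral_any => //.
  apply: ae => x Nx Dx; rewrite !funeposE /= -!EFin_max lee_fin.
  by rewrite ge_max !le_max ab// lexx orbT.
have le_neg (a b : T -> R) : (forall x, ~ N x -> D x -> a x <= b x) ->
    (\int[mu]_(x in D) (EFin \o b)^\- x <= \int[mu]_(x in D) (EFin \o a)^\- x)%E.
  move=> ab; apply: ae_ge0_le_integral_any => //.
  apply: ae => x Nx Dx; rewrite !funenegE /= -!EFin_max lee_fin.
  by rewrite ge_max !le_max lerN2 ab// lexx orbT.
have g1f x : ~ N x -> D x -> g1 x <= f x by move=> Nx Dx; have [] := gf x Nx Dx.
have fg2 x : ~ N x -> D x -> f x <= g2 x by move=> Nx Dx; have [] := gf x Nx Dx.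
have f1 : (\int[mu]_(x in D) (f x)%:E)%E \is a fin_num.
  rewrite integralE fin_numB; apply/andP; split.
    rewrite ge0_fin_numE ?integral_ge0//; apply: le_lt_trans (le_pos _ _ fg2) _.
    exact: integral_funepos_lt_pinfty.
  rewrite ge0_fin_numE ?integral_ge0//; apply: le_lt_trans (le_neg _ _ g1f) _.
  exact: integral_funeneg_lt_pinfty.
rewrite /Rintegral -!lee_fin !fineK//; [|exact: integrable_fin_num..].
by apply/andP; split; rewrite [leLHS]integralE [leRHS]integralE;
  apply: leeB; [exact: le_pos|exact: le_neg|exact: le_pos|exact: le_neg].
Qed.

End arbitrary_integrands.

Section product_ae.
Context d1 d2 (T1 : measurableType d1) (T2 : measurableType d2) (R : realType).
Variables (m1 : {sigma_finite_measure set T1 -> \bar R})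
  (m2 : {sigma_finite_measure set T2 -> \bar R}).

Lemma ae_prod1 (P : T1 -> Prop) : {ae m1, forall x, P x} ->
  {ae (m1 \x m2)%E, forall z, P z.1}.
Proof.
move=> [N [mN N0 PN]]; exists (N `*` setT); split.
- exact: measurableX.
- by rewrite product_measure1E//= N0 mul0e.
- by move=> z /= /PN.
Qed.

Lemma ae_prod2 (P : T2 -> Prop) : {ae m2, forall x, P x} ->
  {ae (m1 \x m2)%E, forall z, P z.2}.
Proof.
move=> [N [mN N0 PN]]; exists (setT `*` N); split.
- exact: measurableX.
- by rewrite product_measure1E//= N0 mule0.
- by move=> z /= /PN.
Qed.

End product_ae.

Section compact_separation.
Context {R : realType} {U : normedModType R}.

(** Near each point of A every small h bounds the distance to B from below; compactness in its
    near-covering form yields one h for all of A. *)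
Lemma compact_closed_dist (A B : set U) : compact A -> closed B -> A `&` B = set0 ->
  exists2 d : R, 0 < d & forall x y, A x -> B y -> d <= `|x - y|.
Proof.
move=> /compact_near_coveringP cA cB AB.
have : \forall h \near (0 : R)^'+, A `<=` [set x | forall y, B y -> h <= `|x - y|].
  apply: cA => x Ax.
  have : nbhs x (~` B).
    apply: open_nbhs_nbhs; split; first exact: closed_openC.
    by move=> Bx; have : (A `&` B) x by []; rewrite AB.
  move=> /nbhs_ballP[e /= e0 xe].
  near=> x' h => /= y By; rewrite leNgt; apply/negP => H.
  apply: (xe y) => //; rewrite -ball_normE /=.
  have -> : x - y = (x - x') + (x' - y) by rewrite addrA subrK.
  apply: le_lt_trans (ler_normD _ _) _; rewrite (splitr e); apply: ltrD.
    near: x'; apply/nbhs_ballP; exists (e / 2) => /=; first exact: divr_gt0.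
    by move=> z; rewrite -ball_normE.
  apply: lt_trans H _; near: h; apply: nbhs_right_lt; exact: divr_gt0.
move=> H; near (0 : R)^'+ => h; exists h => //.
have hA : A `<=` [set x | forall y, B y -> h <= `|x - y|] by near: h.
by move=> x y /hA; exact.
Unshelve. all: by end_near. Qed.

End compact_separation.

Section limn_esup_bounds.
Context {R : realType}.
Local Open Scope ereal_scope.
Implicit Types (f : (\bar R)^nat) (a : \bar R).

Lemma limn_esup_le_near f a : (\forall n \near \oo, f n <= a) -> limn_esup f <= a.
Proof.
move=> [N _ fa]; rewrite limn_esup_lim; apply: lime_le; first exact: is_cvg_esups.
exists N => // n /= Nn; apply: ge_ereal_sup => _ [k /= nk <-].
by apply: fa => /=; exact: leq_trans nk.
Qed.

Lemma limn_esup_ge_near f a : (\forall n \near \oo, a <= f n) -> a <= limn_esup f.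
Proof.
move=> [N _ fa]; rewrite limn_esup_lim; apply: lime_ge; first exact: is_cvg_esups.
exists N => // n /= Nn; apply: le_trans (fa n Nn) _.
by apply: ereal_sup_ubound; exists n => /=.
Qed.

Lemma cvge0_le_near f (e : R) : (0 < e)%R -> f @ \oo --> 0 ->
  \forall n \near \oo, f n <= e%:E.
Proof.
move=> e0 /fine_cvgP[ffin /cvgrPdist_le/(_ _ e0) fe].
near=> n; have fn : f n \is a fin_num by near: n.
rewrite -(fineK fn) lee_fin; apply: le_trans (ler_norm _) _.
by rewrite -normrN -sub0r; near: n.
Unshelve. all: by end_near. Qed.

End limn_esup_bounds.

Section measurable_finite_range.
Context d (X : measurableType d) {R : realType}.

(** The function spaces carry no sigma-algebra. A map with finitely many values is therefore
    factored through a finite type, on which any F is harmless. *)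
Lemma measurable_fun_finite (T : finType) (b : X -> T) (F : T -> \bar R) :
  (forall x, measurable (b @^-1` [set x])) ->
  measurable_fun [set: X] (F \o b).
Proof.
move=> mb _ Y mY; rewrite setTI.
rewrite (_ : _ @^-1` _ = \bigcup_(x in [set x | Y (F x)]) b @^-1` [set x]).
  by apply: fin_bigcup_measurable.
apply/seteqP; split => [t /= Yt|t [x /= Yx bt]]; first by exists (b t).
by rewrite /= bt.
Qed.

Lemma measurable_pair_finite (T1 T2 : finType) (b1 : X -> T1) (b2 : X -> T2) :
  (forall x, measurable (b1 @^-1` [set x])) ->
  (forall x, measurable (b2 @^-1` [set x])) ->
  forall x, measurable ((fun t => (b1 t, b2 t)) @^-1` [set x]).
Proof.
move=> m1 m2 [x y]; rewrite (_ : _ @^-1` _ = b1 @^-1` [set x] `&` b2 @^-1` [set y]).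
  exact: measurableI.
by apply/seteqP; split => t /= [-> ->].
Qed.

Lemma measurable_preimage_bool (A : set X) (x : bool) : measurable A ->
  measurable ((fun t => `[< A t >]) @^-1` [set x]).
Proof.
move=> mA; case: x.
  rewrite (_ : _ @^-1` _ = A)//.
  by apply/seteqP; split => t /=; [move/asboolP|move=> ?; exact/asboolP].
rewrite (_ : _ @^-1` _ = ~` A); first exact: measurableC.
by apply/seteqP; split => t /=; [move/asboolP|move=> ?; exact/asboolP].
Qed.

End measurable_finite_range.

(** * Bochner measurable functions *)

Section bochner.
Context {R : realType} {V : lmodType R}.
Variables (E : normed_fun_space V) (q K : R).
Hypothesis q0 : 0 < q.
Hypothesis K1 : 1 <= K.
Local Notation Q f := (fs_norm E f `^ q)%E.
Local Notation leb := (@lebesgue_measure R).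
Hypothesis E0 : E 0.
Hypothesis EZD : forall (a : R) f g, E f -> E g -> E (a *: f + g).
Hypothesis N_ge0 : forall f, (0 <= fs_norm E f)%E.
Hypothesis N0 : fs_norm E 0 = 0%E.
Hypothesis NN : forall f, fs_norm E (- f) = fs_norm E f.
Hypothesis Nfin : forall f, E f -> (fs_norm E f < +oo)%E.
(** A quasi-triangle inequality for the q-th power replaces Minkowski's inequality. It is used with
    K = 2^q for [sobolev] (q = p) and [tail_space] (q = p - 1). *)
Hypothesis QD : forall f g, E f -> E g -> (Q (f + g) <= K%:E * (Q f + Q g))%E.

Let ED f g : E f -> E g -> E (f + g).
Proof. by move=> Ef Eg; rewrite -[f]scale1r; exact: EZD. Qed.

Let EN f : E f -> E (- f).
Proof. by move=> Ef; rewrite -[- f]addr0 -scaleN1r; exact: EZD. Qed.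

Let EB f g : E f -> E g -> E (f - g).
Proof. by move=> Ef Eg; apply: ED => //; exact: EN. Qed.

Let Q_ge0 f : (0 <= Q f)%E. Proof. exact: poweR_ge0. Qed.
Let QN f : Q (- f) = Q f. Proof. by rewrite NN. Qed.
Let QC f g : Q (f - g) = Q (g - f). Proof. by rewrite -QN opprB. Qed.
Let Q0 : Q 0 = 0%E. Proof. by rewrite N0 poweR0r// gt_eqF. Qed.

Let Qfin f : E f -> Q f \is a fin_num.
Proof.
move=> Ef; apply: fin_num_poweR; rewrite ge0_fin_numE//; exact: Nfin.
Qed.

Let K0 : 0 < K. Proof. exact: lt_le_trans K1. Qed.

Let Qtri f g : E f -> E g -> (Q f <= K%:E * (Q (f - g) + Q g))%E.
Proof. by move=> Ef Eg; rewrite -{1}[f](subrK g); apply: QD => //; exact: EB. Qed.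

Let fin_meas (g : R -> V) := exists (T : finType) (b : measurableTypeR R -> T) (c : T -> V),
  [/\ forall x, measurable (b @^-1` [set x]), forall x, E (c x) &
      forall t, g t = c (b t)].

Let fin_meas_E g t : fin_meas g -> E (g t).
Proof. by case=> T [b [c [_ Ec ->]]]. Qed.

(** The sets [A i] of a simple function may overlap, so the index of t is the vector of its
    memberships. *)
Let simple_fin_meas g : simple_fun E g -> fin_meas g.
Proof.
move=> [m [A [c [mA Ec gE]]]].
exists {ffun 'I_m -> bool}, (fun t => [ffun i => `[< A i t >]]),
  (fun f : {ffun 'I_m -> bool} => \sum_(i < m) (f i)%:R *: c i); split.
- move=> f; rewrite (_ : _ @^-1` _ =
    \bigcap_(i in [set: 'I_m]) ((fun t => `[< A i t >]) @^-1` [set f i])).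
    apply: fin_bigcap_measurable => // i _; apply: measurable_preimage_bool.
    exact: mA.
  apply/seteqP; split => [t /= <- i _|t H] /=; first by rewrite ffunE.
  by apply/ffunP => i; rewrite ffunE; exact: H.
- move=> f; elim/big_ind : _ => // i _.
  by rewrite -[_ *: _]addr0; exact: EZD.
- move=> t; rewrite gE; apply: eq_bigr => i _; rewrite ffunE indicE.
  by congr (_%:R *: _); apply/idP/asboolP; rewrite inE.
Qed.

Let measurable_Q2 g h : fin_meas g -> fin_meas h ->
  measurable_fun setT (fun t : measurableTypeR R => Q (g t - h t)).
Proof.
move=> [T1 [b1 [c1 [m1 _ g1]]]] [T2 [b2 [c2 [m2 _ g2]]]].
rewrite (_ : (fun t => _) =
  (fun x => Q (c1 x.1 - c2 x.2)) \o (fun t => (b1 t, b2 t))).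
  apply: measurable_fun_finite; exact: measurable_pair_finite.
by apply/funext => t /=; rewrite g1 g2.
Qed.

Let fin_meas_trunc g (A : set (measurableTypeR R)) : measurable A -> fin_meas g ->
  fin_meas (fun t => if `[< A t >] then g t else 0).
Proof.
move=> mA [T [b [c [mb Ec gE]]]].
exists (T * bool)%type, (fun t => (b t, `[< A t >])), (fun x => if x.2 then c x.1 else 0).
split.
- by apply: measurable_pair_finite => // x; exact: measurable_preimage_bool.
- by move=> [x []] /=.
- by move=> t /=; case: ifP; rewrite ?gE.
Qed.

Let cvgQ (f : V ^nat) :
  fs_norm E (f k) @[k --> \oo] --> 0%E -> forall e : R, 0 < e ->
  \forall k \near \oo, (Q (f k) <= e%:E)%E.
Proof.
move=> f0 e e0; have e1 : 0 < e `^ q^-1 by exact: powR_gt0.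
have := cvge0_le_near _ _ e1 f0; apply: filterS => k fk.
have -> : e = (e `^ q^-1) `^ q.
  by rewrite -powRrM mulVf ?gt_eqF// powRr1// ltW.
by rewrite -poweR_EFin; apply: gt0_ler_poweR => //;
  rewrite ?in_itv/= ?N_ge0 ?leey ?lee_fin ?ltW.
Qed.

(** Q is only quasi-subadditive, so the limit of [Q (f j)] need not be [Q x]. This and [limQ_ge]
    compare [Q x] with the upper limit up to constants; along finite-valued approximants the upper
    limit is measurable in t, which is not known of [Q (u t)]. *)
Let limQ_le x (f : V ^nat) : E x -> (forall j, E (f j)) ->
  (forall e : R, 0 < e -> \forall j \near \oo, (Q (f j - x) <= e%:E)%E) ->
  (limn_esup (fun j => Q (f j)) <= K%:E * Q x)%E.
Proof.
move=> Ex Ef fx; apply/lee_addgt0Pr => e e0.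
apply: limn_esup_le_near.
have eK : 0 < e / K by exact: divr_gt0.
apply: filterS (fx _ eK) => j h; apply: le_trans (Qtri _ _ (Ef j) Ex) _.
rewrite ge0_muleDr// addeC leeD2l//.
apply: le_trans (lee_wpmul2l _ h) _; first by rewrite lee_fin ltW.
by rewrite -EFinM mulrC divfK// gt_eqF.
Qed.

Let limQ_ge x (f : V ^nat) : E x -> (forall j, E (f j)) ->
  (forall e : R, 0 < e -> \forall j \near \oo, (Q (f j - x) <= e%:E)%E) ->
  (Q x <= (2 * K)%:E * limn_esup (fun j => Q (f j)))%E.
Proof.
move=> Ex Ef fx; have [->|Qx0] := eqVneq (Q x) 0%E.
  apply: mule_ge0; first by rewrite lee_fin mulr_ge0// ltW.
  by apply: limn_esup_ge_near; apply: nearW => j.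
have Qxpos : 0 < fine (Q x).
  by rewrite fine_gt0// lt_neqAle eq_sym Qx0 Q_ge0/= -ge0_fin_numE ?Qfin.
(* Half of Q x / K: once the error is below it, the other half is left for [Q (f j)]. *)
have e0 : 0 < fine (Q x) / (2 * K) by rewrite divr_gt0// mulr_gt0.
have : ((fine (Q x) / (2 * K))%:E <= limn_esup (fun j => Q (f j)))%E.
  apply: limn_esup_ge_near; apply: filterS (fx _ e0) => j h.
  have := Qtri _ _ Ex (Ef j); rewrite QC.
  have Qj := Qfin _ (Ef j); have Qjx := Qfin _ (EB _ _ (Ef j) Ex).
  have Qx := Qfin _ Ex.
  move: h; rewrite -(fineK Qj) -(fineK Qjx) -{2}(fineK Qx) -EFinD -EFinM !lee_fin.
  move=> h1 h2; have {h2} : fine (Q x) / K <= fine (Q (f j - x)) + fine (Q (f j)).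
    by rewrite ler_pdivrMr// mulrC.
  have -> : fine (Q x) / K = fine (Q x) / (2 * K) + fine (Q x) / (2 * K).
    by field; rewrite gt_eqF.
  by lra.
move=> /(lee_wpmul2l _) -/(_ (2 * K)%:E); rewrite lee_fin mulr_ge0 ?(ltW K0)//.
move=> /(_ isT); rewrite -EFinM mulrC divfK ?fineK ?Qfin//.
by rewrite gt_eqF// mulr_gt0.
Qed.

(** Strong measurability gives only almost everywhere convergence, so the approximants are truncated
    to make dominated convergence available. All bounds are expressed through the approximants,
    because [Q (u t)] itself may fail to be measurable. *)
Lemma bochner_approx (J : set (measurableTypeR R)) (u : R -> V) (eps : R) :
  measurable J -> 0 < eps -> bochner_Lp q J E u ->
  exists (T : finType) (b : measurableTypeR R -> T) (c : T -> V)
    (e : measurableTypeR R -> \bar R),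
  [/\ (forall x, measurable (b @^-1` [set x])) /\ (forall x, E (c x)),
      measurable_fun setT e /\ (forall t, (0 <= e t)%E),
      (\int[leb]_(t in J) e t <= eps%:E)%E &
      {ae leb, forall t, J t -> E (u t) /\ (Q (u t - c (b t)) <= e t)%E}].
Proof.
move=> mJ eps0 [[g [sg gu]] Lu].
have fg k : fin_meas (g k) by exact: simple_fin_meas.
have Eg k t : E (g k t) by exact: fin_meas_E.
have mQ h : fin_meas h -> measurable_fun setT (fun t : measurableTypeR R => Q (h t)).
  move=> [T [b [c [mb Ec hE]]]].
  have -> : (fun t => Q (h t)) = (fun x => Q (c x)) \o b.
    by apply/funext => t /=; rewrite hE.
  exact: measurable_fun_finite.
(* A measurable substitute for [Q (u t)], comparable with it at good times. *)
pose m (t : measurableTypeR R) := limn_esup (fun j => Q (g j t)).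
have mm : measurable_fun setT m.
  by apply: measurable_fun_limn_esup => j; exact: mQ.
have m0 t : (0 <= m t)%E by apply: limn_esup_ge_near; apply: nearW => j.
(* If Q (g k - u) <= m and Q u <= 2 K m, the quasi-triangle inequality gives Q (g k) <= K (2 K + 1)
   m, so the truncation below is eventually inactive where m > 0. *)
pose L := K * (2 * K + 1).
have L0 : 0 < L by rewrite mulr_gt0// addr_gt0// mulr_gt0.
pose A k : set (measurableTypeR R) := [set t | (Q (g k t) <= L%:E * m t)%E].
have mA k : measurable (A k).
  rewrite -[A k]setTI; apply: measurable_lee => //; first exact: mQ.
  exact: measurable_funeM.
pose h k (t : R) := if `[< A k t >] then g k t else 0.
have fh k : fin_meas (h k) by exact: fin_meas_trunc.
have Eh k t : E (h k t) by exact: fin_meas_E.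
have QhL k t : (Q (h k t) <= L%:E * m t)%E.
  rewrite /h; case: ifPn => [/asboolP//|_].
  by rewrite Q0 mule_ge0// lee_fin ltW.
(* A measurable majorant of Q (u - h k) at good times; the factor 2 K is that of [limQ_ge]. *)
pose M k (t : measurableTypeR R) :=
  ((2 * K)%:E * limn_esup (fun j => Q (g j t - h k t)))%E.
have mM k : measurable_fun setT (M k).
  apply: measurable_funeM; apply: measurable_fun_limn_esup => j.
  exact: measurable_Q2.
have M0 k t : (0 <= M k t)%E.
  apply: mule_ge0; first by rewrite lee_fin mulr_ge0// ltW.
  by apply: limn_esup_ge_near; apply: nearW => j.
pose good t := E (u t) /\ (fs_norm E (g k t - u t) @[k --> \oo] --> 0%E).
have good_m t : good t -> (m t <= K%:E * Q (u t))%E.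
  by move=> [Et gt]; apply: limQ_le => //; exact: cvgQ.
have good_u t : good t -> (Q (u t) <= (2 * K)%:E * m t)%E.
  by move=> [Et gt]; apply: limQ_ge => //; exact: cvgQ.
have good_M1 k t : good t -> (Q (u t - h k t) <= M k t)%E.
  move=> [Et gt]; apply: limQ_ge => //; first exact: EB.
    by move=> j; exact: EB.
  move=> e e0; apply: filterS (cvgQ _ gt _ e0) => j.
  by rewrite opprB addrA subrK.
have good_M2 k t : good t -> (M k t <= (2 * K * K)%:E * Q (u t - h k t))%E.
  move=> [Et gt]; rewrite EFinM -muleA; apply: lee_wpmul2l.
    by rewrite lee_fin mulr_ge0// ltW.
  apply: limQ_le => //; first exact: EB.
    by move=> j; exact: EB.
  move=> e e0; apply: filterS (cvgQ _ gt _ e0) => j.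
  by rewrite opprB addrA subrK.
have good_fin t : good t -> m t \is a fin_num.
  move=> gt; rewrite ge0_fin_numE//; apply: le_lt_trans (good_m _ gt) _.
  by rewrite lte_mul_pinfty// ?lee_fin ?(ltW K0)// -ge0_fin_numE// Qfin//; case: gt.
(* From [good_M2], the quasi-triangle inequality, Q u <= 2 K m and Q (h k) <= L m. *)
pose D := 2 * K * K * (K * (2 * K + L)).
have good_D k t : good t -> (M k t <= D%:E * m t)%E.
  move=> gt; apply: le_trans (good_M2 k _ gt) _.
  rewrite /D [X in (X * m t)%E]EFinM -muleA; apply: lee_wpmul2l.
    by rewrite lee_fin !mulr_ge0 ?addr_ge0 ?mulr_ge0// ltW.
  apply: (@le_trans _ _ (K%:E * (Q (u t) + Q (h k t))))%E.
    rewrite -(QN (h k t)); apply: QD => //; first by case: gt.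
    exact: EN.
  rewrite EFinM -muleA; apply: lee_wpmul2l; first by rewrite lee_fin ltW.
  have LL : (0 <= L%:E :> \bar R)%E by rewrite lee_fin ltW.
  have KK : (0 <= (2 * K)%:E :> \bar R)%E by rewrite lee_fin mulr_ge0// ltW.
  rewrite EFinD ge0_muleDl//.
  by apply: leeD; [exact: good_u|exact: QhL].
have good_cvg : forall t, good t -> (M ^~ t) @ \oo --> 0%E.
  move=> t gt; have [Et gu0] := gt.
  have near_M (e : R) : 0 < e -> \forall k \near \oo, (M k t <= e%:E)%E.
    move=> e0.
    have e1 : 0 < e / (2 * K * K) by rewrite divr_gt0// !mulr_gt0.
    have step k : (Q (u t - h k t) <= (e / (2 * K * K))%:E)%E -> (M k t <= e%:E)%E.
      move=> H; apply: le_trans (good_M2 k _ gt) _.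
      apply: le_trans (lee_wpmul2l _ H) _; first by rewrite lee_fin !mulr_ge0// ltW.
      by rewrite -EFinM mulrC divfK// gt_eqF// !mulr_gt0.
    (* Where m = 0 the truncation may stay active for every k, but then Q u and Q (h k) both
       vanish. *)
    have [mt0|mt0] := eqVneq (m t) 0%E.
      apply: nearW => k; apply: step.
      have Qu0 : Q (u t) = 0%E.
        by apply/eqP; rewrite eq_le Q_ge0 andbT; have := good_u _ gt; rewrite mt0 mule0.
      have Qh0 : Q (h k t) = 0%E.
        by apply/eqP; rewrite eq_le Q_ge0 andbT; have := QhL k t; rewrite mt0 mule0.
      apply: le_trans (QD _ _ Et (EN _ (Eh k t))) _.
      by rewrite QN Qu0 Qh0 adde0 mule0 lee_fin ltW.
    have mpos : 0 < fine (m t).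
      by rewrite fine_gt0// lt_neqAle eq_sym mt0 m0/= -ge0_fin_numE ?good_fin.
    near=> k.
    have Ak : A k t.
      have H : (Q (g k t - u t) <= (fine (m t))%:E)%E by near: k; exact: cvgQ.
      apply: le_trans (Qtri _ _ (Eg k t) Et) _.
      rewrite /L EFinM -muleA; apply: lee_wpmul2l; first by rewrite lee_fin ltW.
      have KK : (0 <= (2 * K)%:E :> \bar R)%E by rewrite lee_fin mulr_ge0// ltW.
      rewrite EFinD ge0_muleDl// [leLHS]addeC.
      apply: leeD; first exact: good_u.
      by rewrite mul1e; rewrite fineK ?good_fin in H.
    apply: step; rewrite /h; case: asboolP => // _.
    by rewrite QC; near: k; exact: cvgQ.
  apply/fine_cvgP; split.
    apply: filterS (near_M 1 ltr01) => k Mk.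
    by rewrite ge0_fin_numE//; apply: le_lt_trans Mk _; rewrite ltry.
  apply/cvgrPdist_le => e e0; apply: filterS (near_M e e0) => k Mk.
  rewrite sub0r normrN ger0_norm ?fine_ge0//.
  by rewrite -lee_fin fineK// ge0_fin_numE//; apply: le_lt_trans Mk _; rewrite ltry.
have ae_good : {ae leb, forall x, J x -> good x}.
  exact: gu.
(* At good times m <= K Q u, and the integral of Q u, an arbitrary integrand, is finite by
   assumption. *)
have intm : (\int[leb]_(t in J) (K^-1%:E * m t) < +oo)%E.
  apply: le_lt_trans Lu; apply: ae_ge0_le_integral_any => //.
    by move=> t _; rewrite mule_ge0// lee_fin invr_ge0 ltW.
  apply: filterS ae_good => t H /H gt.
  have H1 := good_m _ gt.
  apply: le_trans (lee_wpmul2l _ H1) _; first by rewrite lee_fin invr_ge0 ltW.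
  by rewrite muleA -EFinM mulVf ?gt_eqF// mul1e.
have KK0 := ltW K0; have LL0 := ltW L0.
have D0 : 0 <= D.
  apply: mulr_ge0; first by rewrite !mulr_ge0.
  by apply: mulr_ge0 => //; apply: addr_ge0 => //; exact: mulr_ge0.
have iDm : leb.-integrable J (fun t => D%:E * m t)%E.
  apply/integrableP; split.
    by apply: measurable_funTS; exact: measurable_funeM.
  under eq_integral do rewrite gee0_abs ?mule_ge0 ?lee_fin//.
  have -> : (\int[leb]_(t in J) (D%:E * m t) =
     (D * K)%:E * \int[leb]_(t in J) (K^-1%:E * m t))%E.
    rewrite -ge0_integralZl_EFin//.
    - apply: eq_integral => t _; rewrite muleA -EFinM -mulrA divff ?gt_eqF// mulr1//.
    - by move=> t _; rewrite mule_ge0// lee_fin invr_ge0 ltW.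
    - by apply: measurable_funTS; exact: measurable_funeM.
    - by rewrite mulr_ge0// ltW.
  by rewrite lte_mul_pinfty// lee_fin mulr_ge0// ltW.
have [_ _ lim] : [/\ leb.-integrable J (cst 0%E : _ -> \bar R),
   (\int[leb]_(x in J) `|M n x - cst 0%E x|)%E @[n --> \oo] --> 0%E &
   (\int[leb]_(x in J) M n x)%E @[n --> \oo] --> (\int[leb]_(x in J) cst 0 x)%E].
  apply: (dominated_convergence mJ _ _ _ iDm) => //.
  - by move=> k; exact: measurable_funTS.
  - by apply: filterS ae_good => t H /H; exact: good_cvg.
  - by apply: filterS ae_good => t H k Jt; have gt := H Jt; rewrite gee0_abs// good_D.
rewrite integral0 in lim.
have [k _ /(_ k (leqnn k)) hk] := cvge0_le_near _ _ eps0 lim.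
have [T [b [c [mb Ec hE]]]] := fh k.
exists T, b, c, (M k); split => //.
apply: filterS ae_good => t H /H gt; split; first by case: gt.
by rewrite -hE; exact: good_M1.
Unshelve. all: by end_near. Qed.

(* Approximate [u] by a function with finitely many values and shrink its level
   sets to compact ones, which are at positive distance from each other. *)
Lemma bochner_modulus (a b eps : R) (u : R -> V) :
  0 < eps -> bochner_Lp q `[a, b] E u ->
  exists (e : measurableTypeR R -> R) (h0 : R) (S : set (measurableTypeR R)),
  [/\ 0 < h0, measurable_fun setT e /\ (forall t, 0 <= e t),
      (\int[leb]_(t in `[a, b]) (e t)%:E <= eps%:E)%E,
      {ae leb, forall t, `[a, b]%classic t -> S t} &
      forall r t, `[a, b]%classic r -> `[a, b]%classic t -> S r -> S t ->
        `|r - t| <= h0 -> (Q (u r - u t) <= (e r + e t)%:E)%E].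
Proof.
move=> eps0 Lu; set J := `[a, b]%classic.
have mJ : measurable (J : set (measurableTypeR R)) by exact: measurable_itv.
have KK0 := ltW K0.
(* K * K is the cost of two applications of the quasi-triangle inequality; the 2 shares eps between
   the approximation error and the removed sets. *)
pose eps1 := eps / (2 * (K * K)).
have eps10 : 0 < eps1 by rewrite divr_gt0// !mulr_gt0.
have [T [bb [c [e1 [[mb Ec] [me1 e10] ie1 ae1]]]]] := bochner_approx _ _ _ mJ eps10 Lu.
pose M : R := \sum_x \sum_y fine (Q (c x - c y)).
have fQ x y : Q (c x - c y) \is a fin_num by apply: Qfin; exact: EB.
have Mge x y : (Q (c x - c y) <= M%:E)%E.
  rewrite -(fineK (fQ x y)) lee_fin /M (bigD1 x)//= (bigD1 y)//= -addrA lerDl.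
  apply: addr_ge0; first by apply: sumr_ge0 => z _; exact: fine_ge0.
  by apply: sumr_ge0 => z _; apply: sumr_ge0 => z' _; exact: fine_ge0.
have M0 : 0 <= M.
  by apply: sumr_ge0 => z _; apply: sumr_ge0 => z' _; exact: fine_ge0.
(* The removed sets have total measure at most #|T| dl and a jump costs at most M, together at most
   eps1. *)
pose dl := eps1 / ((M + 1) * (#|T|%:R + 1)).
have dl0 : 0 < dl.
  by rewrite divr_gt0// mulr_gt0// ltr_wpDl.
pose B x : set (measurableTypeR R) := bb @^-1` [set x] `&` J.
have mB x : measurable (B x) by exact: measurableI.
have Bfin x : (leb (B x) < +oo)%E.
  apply: (@le_lt_trans _ _ (leb J)).
    by apply: le_measure; rewrite ?inE//; exact: subIsetr.
  by rewrite /J lebesgue_measure_itv/=; case: ifPn => _; rewrite -?EFinB ltry.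
have /choice[C hC] : forall x, exists C : set R,
    [/\ compact C, C `<=` B x & (leb (B x `\` C) < dl%:E)%E].
  move=> x; have [W [W1 W2 W3]] := @lebesgue_regularity_inner R (B x) dl (mB x) (Bfin x) dl0.
  by exists W; split.
have cC x : compact (C x) by have [] := hC x.
have CB x : C x `<=` B x by have [] := hC x.
have mC x : measurable (C x : set (measurableTypeR R)).
  by apply: closed_measurable; apply: compact_closed => //; exact: Rhausdorff.
(* Distinct level sets have disjoint compact cores, hence a positive distance; on the diagonal 1 is
   a filler. *)
have /choice[dd hdd] : forall xy : T * T, exists d : R, 0 < d /\
    (xy.1 != xy.2 -> forall r t, C xy.1 r -> C xy.2 t -> d <= `|r - t|).
  move=> [x y] /=; have [->|xy] := eqVneq x y; first by exists 1.
  have clC : closed (C y) by apply: compact_closed => //; exact: Rhausdorff.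
  have [|d d0 hd] := compact_closed_dist _ _ (cC x) clC.
    rewrite -subset0 => t [/CB[/= t1 _] /CB[/= t2 _]].
    by move/eqP: xy; apply; rewrite -t1 -t2.
  by exists d.
pose h1 := \big[Num.min/1]_(xy : T * T) dd xy.
have h1_gt0 : 0 < h1.
  by apply/bigmin_gtP; split => // xy _; have [] := hdd xy.
pose Z x : set (measurableTypeR R) := B x `\` C x.
have mZ x : measurable (Z x) by exact: measurableD.
(* At least 1 as soon as a time t of J lies outside the compact core of its own level set. *)
pose z t : R := \sum_(x : T) \1_(Z x) t.
have z0 t : 0 <= z t by apply: sumr_ge0.
have mz : measurable_fun setT (z : measurableTypeR R -> R).
  by apply: measurable_sum => x; exact: measurable_indic.
pose e t : R := K * K * (fine (e1 t) + M * z t).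
have mfe1 : measurable_fun setT (fun t : measurableTypeR R => fine (e1 t)).
  exact: measurableT_comp.
pose S t := [/\ E (u t), (Q (u t - c (bb t)) <= e1 t)%E & (e1 t < +oo)%E].
exists e, (h1 / 2), S; split.
- by rewrite divr_gt0.
- split; last first.
    move=> t; apply: mulr_ge0; first exact: mulr_ge0.
    by apply: addr_ge0; [exact: fine_ge0|exact: mulr_ge0].
  by apply: measurable_funM => //; apply: measurable_funD => //; exact: measurable_funM.
- have H : (\int[leb]_(t in J) ((K * K)%:E * (e1 t + M%:E * (z t)%:E)) <= eps%:E)%E.
    have iz : (\int[leb]_(t in J) (z t)%:E <= (#|T|%:R * dl)%:E)%E.
      under eq_integral do rewrite /z -sumEFin.
      rewrite ge0_integral_sum//; last first.
        by move=> x; apply/measurable_EFinP/measurable_funTS; exact: measurable_indic.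
      apply: (@le_trans _ _ (\sum_(x : T) dl%:E)%E).
        apply: lee_sum => x _; rewrite integral_indic// setIidl.
          by have [_ _ /ltW] := hC x.
        by apply: subset_trans (@subDsetl _ _ _) _; exact: subIsetr.
      by rewrite sumEFin lee_fin sumr_const mulr_natl.
    rewrite ge0_integralZl_EFin//; last 3 first.
    + by move=> t _; rewrite adde_ge0// mule_ge0// lee_fin.
    + apply: measurable_funTS; apply: emeasurable_funD => //.
      by apply: measurable_funeM; exact/measurable_EFinP.
    + exact: mulr_ge0.
    + rewrite ge0_integralD//; last 3 first.
      * exact: measurable_funTS.
      * by move=> t _; rewrite mule_ge0// lee_fin.
      * by apply: measurable_funTS; apply: measurable_funeM; exact/measurable_EFinP.
      rewrite ge0_integralZl_EFin//; last 2 first.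
      * by move=> t _; rewrite lee_fin.
      * by apply: measurable_funTS; exact/measurable_EFinP.
      apply: (@le_trans _ _ ((K * K)%:E * (eps1%:E + M%:E * (#|T|%:R * dl)%:E))%E).
        apply: lee_wpmul2l; first by rewrite lee_fin mulr_ge0.
        by apply: leeD => //; apply: lee_wpmul2l; rewrite ?lee_fin.
      have -> : ((K * K)%:E * (eps1%:E + M%:E * (#|T|%:R * dl)%:E) =
        (K * K * (eps1 + M * (#|T|%:R * dl)))%:E)%E by [].
      rewrite lee_fin; have h : M * (#|T|%:R * dl) <= eps1.
        have -> : M * (#|T|%:R * dl) = (M * #|T|%:R) / ((M + 1) * (#|T|%:R + 1)) * eps1.
          by rewrite /dl; field; rewrite !gt_eqF// ltr_wpDl.
        rewrite -[leRHS]mul1r; apply: ler_wpM2r; first exact: ltW.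
        rewrite ler_pdivrMr ?mulr_gt0 ?ltr_wpDl// mul1r.
        by apply: ler_pM => //; rewrite lerDl.
      apply: (@le_trans _ _ (K * K * (eps1 + eps1))).
        by rewrite ler_wpM2l ?mulr_ge0// lerD2l.
      rewrite le_eqVlt; apply/orP; left; apply/eqP.
      by rewrite /eps1; field; rewrite gt_eqF.
  apply: le_trans H; apply: ge0_le_integral => //.
  + move=> t _; rewrite lee_fin; apply: mulr_ge0; first exact: mulr_ge0.
    by apply: addr_ge0; [exact: fine_ge0|exact: mulr_ge0].
  + apply: measurable_funTS; apply/measurable_EFinP.
    by apply: measurable_funM => //; apply: measurable_funD => //; exact: measurable_funM.
  + apply: measurable_funTS; apply: measurable_funeM; apply: emeasurable_funD => //.
    by apply: measurable_funeM; exact/measurable_EFinP.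
  + move=> t _; rewrite /e EFinM EFinD; apply: lee_wpmul2l.
      by rewrite lee_fin mulr_ge0.
    rewrite EFinM leeD2r//; have := e10 t.
    by case: (e1 t) => //= *; rewrite leey.
- have ie : leb.-integrable J e1.
    apply/integrableP; split; first exact: measurable_funTS.
    under eq_integral do rewrite gee0_abs//.
    by apply: le_lt_trans ie1 _; rewrite ltry.
  have := integrable_ae mJ ie; apply: filterS2 ae1 => t H1 H2 Jt.
  have [Eu Qu] := H1 Jt; split => //.
  by have := H2 Jt; rewrite ge0_fin_numE.
- move=> r t Jr Jt [Er Qr fr] [Et Qt ft] rt.
  have fr' : e1 r \is a fin_num by rewrite ge0_fin_numE.
  have ft' : e1 t \is a fin_num by rewrite ge0_fin_numE.
  have bad s : J s -> C (bb s) s \/ 1 <= z s.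
    move=> Js; have [Cs|Cs] := pselect (C (bb s) s); first by left.
    right; rewrite /z (bigD1 (bb s))//= indicE mem_set ?lerDl ?sumr_ge0//.
  (* If the indices differ and both times lie in their cores, they are at least h1 apart, against |r
     - t| <= h1 / 2. So one of them lies in a removed set and z pays for M. *)
  have mid : (Q (c (bb r) - c (bb t)) <= (M * (z r + z t))%:E)%E.
    have [eb|neb] := eqVneq (bb r) (bb t).
      by rewrite eb subrr Q0 lee_fin mulr_ge0// addr_ge0.
    apply: le_trans (Mge _ _) _; rewrite lee_fin -{1}[M]mulr1 ler_wpM2l//.
    have [Cr|] := bad r Jr; last by move=> h; apply: le_trans h _; rewrite lerDl.
    have [Ct|] := bad t Jt; last by move=> h; apply: le_trans h _; rewrite lerDr.
    have [_ /(_ neb r t Cr Ct) dle] := hdd (bb r, bb t).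
    have : h1 <= dd (bb r, bb t) by exact: bigmin_le.
    move=> h1d; exfalso; move: rt; apply/negP; rewrite -ltNge.
    apply: lt_le_trans (le_trans h1d dle).
    by rewrite ltr_pdivrMr// ltr_pMr// ltr1n.
  have Ecr := Ec (bb r); have Ect := Ec (bb t).
  have -> : u r - u t = (u r - c (bb r)) + ((c (bb r) - c (bb t)) - (u t - c (bb t))).
    by rewrite opprB addrA !subrKA.
  apply: le_trans (QD _ _ (EB _ _ Er Ecr) (EB _ _ (EB _ _ Ecr Ect) (EB _ _ Et Ect))) _.
  have h2 : (Q ((c (bb r) - c (bb t)) - (u t - c (bb t))) <=
      K%:E * ((M * (z r + z t))%:E + e1 t))%E.
    apply: le_trans (QD _ _ (EB _ _ Ecr Ect) (EN _ (EB _ _ Et Ect))) _.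
    by apply: lee_wpmul2l; [rewrite lee_fin|rewrite QN; apply: leeD].
  apply: le_trans (lee_wpmul2l _ (leeD Qr h2)) _; first by rewrite lee_fin.
  rewrite -(fineK fr') -(fineK ft').
  rewrite -[leLHS]/((K * (fine (e1 r) +
    K * (M * (z r + z t) + fine (e1 t))))%:E) lee_fin /e.
  have k1 : fine (e1 r) <= K * fine (e1 r).
    by rewrite -{1}[fine (e1 r)]mul1r ler_wpM2r// fine_ge0.
  have -> : K * K * (fine (e1 r) + M * z r) + K * K * (fine (e1 t) + M * z t) =
    K * (K * fine (e1 r) + K * (M * (z r + z t) + fine (e1 t))) by ring.
  by rewrite ler_wpM2l// lerD2r.
Qed.

(** Up to an integrable error u is a function with finitely many values, which is bounded. The
    result is a measurable majorant of [Q (u t)], whose own measurability is unknown. *)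
Lemma bochner_bound (a b : R) (u : R -> V) : bochner_Lp q `[a, b] E u ->
  exists e : measurableTypeR R -> R,
  [/\ measurable_fun setT e, forall t, 0 <= e t,
      (\int[leb]_(t in `[a, b]) (e t)%:E < +oo)%E &
      {ae leb, forall t, `[a, b]%classic t -> E (u t) /\ (Q (u t) <= (e t)%:E)%E}].
Proof.
move=> Lu; set J := `[a, b]%classic.
have mJ : measurable (J : set (measurableTypeR R)) by exact: measurable_itv.
have KK0 := ltW K0.
have [T [bb [c [e1 [[mb Ec] [me1 e10] ie1 ae1]]]]] :=
  bochner_approx _ _ _ mJ ltr01 Lu.
pose M : R := \sum_x fine (Q (c x)).
have fQ x : Q (c x) \is a fin_num by exact: Qfin.
have Mge x : (Q (c x) <= M%:E)%E.
  rewrite -(fineK (fQ x)) lee_fin /M (bigD1 x)//= lerDl.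
  by apply: sumr_ge0 => z _; exact: fine_ge0.
have M0 : 0 <= M by apply: sumr_ge0 => z _; exact: fine_ge0.
exists (fun t => K * (fine (e1 t) + M)).
have mfe1 : measurable_fun setT (fun t : measurableTypeR R => fine (e1 t)).
  exact: measurableT_comp.
have me : measurable_fun setT (fun t : measurableTypeR R => K * (fine (e1 t) + M)).
  by apply: measurable_funM => //; exact: measurable_funD.
have e0 t : 0 <= K * (fine (e1 t) + M).
  by rewrite mulr_ge0// addr_ge0// fine_ge0.
split => //.
- apply: (@le_lt_trans _ _ (\int[leb]_(t in J) (K%:E * (e1 t + M%:E)))%E).
    apply: ge0_le_integral => //.
    + by move=> t _; rewrite lee_fin.
    + by apply: measurable_funTS; exact/measurable_EFinP.
    + by apply: measurable_funTS; apply: measurable_funeM; exact: emeasurable_funD.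
    + move=> t _; rewrite EFinM EFinD; apply: lee_wpmul2l; first by rewrite lee_fin.
      rewrite leeD2r//; have := e10 t.
      by case: (e1 t) => //= *; rewrite leey.
  rewrite ge0_integralZl_EFin//; last 2 first.
  - by move=> t _; rewrite adde_ge0.
  - by apply: measurable_funTS; exact: emeasurable_funD.
  rewrite lte_mul_pinfty// ge0_integralD//; last exact: measurable_funTS.
  apply: lte_add_pinfty; first by apply: le_lt_trans ie1 _; rewrite ltry.
  have fJ : (leb J < +oo)%E.
    by rewrite /J lebesgue_measure_itv/=; case: ifPn => _; rewrite -?EFinB ltry.
  by rewrite integral_cst// lte_mul_pinfty// ?lee_fin.
- have ie : leb.-integrable J e1.
    apply/integrableP; split; first exact: measurable_funTS.
    under eq_integral do rewrite gee0_abs//.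
    by apply: le_lt_trans ie1 _; rewrite ltry.
  have := integrable_ae mJ ie; apply: filterS2 ae1 => t H1 H2 Jt.
  have [Eu Qu] := H1 Jt; split => //.
  have ft := H2 Jt.
  apply: le_trans (Qtri _ _ Eu (Ec (bb t))) _.
  rewrite EFinM; apply: lee_wpmul2l; first by rewrite lee_fin.
  by rewrite EFinD fineK//; exact: leeD.
Qed.

End bochner.

(** * Good times and descent over a grid *)

Section descent.
Context {R : realType}.
Local Notation leb := (@lebesgue_measure R).
Variables (G : measurableTypeR R -> R) (S : set (measurableTypeR R)) (a b : R).
Hypothesis mG : measurable_fun setT G.
Hypothesis G0 : forall t, 0 <= G t.
Hypothesis iG : (\int[leb]_(t in `[a, b]) (G t)%:E < +oo)%E.
Hypothesis aeS : {ae leb, forall t, `[a, b]%classic t -> S t}.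

Lemma integrable_subitv x y : a <= x -> y <= b ->
  leb.-integrable `[x, y] (EFin \o G).
Proof.
move=> ax yb; apply/integrableP; split.
  by apply: measurable_funTS; exact/measurable_EFinP.
under eq_integral do rewrite /= ger0_norm//.
apply: le_lt_trans iG; apply: ge0_subset_integral => //.
- by apply: measurable_funTS; exact/measurable_EFinP.
- by move=> t _; rewrite lee_fin.
- by apply: subset_itvScc; rewrite bnd_simp.
Qed.

Lemma Rintegral_chasles x y : a <= x -> x <= y -> y <= b ->
  \int[leb]_(t in `[a, y]) G t = \int[leb]_(t in `[a, x]) G t +
  \int[leb]_(t in `[x, y]) G t.
Proof.
move=> ax xy yb.
have i := @integrable_subitv a y (lexx _) yb.
have := @Rintegral_itvB _ G (BLeft a) (BRight y) x i.
rewrite !bnd_simp => /(_ ax xy).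
rewrite (@Rintegral_itv_obnd_cbnd _ x (BRight y)); last first.
  apply: integrableS (integrable_subitv x y ax yb) => //.
  by apply: subset_itvr; rewrite bnd_simp.
by move=> <-; rewrite addrC subrK.
Qed.

(** Otherwise G would exceed its mean by e / (y - x) almost everywhere on [x, y], since S has full
    measure there, and integrating gives a contradiction. *)
Lemma good_point x y e : a <= x -> x < y -> y <= b -> 0 < e ->
  exists t, [/\ x <= t, t <= y, S t &
    (y - x) * G t <= \int[leb]_(t in `[x, y]) G t + e].
Proof.
move=> ax xy yb e0; apply: contrapT => H.
have xy0 : 0 < y - x by rewrite subr_gt0.
set I := \int[leb]_(t in `[x, y]) G t.
have IG := @integrable_subitv x y ax yb.
have : (\int[leb]_(t in `[x, y]) ((I + e) / (y - x))%:E <=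
    \int[leb]_(t in `[x, y]) (G t)%:E)%E.
  have I0 : 0 <= I by apply: Rintegral_ge0.
  apply: ae_ge0_le_integral_any => //.
  - move=> t _; rewrite lee_fin; apply: divr_ge0; last exact: ltW.
    by apply: addr_ge0 => //; exact: ltW.
  - by move=> t _; rewrite lee_fin.
  apply: ae_imply aeS => t St /=; rewrite in_itv/= => /andP[xt ty].
  have {}St : S t.
    by apply: St; rewrite /= in_itv/= (le_trans ax xt) (le_trans ty yb).
  rewrite lee_fin ler_pdivrMr// leNgt mulrC; apply/negP => h; apply: H.
  by exists t; split => //; rewrite ltW.
rewrite integral_cst//= lebesgue_measure_itv/= lte_fin xy -EFinB -EFinM.
rewrite divfK ?gt_eqF// -[leRHS]fineK ?integrable_fin_num// lee_fin.
by rewrite /I /Rintegral gerDl leNgt e0.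
Qed.

Variables (E : R -> R) (h0 eta : R).
Hypothesis h00 : 0 < h0.
Hypothesis eta0 : 0 < eta.
Hypothesis ieta : \int[leb]_(t in `[a, b]) G t <= eta.
Hypothesis step : forall r t, a <= r -> r < t -> t <= b -> S r -> S t ->
  t - r <= h0 -> E t <= E r + \int[leb]_(x in `[r, t]) G x + (t - r) * G t.

(* The grid points are moved to points where [G] does not exceed its mean on the
   cell, so that the terms [(t - r) * G t] add up to about the integral of [G]. *)
Lemma descent_along_grid d : a < b -> 0 < d -> exists r t,
  [/\ a <= r <= a + d, b - d <= t <= b & E t <= E r + 5 * eta].
Proof.
move=> ab d0; have ba0 : 0 < b - a by rewrite subr_gt0.
(* Successive chosen points lie in adjacent cells and can be 2 h apart, hence h0 / 2. *)
pose m := Num.min (h0 / 2) d.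
have m0 : 0 < m by rewrite lt_min d0 andbT divr_gt0.
pose n := Num.truncn ((b - a) / m).
pose h := (b - a) / n.+1%:R.
have h_gt0 : 0 < h by rewrite divr_gt0.
have hm : h <= m.
  rewrite /h ler_pdivrMr// mulrC -ler_pdivrMr//.
  by rewrite ltW// truncnS_gt.
have hd : h <= d by apply: le_trans hm _; rewrite ge_min lexx orbT.
have hh0 : 2 * h <= h0.
  by rewrite mulrC -ler_pdivlMr//; apply: le_trans hm _; rewrite ge_min lexx.
pose x i : R := a + h * i%:R.
have xS i : x i.+1 = x i + h by rewrite /x -natr1; ring.
have xn : x n.+1 = b by rewrite /x /h divfK// addrC subrK.
have ax i : a <= x i by rewrite lerDl mulr_ge0// ltW.
have xb i : (i <= n.+1)%N -> x i <= b.
  by move=> ni; rewrite -xn lerD2l ler_wpM2l ?(ltW h_gt0)// ler_nat.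
pose eps := eta / n.+1%:R.
have eps0 : 0 < eps by rewrite divr_gt0.
(* One good point per cell; the value 0 for i > n is a filler. *)
have /choice[t ht] : forall i, exists t, (i <= n)%N ->
    [/\ x i <= t, t <= x i.+1, S t &
      h * G t <= \int[leb]_(s in `[x i, x i.+1]) G s + eps].
  move=> i; have [ni|] := leqP i n; last by exists 0.
  have [||t [t1 t2 t3 t4]] := @good_point (x i) (x i.+1) eps (ax i) _ _ eps0.
  - by rewrite xS ltrDl.
  - exact: xb.
  - by exists t => _; split => //; move: t4; rewrite xS [x i + h]addrC addrK.
pose Ga y := \int[leb]_(s in `[a, y]) G s.
have ch u v : a <= u -> u <= v -> v <= b ->
    \int[leb]_(s in `[u, v]) G s = Ga v - Ga u.
  by move=> au uv vb; rewrite /Ga (Rintegral_chasles _ _ au uv vb) [_ + _ - _]addrC addKr.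
have GaM u v : a <= u -> u <= v -> v <= b -> Ga u <= Ga v.
  by move=> au uv vb; rewrite -subr_ge0 -ch//; apply: Rintegral_ge0.
have aa : Ga a = 0.
  by have := ch a a (lexx _) (lexx _) (ltW ab); rewrite subrr -/(Ga a).
have Ga0 u : a <= u -> u <= b -> 0 <= Ga u by move=> au ub; rewrite -aa; exact: GaM.
(* The integral terms telescope to [Ga (t i)]; the gap of at most 2 h between chosen points puts the
   factor 2 on the cell integrals and on their errors eps. *)
have key i : (i <= n)%N ->
    E (t i) <= E (t 0) + Ga (t i) + 2 * Ga (x i.+1) + 2 * (i%:R * eps).
  elim: i => [_|i IH ni].
    have [t1 t2 _ _] := ht 0 (leq0n n).
    have at0 := le_trans (ax 0) t1.
    have tb := le_trans t2 (xb 1 isT).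
    have := Ga0 _ at0 tb; have := Ga0 _ (ax 1) (xb 1 isT).
    by rewrite mul0r mulr0; lra.
  have {}IH := IH (ltnW ni).
  have [t1 t2 St tG] := ht i (ltnW ni).
  have [t1' t2' St' tG'] := ht i.+1 ni.
  have ati := le_trans (ax _) t1.
  have tt' : t i <= t i.+1 by exact: le_trans t1'.
  have tb' := le_trans t2' (xb i.+2 ni).
  have sb : t i.+1 - t i <= 2 * h.
    by move: t1 t2'; rewrite !xS; lra.
  have cx : \int[leb]_(s in `[x i.+1, x i.+2]) G s = Ga (x i.+2) - Ga (x i.+1).
    by apply: ch => //; [rewrite [leRHS]xS lerDl ltW|exact: xb].
  have Gt' : (t i.+1 - t i) * G (t i.+1) <=
      2 * (Ga (x i.+2) - Ga (x i.+1)) + 2 * eps.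
    apply: (@le_trans _ _ (2 * h * G (t i.+1))); first exact: ler_wpM2r.
    by rewrite -mulrA -mulrDr ler_wpM2l// -cx.
  have Et : E (t i.+1) <= E (t i) + (Ga (t i.+1) - Ga (t i)) + (t i.+1 - t i) * G (t i.+1).
    move: tt'; rewrite le_eqVlt => /orP[/eqP <-|lt'].
      by rewrite !subrr mul0r !addr0.
    rewrite -ch//; last exact: ltW.
    by apply: step => //; exact: le_trans hh0.
  rewrite -natr1 mulrDl mul1r; lra.
have [t1 t2 _ _] := ht 0 (leq0n n).
have [s1 s2 _ _] := ht n (leqnn n).
have sb : t n <= b by rewrite -xn.
have as_ : a <= t n by exact: le_trans s1.
exists (t 0), (t n); split.
- rewrite (le_trans (ax 0) t1)/=; apply: le_trans t2 _.
  by rewrite /x mulr1 lerD2l.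
- rewrite sb andbT; apply: le_trans s1.
  by rewrite lerBlDr -xn xS lerD2l.
(* [Ga (t n)], [Ga b] and n eps are each at most eta and carry the weights 1 + 2 + 2 = 5. *)
- have := key n (leqnn n); rewrite xn.
  have h1 : Ga (t n) <= eta by apply: le_trans ieta; exact: GaM.
  have h2 : Ga b <= eta by [].
  have h3 : n%:R * eps <= eta.
    rewrite /eps mulrCA ler_piMr ?(ltW eta0)// ler_pdivrMr// mul1r ler_nat//.
  by lra.
Qed.

End descent.

(** * Function spaces on R^n *)

Section geometry.
Context {R : realType} {n : nat}.
Implicit Types (x y : 'rV[R]_n).
Local Notation mu := (@lebesgue_rV R n).

Lemma coord_le_norm x i : `|x ord0 i| <= `|x|.
Proof.
rewrite -[`|x|]/(mx_norm x) mx_normrE.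
exact: (le_bigmax _ (fun ij => `|x ij.1 ij.2|) (ord0, i)).
Qed.

Lemma norm_le_coord x c : 0 <= c -> (forall i, `|x ord0 i| <= c) -> `|x| <= c.
Proof.
move=> c0 xc; rewrite -[`|x|]/(mx_norm x) mx_normrE.
by apply: bigmax_le => // -[i j] _ /=; rewrite (ord1 i).
Qed.

Lemma enorm_ge0 x : 0 <= enorm x. Proof. exact: sqrtr_ge0. Qed.

Lemma norm_le_enorm x : `|x| <= enorm x.
Proof.
apply: norm_le_coord; first exact: enorm_ge0.
move=> i; rewrite -sqrtr_sqr ler_wsqrtr// (bigD1 i)//= lerDl.
by apply: sumr_ge0 => j _; exact: sqr_ge0.
Qed.

Lemma enorm_le_norm x : enorm x <= n%:R * `|x|.
Proof.
have nx0 : 0 <= n%:R * `|x| by rewrite mulr_ge0.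
rewrite -(ger0_norm nx0) -sqrtr_sqr ler_wsqrtr//.
apply: (@le_trans _ _ (\sum_(i < n) `|x| ^+ 2)).
  apply: ler_sum => i _; rewrite -[leLHS]real_normK ?num_real//.
  by rewrite lerXn2r ?nnegrE// coord_le_norm.
rewrite sumr_const card_ord -[leLHS]mulr_natl exprMn ler_wpM2r ?sqr_ge0//.
by rewrite expr2 -natrM ler_nat; case: n => // k; rewrite leq_pmulr.
Qed.

Lemma enormN x : enorm (- x) = enorm x.
Proof. by congr Num.sqrt; apply: eq_bigr => i _; rewrite mxE sqrrN. Qed.

Lemma measurable_enorm : measurable_fun setT (@enorm R n).
Proof.
apply: (measurableT_comp (f := @Num.sqrt R)).
  by apply: continuous_measurable_fun; exact: sqrt_continuous.
apply: measurable_sum => i; apply: measurable_funX.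
exact: measurable_coord_rV.
Qed.

Lemma measurable_box (A : 'I_n -> set (measurableTypeR R)) :
  (forall i, measurable (A i)) -> measurable [set x | forall i, A i (coord_rV i x)].
Proof.
move=> mA; rewrite (_ : mkset _ =
    \bigcap_(i in [set: 'I_n]) ([set: 'rV[R]_n] `&` coord_rV i @^-1` (A i))).
  by apply: fin_bigcap_measurable => // i _; exact: measurable_coord_rV.
by apply/seteqP; split => [x Ax i _|x Ax i] /=; [split|have [] := Ax i I].
Qed.

(** The sigma-algebra comes from the coordinates, the topology from the sup norm. An open set is the
    countable union of the boxes it contains with rational centre and half-width 1 / (k + 1). *)
Lemma measurable_open_rV (U : set 'rV[R]_n) : open U -> measurable U.
Proof.
move=> oU.
pose box (ck : 'rV[rat]_n * nat) : set 'rV[R]_n :=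
  [set x | forall i, `]ratr (ck.1 ord0 i) - ck.2.+1%:R^-1,
                     ratr (ck.1 ord0 i) + ck.2.+1%:R^-1[%classic (coord_rV i x)].
have mbox ck : measurable (box ck).
  by apply: (@measurable_box (fun i => `]_ , _[%classic)) => i; exact: measurable_itv.
rewrite (_ : U = \bigcup_ck (if `[< box ck `<=` U >] then box ck else set0)).
  apply: countable_bigcupT_measurable => // ck; case: ifP => // _; exact: mbox.
apply/seteqP; split => [x Ux|x [ck _]]; last first.
  by case: asboolP => // bU xb; exact: bU.
have : nbhs x U by exact: open_nbhs_nbhs.
move=> /nbhs_ballP[e /= e0 xe].
(* Both x and any point of the box are within 1 / (k + 1) of the centre in each coordinate, so 2 /
   (k + 1) < e is needed. *)
pose k := Num.truncn (2 / e).
have k0 : 0 < k.+1%:R^-1 :> R by rewrite invr_gt0.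
have ke : 2 * k.+1%:R^-1 < e.
  by rewrite ltr_pdivrMr// mulrC -ltr_pdivrMr// truncnS_gt.
have /choice[c hc] : forall i : 'I_n, exists c : rat,
    x ord0 i - k.+1%:R^-1 < ratr c < x ord0 i + k.+1%:R^-1.
  move=> i.
  have [|c] := @rat_in_itvoo R (x ord0 i - k.+1%:R^-1) (x ord0 i + k.+1%:R^-1).
    by rewrite ltrBlDr -addrA ltrDl addr_gt0.
  by rewrite in_itv/=; exists c.
have gen (u v w d : R) : u - d < w -> w < u + d -> w - d < v -> v < w + d ->
    `|u - v| <= 2 * d.
  by move=> *; rewrite ler_norml; apply/andP; split; lra.
exists (\row_i c i, k) => //.
have sub : box (\row_i c i, k) `<=` U.
  move=> y yb; apply: xe; rewrite -ball_normE /=.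
  apply: le_lt_trans ke; apply: norm_le_coord; first by rewrite mulr_ge0// ltW.
  move=> i; have := yb i; rewrite /= in_itv/= /coord_rV !mxE => /andP[y1 y2].
  have /andP[c1 c2] := hc i.
  by apply: (gen _ _ _ _ c1 c2 y1 y2).
rewrite asboolT//= => i; rewrite /= in_itv/= /coord_rV mxE.
have gen' (u w d : R) : u - d < w -> w < u + d -> w - d < u < w + d.
  by move=> *; apply/andP; split; lra.
by have /andP[c1 c2] := hc i; apply: gen'.
Qed.

Lemma closed_measurable_rV (U : set 'rV[R]_n) : closed U -> measurable U.
Proof.
move=> cU; rewrite -[U]setCK; apply: measurableC.
by apply: measurable_open_rV; exact: closed_openC.
Qed.

Lemma lebesgue_rV_ball c : 0 <= c ->
  (mu [set x | (`|x| <= c)%R] <= ((2 * c) ^+ n)%:E)%E.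
Proof.
move=> c0; pose A (i : 'I_n) : set (measurableTypeR R) := `[- c, c]%classic.
have mA i : measurable (A i) by exact: measurable_itv.
have -> : [set x | `|x| <= c] = [set x : 'rV[R]_n | forall i, A i (coord_rV i x)].
  apply/seteqP; split => x /= xc.
    move=> i; rewrite /A /= in_itv/= /coord_rV -ler_norml.
    exact: le_trans (coord_le_norm _ _) xc.
  apply: norm_le_coord => // i.
  by have := xc i; rewrite /A /= in_itv/= -ler_norml.
rewrite lebesgue_rV_box// (eq_bigr (fun=> (2 * c)%:E)); last first.
  move=> i _; rewrite /A lebesgue_measure_itv/= lte_fin.
  case: ifPn => [_|]; first by rewrite -EFinB opprK mulr_natl mulr2n.
  rewrite -leNgt => h; have -> : c = 0 by apply/eqP; rewrite eq_le c0; lra.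
  by rewrite mulr0.
rewrite big_const card_ord.
suff -> : forall k, iter k (mule (2 * c)%:E) 1%E = ((2 * c) ^+ k)%:E by [].
by elim => [|k IH] //=; rewrite IH exprS EFinM.
Qed.

Lemma measurable_ball_rV c : measurable [set x : 'rV[R]_n | `|x| <= c].
Proof.
have [c0|c0] := leP 0 c.
  pose A (i : 'I_n) : set (measurableTypeR R) := `[- c, c]%classic.
  have mA i : measurable (A i) by exact: measurable_itv.
  have -> : [set x | `|x| <= c] = [set x : 'rV[R]_n | forall i, A i (coord_rV i x)].
    apply/seteqP; split => x /= xc.
      move=> i; rewrite /A /= in_itv/= /coord_rV -ler_norml.
      exact: le_trans (coord_le_norm _ _) xc.
    apply: norm_le_coord => // i.
    by have := xc i; rewrite /A /= in_itv/= -ler_norml.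
  exact: measurable_box.
rewrite (_ : mkset _ = set0)//; apply/seteqP; split => x //= xc.
by have := le_lt_trans xc c0; rewrite normr_lt0.
Qed.

Lemma bounded_set_norm (A : set 'rV[R]_n) : bounded_set A ->
  exists2 M : R, 0 < M & forall x, A x -> `|x| <= M.
Proof.
move=> [M [_ AM]]; exists (`|M| + 1); first by rewrite ltr_wpDl.
move=> x Ax; apply: (AM (`|M| + 1)) => //.
by rewrite (le_lt_trans (ler_norm _))// ltrDl.
Qed.

Lemma bounded_set_finite_measure (A : set 'rV[R]_n) : measurable A ->
  bounded_set A -> (mu A < +oo)%E.
Proof.
move=> mA /bounded_set_norm[M M0 AM].
apply: (@le_lt_trans _ _ (mu [set x | `|x| <= M])).
  by apply: le_measure; rewrite ?inE//; exact: measurable_ball_rV.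
by apply: le_lt_trans (lebesgue_rV_ball _ (ltW M0)) _; rewrite ltry.
Qed.

Lemma tail_weight_ge0 (al : R) x : 0 <= (1 + enorm x `^ al)^-1.
Proof. by rewrite invr_ge0 addr_ge0// powR_ge0. Qed.

Lemma measurable_tail_weight (al : R) :
  measurable_fun setT (fun x => (1 + enorm x `^ al)^-1).
Proof.
rewrite (_ : (fun x => _) = (@powR R)^~ (-1) \o (fun x => 1 + enorm x `^ al)).
  apply: measurable_fun_powR.
  apply: measurable_funD => //.
  by apply: measurable_fun_powR; exact: measurable_enorm.
by apply/funext => x /=; rewrite powR_inv1// addr_ge0// powR_ge0.
Qed.

(** Dyadic comparison: for 2^j < |x| <= 2^(j+1) the weight is at most 2^(-j (n + al)), while the
    ball of radius 2^(j+1) has measure at most (4 * 2^j)^n. The products form a geometric series of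
    ratio 2^(-al). Sup-norm balls serve because |x| <= [enorm x]. *)
Lemma tail_weight_integrable (al : R) : 0 < al ->
  (\int[mu]_x ((1 + enorm x `^ (n%:R + al))^-1)%:E < +oo)%E.
Proof.
move=> al0; pose r : R := 2 `^ (- al).
have r0 : 0 < r by rewrite powR_gt0.
have r1 : r < 1.
  rewrite /r powRN invf_lt1 ?powR_gt0//.
  have := @gt0_ltr_powR R al al0 1 2.
  by rewrite !nnegrE powR1 => ->//; rewrite ltr1n.
pose B j : set 'rV[R]_n := [set x | `|x| <= 2 ^+ j.+1].
have mB j : measurable (B j) by exact: measurable_ball_rV.
(* A ball in place of a shell: an upper bound is enough, and the measure of a ball has an explicit
   bound. *)
pose f j x : R := (2 `^ (- (n%:R + al))) ^+ j * \1_(B j) x.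
have f0 j x : 0 <= f j x by rewrite mulr_ge0// exprn_ge0// powR_ge0.
have mf j : measurable_fun setT (fun x => (f j x)%:E).
  by apply/measurable_EFinP; apply: measurable_funM => //; exact: measurable_indic.
have na0 : 0 <= n%:R + al by rewrite addr_ge0// ltW.
have dom x : (((1 + enorm x `^ (n%:R + al))^-1)%:E <= \sum_(j <oo) (f j x)%:E)%E.
  have [j hj] : exists j, (1 + enorm x `^ (n%:R + al))^-1 <= f j x.
    have [x1|x1] := leP `|x| 2.
      exists 0%N; rewrite /f expr0 mul1r indicE mem_set//=.
      by rewrite invf_le1 ?lerDl ?powR_ge0// ltr_wpDr// powR_ge0.
    have [j /andP[j1 j2]] : exists j, 2 ^+ j < `|x| <= 2 ^+ j.+1.
      pose P k := `|x| <= 2 ^+ k.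
      have exP : exists k, P k.
        exists (Num.truncn `|x|).+1; rewrite /P.
        apply: le_trans (ltW (truncnS_gt _)) _.
        by rewrite -natrX ler_nat; exact/ltnW/ltn_expl.
      case: (ex_minnP exP) => -[|k] Pk kmin.
        by move: Pk; rewrite /P expr0 => /(lt_le_trans x1); rewrite ltrn1.
      exists k; apply/andP; split; last exact: Pk.
      rewrite ltNge; apply/negP => /kmin.
      by rewrite ltnn.
    exists j; rewrite /f indicE mem_set//= mulr1.
    have e1 : (2 `^ (- (n%:R + al))) ^+ j = ((2 ^+ j) `^ (n%:R + al))^-1.
      by rewrite -powR_mulrn ?powR_ge0// -powRrM mulrC powRrM powRN powR_mulrn.
    rewrite e1 lef_pV2 ?posrE ?powR_gt0 ?exprn_gt0//; last first.
      by rewrite ltr_wpDr// powR_ge0.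
    apply: (@le_trans _ _ (enorm x `^ (n%:R + al))); last by rewrite lerDr.
    apply: le_powRl => //.
    exact: le_trans (ltW j1) (norm_le_enorm x).
  apply: (@le_trans _ _ (f j x)%:E); first by rewrite lee_fin.
  rewrite (@nneseriesD1 _ (fun k => (f k x)%:E) j xpredT)//.
    by rewrite leeDl//; apply: nneseries_ge0 => k _ _; rewrite lee_fin.
  by move=> k _; rewrite lee_fin.
apply: (@le_lt_trans _ _ (\int[mu]_x (\sum_(j <oo) (f j x)%:E))%E).
  apply: ge0_le_integral => //.
  - by move=> x _; rewrite lee_fin tail_weight_ge0.
  - by apply/measurable_EFinP; exact: measurable_tail_weight.
  - by apply: ge0_emeasurable_sum => // k x _ _; rewrite lee_fin.
rewrite integral_nneseries//; last by move=> k x _; rewrite lee_fin.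
apply: (@le_lt_trans _ _ (4 ^+ n / (1 - r))%:E); last by rewrite ltry.
apply: lime_le; first by apply: is_cvg_nneseries => *; apply: integral_ge0 => *; rewrite lee_fin.
apply: nearW => N; apply: (@le_trans _ _ (\sum_(0 <= j < N) (4 ^+ n * r ^+ j)%:E)%E).
  apply: lee_sum => j _.
  have -> : (\int[mu]_x (f j x)%:E = ((2 `^ (- (n%:R + al))) ^+ j)%:E * mu (B j))%E.
    under eq_integral do rewrite /f EFinM.
    rewrite ge0_integralZl_EFin//; last first.
      by apply/measurable_EFinP; exact: measurable_indic.
    by rewrite integral_indic// setIT.
  have c0 : 0 <= 2 ^+ j.+1 :> R by exact: exprn_ge0.
  apply: le_trans (lee_wpmul2l _ (lebesgue_rV_ball _ c0)) _.
    by rewrite lee_fin exprn_ge0// powR_ge0.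
  rewrite -EFinM lee_fin le_eqVlt; apply/orP; left; apply/eqP.
  have -> : 2 `^ (- (n%:R + al)) = (2 ^+ n)^-1 * r :> R.
    by rewrite opprD powRD ?pnatr_eq0 ?implybT// powRN powR_mulrn.
  have e1 : ((2 ^+ n)^-1) ^+ j = ((2 ^+ j) ^+ n)^-1 :> R.
    by rewrite exprVn -!exprM mulnC.
  have e2 : 2 * 2 ^+ j.+1 = 4 * 2 ^+ j :> R by rewrite exprS; ring.
  rewrite e2 !exprMn e1; field.
  by rewrite expf_neq0// expf_neq0.
rewrite sumEFin lee_fin -mulr_sumr ler_wpM2l ?exprn_ge0//.
have := subrX1 r N; rewrite big_mkord => h.
have r1' : 0 < 1 - r by rewrite subr_gt0.
rewrite -div1r ler_pdivlMr//.
have -> : (\sum_(i < N) r ^+ i) * (1 - r) = 1 - r ^+ N.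
  by rewrite -[1 - r ^+ N]opprB h; ring.
by rewrite lerBlDr lerDl exprn_ge0// ltW.
Qed.

End geometry.

Section weighted_power.
Context d (T : measurableType d) (R : realType).
Variable mu : {measure set T -> \bar R}.
Variables (D : set T) (k : T -> R) (q : R).
Hypothesis mD : measurable D.
Hypothesis mk : measurable_fun D k.
Hypothesis k0 : forall x, 0 <= k x.
Hypothesis q0 : 0 < q.

(** The Gagliardo seminorm, the L^p norm and the tail norm are the cases of weight [frac_kernel], 1
    and [tail_weight], so scaling and the quasi-triangle inequality are proved once. *)
Definition weighted_power (h : T -> R) : \bar R :=
  (\int[mu]_(x in D) (`|h x| `^ q * k x)%:E)%E.

Lemma weighted_power_ge0 h : (0 <= weighted_power h)%E.
Proof. by apply: integral_ge0 => x _; rewrite lee_fin mulr_ge0// powR_ge0. Qed.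

Lemma measurable_weighted_power (h : T -> R) : measurable_fun D h ->
  measurable_fun D (fun x => (`|h x| `^ q * k x)%:E).
Proof.
move=> mh; apply/measurable_EFinP; apply: measurable_funM => //.
by apply: measurable_fun_powR; exact: measurableT_comp.
Qed.

Lemma weighted_powerD (h1 h2 : T -> R) : measurable_fun D h1 -> measurable_fun D h2 ->
  (weighted_power (fun x => h1 x + h2 x)%R <=
    (2 `^ q)%:E * (weighted_power h1 + weighted_power h2))%E.
Proof.
move=> m1 m2; rewrite /weighted_power -ge0_integralD//; last 4 first.
- by move=> x _; rewrite lee_fin mulr_ge0// powR_ge0.
- exact: measurable_weighted_power.
- by move=> x _; rewrite lee_fin mulr_ge0// powR_ge0.
- exact: measurable_weighted_power.
rewrite -ge0_integralZl_EFin//; last 2 first.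
- by move=> x _; rewrite -EFinD lee_fin addr_ge0// mulr_ge0// powR_ge0.
- by apply: emeasurable_funD; exact: measurable_weighted_power.
apply: ge0_le_integral => //.
- by move=> x _; rewrite lee_fin mulr_ge0// powR_ge0.
- by apply: measurable_weighted_power; exact: measurable_funD.
- apply: measurable_funeM.
  by apply: emeasurable_funD; exact: measurable_weighted_power.
- move=> x _; rewrite -EFinD -EFinM lee_fin -mulrDl mulrA ler_wpM2r//.
  apply: le_trans (powRD_le _ _ _ (ltW q0) (normr_ge0 (h1 x)) (normr_ge0 (h2 x))).
  by apply: le_powRl; [exact: ltW|exact: normr_ge0|exact: ler_normD].
Qed.

Lemma weighted_powerZ (h : T -> R) (a : R) : measurable_fun D h ->
  weighted_power (fun x => a * h x) = ((`|a| `^ q)%:E * weighted_power h)%E.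
Proof.
move=> mh; rewrite /weighted_power -ge0_integralZl_EFin//; last 2 first.
- by move=> x _; rewrite lee_fin mulr_ge0// powR_ge0.
- exact: measurable_weighted_power.
by apply: eq_integral => x _; rewrite normrM powRM// -EFinM mulrA.
Qed.

End weighted_power.
Arguments weighted_power {d T R}.

Section function_spaces.
Context {R : realType} {n : nat}.
Local Notation mu := (@lebesgue_rV R n).
Implicit Types (D : set 'rV[R]_n) (u v : 'rV[R]_n -> R).
Variables (s p : R).
Hypothesis p1 : 1 < p.

Let p0 : 0 < p. Proof. exact: lt_trans p1. Qed.

Lemma frac_kernel_ge0 (z : 'rV[R]_n * 'rV[R]_n) : 0 <= frac_kernel s p z.
Proof. exact: powR_ge0. Qed.

Lemma measurable_frac_kernel : measurable_fun setT (@frac_kernel R n s p).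
Proof.
apply: measurable_fun_powR.
apply: (measurableT_comp (f := @enorm R n) measurable_enorm).
apply: measurable_fun_rV => i.
rewrite (_ : _ \o _ = fun z => coord_rV i z.1 - coord_rV i z.2).
  apply: measurable_funB; (apply: measurableT_comp; first exact: measurable_coord_rV).
    exact: measurable_fst.
  exact: measurable_snd.
by apply/funext => z; rewrite /coord_rV /= !mxE.
Qed.

Lemma measurable_fun_fstX (D : set 'rV[R]_n) (u : 'rV[R]_n -> R) : measurable D ->
  measurable_fun D u -> measurable_fun (D `*` D) (fun z => u z.1).
Proof.
move=> mD mu_; apply: (measurable_comp (F := D)) => //.
  by move=> _ [z [? ?] <-].
by apply: measurable_funTS; exact: measurable_fst.
Qed.

Lemma measurable_fun_sndX (D : set 'rV[R]_n) (u : 'rV[R]_n -> R) : measurable D ->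
  measurable_fun D u -> measurable_fun (D `*` D) (fun z => u z.2).
Proof.
move=> mD mu_; apply: (measurable_comp (F := D)) => //.
  by move=> _ [z [? ?] <-].
by apply: measurable_funTS; exact: measurable_snd.
Qed.

Definition sobolev_power (D : set 'rV[R]_n) (u : 'rV[R]_n -> R) : \bar R :=
  (gagliardo s p D u + \int[mu]_(x in D) (`|u x| `^ p)%:E)%E.

Lemma gagliardoE D u : gagliardo s p D u =
  weighted_power (mu \x mu)%E (D `*` D) (frac_kernel s p) p (fun z => u z.1 - u z.2).
Proof. by []. Qed.

Lemma lp_powerE D u : (\int[mu]_(x in D) (`|u x| `^ p)%:E)%E =
  weighted_power mu D (fun=> 1) p u.
Proof. by apply: eq_integral => x _; rewrite mulr1. Qed.

Lemma gagliardo_ge0 D u : (0 <= gagliardo s p D u)%E.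
Proof. by rewrite gagliardoE; apply: weighted_power_ge0 => z; exact: frac_kernel_ge0. Qed.

Lemma sobolev_power_ge0 D u : (0 <= sobolev_power D u)%E.
Proof.
apply: adde_ge0; first exact: gagliardo_ge0.
by apply: integral_ge0 => x _; rewrite lee_fin powR_ge0.
Qed.

Lemma sobolev_normX D u : (fs_norm (sobolev s p D) u `^ p = sobolev_power D u)%E.
Proof.
rewrite /= /sobolev_norm -poweRrM mulVf ?gt_eqF// poweRe1//.
exact: sobolev_power_ge0.
Qed.

Lemma gagliardoD D u v : measurable D -> measurable_fun D u -> measurable_fun D v ->
  (gagliardo s p D (fun x => u x + v x)%R <=
    (2 `^ p)%:E * (gagliardo s p D u + gagliardo s p D v))%E.
Proof.
move=> mD mu_ mv; rewrite !gagliardoE.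
have mB (f : 'rV[R]_n -> R) : measurable_fun D f -> measurable_fun (D `*` D) (fun z => f z.1 - f z.2).
  move=> mf; apply: measurable_funB; first exact: measurable_fun_fstX.
  exact: measurable_fun_sndX.
have mDD : measurable (D `*` D) by exact: measurableX.
have mK : measurable_fun (D `*` D) (@frac_kernel R n s p).
  by apply: measurable_funTS; exact: measurable_frac_kernel.
rewrite (_ : (fun z => _) = (fun z => (u z.1 - u z.2) + (v z.1 - v z.2))).
  apply: weighted_powerD => //; [exact: frac_kernel_ge0|exact: mB|exact: mB].
by apply/funext => z; ring.
Qed.

Lemma sobolev_powerD D u v : measurable D -> measurable_fun D u -> measurable_fun D v ->
  (sobolev_power D (u + v)%R <= (2 `^ p)%:E * (sobolev_power D u + sobolev_power D v))%E.
Proof.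
move=> mD mu_ mv.
have -> : (u + v)%R = (fun x => u x + v x)%R by [].
rewrite /sobolev_power !lp_powerE [X in (_ <= _ * X)%E]addeACA ge0_muleDr.
- apply: leeD; first exact: gagliardoD.
  apply: weighted_powerD => //; exact: measurable_cst.
- by rewrite adde_ge0// gagliardo_ge0.
- by rewrite adde_ge0// weighted_power_ge0.
Qed.

Lemma gagliardoZ D u (a : R) : measurable D -> measurable_fun D u ->
  gagliardo s p D (fun x => a * u x) = ((`|a| `^ p)%:E * gagliardo s p D u)%E.
Proof.
move=> mD mu_.
have mB : measurable_fun (D `*` D) (fun z => u z.1 - u z.2).
  apply: measurable_funB; first exact: measurable_fun_fstX.
  exact: measurable_fun_sndX.
have mDD : measurable (D `*` D) by exact: measurableX.
have mK : measurable_fun (D `*` D) (@frac_kernel R n s p).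
  by apply: measurable_funTS; exact: measurable_frac_kernel.
have := @weighted_powerZ _ _ _ (mu \x mu)%E (D `*` D) (frac_kernel s p) p
  mDD mK frac_kernel_ge0 (fun z => u z.1 - u z.2) a mB.
rewrite -gagliardoE => <-; rewrite gagliardoE.
by congr (weighted_power _ _ _ _ _); apply/funext => z; rewrite mulrBr.
Qed.

Lemma sobolev_powerZ D u (a : R) : measurable D -> measurable_fun D u ->
  sobolev_power D (a *: u) = ((`|a| `^ p)%:E * sobolev_power D u)%E.
Proof.
move=> mD mu_.
have -> : a *: u = (fun x => a * u x) by [].
rewrite /sobolev_power (gagliardoZ _ _ _ mD mu_) !lp_powerE.
rewrite (@weighted_powerZ _ _ _ mu D (fun=> 1) p)//.
have := gagliardo_ge0 D u; move: (gagliardo s p D u) => A A0.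
have : (0 <= weighted_power mu D (fun=> 1%R) p u)%E by exact: weighted_power_ge0.
by move: (weighted_power _ _ _ _ _) => B B0; rewrite ge0_muleDr.
Qed.

Lemma sobolevP D u : sobolev s p D u <->
  (measurable_fun D u /\ (sobolev_power D u < +oo)%E).
Proof.
split => -[mu_ Nu]; split => //.
  by rewrite -sobolev_normX; apply: poweR_lty.
by rewrite /sobolev_norm; apply: poweR_lty.
Qed.

Lemma sobolev_ge0 D u : (0 <= fs_norm (sobolev s p D) u)%E.
Proof. exact: poweR_ge0. Qed.

Lemma sobolev_norm0 D : fs_norm (sobolev s p D) 0 = 0%E.
Proof.
rewrite /= /sobolev_norm /gagliardo.
under eq_integral do rewrite subr0 normr0 powR0 ?gt_eqF// mul0r.
under [X in (_ + X)%E]eq_integral do rewrite normr0 powR0 ?gt_eqF//.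
by rewrite !integral0 adde0 poweR0r// invr_eq0 gt_eqF.
Qed.

Lemma sobolev_normN D u : fs_norm (sobolev s p D) (- u) = fs_norm (sobolev s p D) u.
Proof.
have e1 : gagliardo s p D (- u) = gagliardo s p D u.
  apply: eq_integral => z _.
  have -> : (- u) z.1 - (- u) z.2 = - (u z.1 - u z.2) by rewrite opprB addrC opprK.
  by rewrite normrN.
have e2 : (\int[mu]_(x in D) (`|(- u)%R x| `^ p)%:E = \int[mu]_(x in D) (`|u x| `^ p)%:E)%E.
  by apply: eq_integral => x _; rewrite normrN.
by rewrite /= /sobolev_norm e1 e2.
Qed.

Lemma sobolev0_mem D : sobolev s p D 0.
Proof.
split; first exact: measurable_cst.
by rewrite -[sobolev_norm s p D 0]/(fs_norm (sobolev s p D) 0) sobolev_norm0.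
Qed.

Lemma sobolev_lin D (a : R) u v : measurable D ->
  sobolev s p D u -> sobolev s p D v -> sobolev s p D (a *: u + v).
Proof.
move=> mD /sobolevP[mu_ fu] /sobolevP[mv fv]; apply/sobolevP.
have mau : measurable_fun D (a *: u).
  by apply: measurable_funM => //; exact: measurable_cst.
split; first exact: measurable_funD.
apply: le_lt_trans (sobolev_powerD _ _ _ mD mau mv) _.
rewrite lte_mul_pinfty// ?lee_fin ?powR_ge0//.
apply: lte_add_pinfty; [rewrite (sobolev_powerZ _ _ _ mD mu_)|exact: fv].
by apply: lte_mul_pinfty; [rewrite lee_fin powR_ge0| |exact: fu].
Qed.

Lemma sobolev_normD D u v : measurable D -> sobolev s p D u -> sobolev s p D v ->
  (fs_norm (sobolev s p D) (u + v)%R `^ p <= (2 `^ p)%:E *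
    (fs_norm (sobolev s p D) u `^ p + fs_norm (sobolev s p D) v `^ p))%E.
Proof.
move=> mD [mu_ _] [mv _].
by have := sobolev_powerD _ _ _ mD mu_ mv; rewrite -!sobolev_normX.
Qed.

End function_spaces.

Section tail.
Context {R : realType} {n : nat}.
Local Notation mu := (@lebesgue_rV R n).
Implicit Types (u v : 'rV[R]_n -> R).
Variables (q al : R).
Hypothesis q0 : 0 < q.

Definition tail_weight (x : 'rV[R]_n) : R := (1 + enorm x `^ (n%:R + al))^-1.

Definition tail_power (u : 'rV[R]_n -> R) : \bar R :=
  weighted_power mu setT tail_weight q u.

Let w0 x : 0 <= tail_weight x. Proof. exact: tail_weight_ge0. Qed.
Let mw : measurable_fun setT tail_weight. Proof. exact: measurable_tail_weight. Qed.

Lemma tail_power_ge0 u : (0 <= tail_power u)%E.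
Proof. exact: weighted_power_ge0. Qed.

Lemma tail_normX u : (fs_norm (tail_space q al) u `^ q = tail_power u)%E.
Proof.
rewrite /= /tail_norm -poweRrM mulVf ?gt_eqF// poweRe1//.
exact: tail_power_ge0.
Qed.

Lemma tail_normD u v : tail_space q al u -> tail_space q al v ->
  (fs_norm (tail_space q al) (u + v)%R `^ q <= (2 `^ q)%:E *
    (fs_norm (tail_space q al) u `^ q + fs_norm (tail_space q al) v `^ q))%E.
Proof.
move=> [mu_ _ _] [mv _ _].
have h : (tail_power (u + v)%R <= (2 `^ q)%:E * (tail_power u + tail_power v))%E.
  exact: (@weighted_powerD _ _ _ mu setT tail_weight q measurableT mw w0 q0 u v).
by rewrite -(tail_normX (u + v)) -(tail_normX u) -(tail_normX v) in h.
Qed.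

Lemma tail_norm0 : fs_norm (tail_space q al) (0 : 'rV[R]_n -> R) = 0%E.
Proof.
rewrite /= /tail_norm.
under eq_integral do rewrite normr0 powR0 ?gt_eqF// mul0r.
by rewrite integral0 poweR0r// invr_eq0 gt_eqF.
Qed.

Lemma tail_normN u :
  fs_norm (tail_space q al) (- u) = fs_norm (tail_space q al) u.
Proof.
have e : (\int[mu]_x (`|(- u)%R x| `^ q / (1 + enorm x `^ (n%:R + al)))%:E =
  \int[mu]_x (`|u x| `^ q / (1 + enorm x `^ (n%:R + al)))%:E)%E.
  by apply: eq_integral => x _; rewrite normrN.
by rewrite /= /tail_norm e.
Qed.

Lemma tail0_mem : tail_space q al (0 : 'rV[R]_n -> R).
Proof.
split; first exact: measurable_cst.
  move=> K cK; under eq_integral do rewrite normr0 powR0 ?gt_eqF//.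
  by rewrite integral0.
by rewrite -[tail_norm q al 0]/(fs_norm (tail_space q al) 0) tail_norm0.
Qed.

Lemma tail_lin (a : R) u v :
  tail_space q al u -> tail_space q al v -> tail_space q al (a *: u + v).
Proof.
move=> [mu_ lu tu] [mv lv tv].
have mau : measurable_fun setT (a *: u).
  by apply: measurable_funM => //; exact: measurable_cst.
have powfin f : (tail_norm q al f < +oo)%E -> (tail_power f < +oo)%E.
  by move=> tf; rewrite -tail_normX; exact: poweR_lty.
split; first exact: measurable_funD.
- move=> K cK.
  have mK : measurable K.
    apply: closed_measurable_rV.
    by apply: compact_closed => //; exact: norm_hausdorff.
  have e f : (\int[mu]_(x in K) (`|f x| `^ q)%:E)%E = weighted_power mu K (fun=> 1) q f.
    by apply: eq_integral => x _; rewrite mulr1.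
  have mau' : measurable_fun K (a *: u) by exact: measurable_funTS.
  have mv' : measurable_fun K v by exact: measurable_funTS.
  have mu' : measurable_fun K u by exact: measurable_funTS.
  have m1 : measurable_fun K (fun=> 1 : R) by exact: measurable_cst.
  have := @weighted_powerD _ _ _ mu K (fun=> 1) q mK m1 (fun=> ler01) q0 _ _ mau' mv'.
  rewrite e => /le_lt_trans; apply; apply: lte_mul_pinfty.
  + by rewrite lee_fin powR_ge0.
  + by [].
  + apply: lte_add_pinfty; last by rewrite -e; exact: lv.
    rewrite (@weighted_powerZ _ _ _ mu K (fun=> 1) q mK m1 (fun=> ler01) u a mu').
    apply: lte_mul_pinfty; [by rewrite lee_fin powR_ge0|by []|].
    by rewrite -e; exact: lu.
- apply: poweR_lty.
  have := @weighted_powerD _ _ _ mu setT tail_weight q measurableT mw w0 q0 _ _ mau mv.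
  move=> /le_lt_trans; apply; apply: lte_mul_pinfty.
  + by rewrite lee_fin powR_ge0.
  + by [].
  + apply: lte_add_pinfty; last exact: powfin.
    rewrite (@weighted_powerZ _ _ _ mu setT tail_weight q measurableT mw w0 u a mu_).
    apply: lte_mul_pinfty; [by rewrite lee_fin powR_ge0|by []|exact: powfin].
Qed.

End tail.

Section nonneg_integrals.
Context d (T : measurableType d) (R : realType).
Variable mu : {measure set T -> \bar R}.
Implicit Types f g : T -> R.

Lemma integralD_nonneg f g : measurable_fun setT f -> measurable_fun setT g ->
  (forall x, 0 <= f x) -> (forall x, 0 <= g x) ->
  (\int[mu]_x (f x + g x)%:E = \int[mu]_x (f x)%:E + \int[mu]_x (g x)%:E)%E.
Proof.
move=> mf mg f0 g0; rewrite -ge0_integralD//.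
- by move=> x _; rewrite lee_fin.
- exact/measurable_EFinP.
- by move=> x _; rewrite lee_fin.
- exact/measurable_EFinP.
Qed.

Lemma integralZ_nonneg f k : measurable_fun setT f -> (forall x, 0 <= f x) -> 0 <= k ->
  (\int[mu]_x (k * f x)%:E = k%:E * \int[mu]_x (f x)%:E)%E.
Proof.
move=> mf f0 k0; rewrite -ge0_integralZl_EFin//.
- by move=> x _; rewrite lee_fin.
- exact/measurable_EFinP.
Qed.

End nonneg_integrals.

Section product_integrals.
Context d1 d2 (T1 : measurableType d1) (T2 : measurableType d2) (R : realType).
Variables (m1 : {sigma_finite_measure set T1 -> \bar R})
  (m2 : {sigma_finite_measure set T2 -> \bar R}).
Variables (a : T1 -> R) (b : T2 -> R).
Hypothesis ma : measurable_fun setT a.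
Hypothesis mb : measurable_fun setT b.
Hypothesis a0 : forall x, 0 <= a x.
Hypothesis b0 : forall x, 0 <= b x.

Lemma measurable_fun_tensor : measurable_fun setT (fun z : T1 * T2 => a z.1 * b z.2).
Proof.
apply: measurable_funM.
  by apply: (measurableT_comp ma); exact: measurable_fst.
by apply: (measurableT_comp mb); exact: measurable_snd.
Qed.

Lemma integral_tensor :
  (\int[m1 \x m2]_z (a z.1 * b z.2)%:E =
   (\int[m1]_x (a x)%:E) * (\int[m2]_y (b y)%:E))%E.
Proof.
rewrite fubini_tonelli1; last 2 first.
- by apply/measurable_EFinP; exact: measurable_fun_tensor.
- by move=> z; rewrite lee_fin mulr_ge0.
have ea x : fubini_F m2 (fun z => (a z.1 * b z.2)%:E) x =
    ((\int[m2]_y (b y)%:E) * (a x)%:E)%E.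
  by rewrite /fubini_F /= integralZ_nonneg// muleC.
rewrite (eq_integral (fun x => (\int[m2]_y (b y)%:E) * (a x)%:E)%E)//.
rewrite ge0_integralZl//; first by rewrite muleC.
- exact/measurable_EFinP.
- by move=> x _; rewrite lee_fin.
- by apply: integral_ge0 => y _; rewrite lee_fin.
Qed.

End product_integrals.

(** * The nonlocal form *)

Section pointwise_bounds.
Context {R : realType}.
Implicit Types (p d x y z a b c : R).

Lemma powR_norm3 p x y z : 0 <= p ->
  (`|x| + `|y| + `|z|) `^ p <= 4 `^ p * (`|x| `^ p + `|y| `^ p + `|z| `^ p).
Proof.
move=> p0; have h1 := powRD_le p (`|x| + `|y|) `|z| p0 (addr_ge0 _ _) (normr_ge0 _).
apply: le_trans (h1 (normr_ge0 _) (normr_ge0 _)) _.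
have h2 := powRD_le p `|x| `|y| p0 (normr_ge0 _) (normr_ge0 _).
have e4 : 4 `^ p = 2 `^ p * 2 `^ p :> R by rewrite -powRM//; congr (_ `^ _); ring.
rewrite e4 -mulrA ler_wpM2l ?powR_ge0// mulrDr lerD// ler_peMl ?powR_ge0//.
by rewrite -[X in X <= _](powRr0 2) ler_powR// ler1n.
Qed.

Lemma powR_normB p x y : 0 <= p ->
  `|x - y| `^ p <= 2 `^ p * (`|x| `^ p + `|y| `^ p).
Proof.
move=> p0.
apply: le_trans (powRD_le p _ _ p0 (normr_ge0 x) (normr_ge0 y)).
by apply: le_powRl => //; exact: ler_normB.
Qed.

(** For pairs inside D, where p-th powers of all three differences are integrable: with S = |a| +
    |b| + |c| the factors other than |a - b| go into S^(p-1), which [powR_absorb] trades against |a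
    - b|^p. *)
Lemma Jp_near p d a b c : 2 < p -> 0 < d ->
  `|Jp p a - Jp p b| * `|c| <= (p - 1) * 4 `^ p *
    (d * (`|a| `^ p + `|b| `^ p + `|c| `^ p) + d `^ (1 - p) * `|a - b| `^ p).
Proof.
move=> p2 d0; have p10 : 0 <= p - 1 by lra.
set S := `|a| + `|b| + `|c|.
have S0 : 0 <= S by rewrite !addr_ge0.
have : `|Jp p a - Jp p b| * `|c| <= (p - 1) * (`|a - b| * S `^ (p - 1)).
  have -> : p - 1 = p - 2 + 1 by ring.
  rewrite powRS//; last by lra.
  have h := Jp_lip p a b p2.
  apply: (@le_trans _ _ ((p - 1) * (`|a - b| * (`|a| + `|b|) `^ (p - 2)) * `|c|)).
    by rewrite ler_wpM2r.
  have -> : p - 2 + 1 = p - 1 by ring.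
  rewrite -!mulrA ler_wpM2l// ler_wpM2l// [S * _]mulrC.
  apply: ler_pM => //.
    by apply: le_powRl; [lra|exact: addr_ge0|rewrite lerDl].
  by rewrite lerDr addr_ge0.
move=> /le_trans; apply.
rewrite -mulrA ler_wpM2l//.
have := powR_absorb (p - 1) d `|a - b| S p10 d0 (normr_ge0 _) S0.
rewrite subrK opprB => /le_trans; apply.
have p0 : 0 <= p by lra.
have h3 := powR_norm3 p a b c p0.
rewrite mulrDr; apply: lerD.
  by rewrite mulrCA ler_wpM2l// ltW.
rewrite ler_peMl ?mulr_ge0 ?powR_ge0//.
by rewrite -[X in X <= _](powRr0 4) ler_powR// ler1n.
Qed.

(** For pairs at a distance only powers p - 1 of the values are integrable, so c is spent through
    its bound 1 and [powR_absorb] runs with exponent p - 2. *)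
Lemma Jp_far p d x1 y1 x2 y2 c : 2 < p -> 0 < d -> `|c| <= 1 ->
  `|Jp p (x1 - y1) - Jp p (x2 - y2)| * `|c| <= (p - 1) * 4 `^ p *
    (d * ((`|x1| `^ (p - 1) + `|y1| `^ (p - 1)) +
          (`|x2| `^ (p - 1) + `|y2| `^ (p - 1))) +
     d `^ (2 - p) * (`|x1 - x2| `^ (p - 1) + `|y1 - y2| `^ (p - 1))).
Proof.
move=> p2 d0 c1; have p10 : 0 <= p - 1 by lra.
set a := x1 - y1; set b := x2 - y2.
have S0 : 0 <= `|a| + `|b| by rewrite addr_ge0.
apply: (@le_trans _ _ ((p - 1) * (`|a - b| * (`|a| + `|b|) `^ (p - 2)))).
  apply: le_trans (Jp_lip p a b p2).
  by rewrite -[leRHS]mulr1 ler_wpM2l.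
rewrite -mulrA ler_wpM2l//.
have p20 : 0 <= p - 2 by lra.
have := powR_absorb (p - 2) d `|a - b| _ p20 d0 (normr_ge0 _) S0.
rewrite (opprB p 2); have -> : p - 2 + 1 = p - 1 by ring.
move=> /le_trans; apply.
have e4 : 4 `^ (p - 1) = 2 `^ (p - 1) * 2 `^ (p - 1) :> R.
  by rewrite -powRM//; congr (_ `^ _); ring.
have l4 : 4 `^ (p - 1) <= 4 `^ p :> R by rewrite ler_powR ?ler1n// gerBl.
have l2 : 1 <= 2 `^ (p - 1) :> R.
  by rewrite -[X in X <= _](powRr0 2) ler_powR// ler1n.
have l2' : 0 <= 2 `^ (p - 1) :> R by exact: powR_ge0.
rewrite mulrDr; apply: lerD.
  rewrite mulrCA ler_wpM2l ?(ltW d0)//.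
  apply: le_trans (powRD_le (p - 1) _ _ p10 (normr_ge0 _) (normr_ge0 _)) _.
  have ha := powR_normB (p - 1) x1 y1 p10; have hb := powR_normB (p - 1) x2 y2 p10.
  apply: (@le_trans _ _ (4 `^ (p - 1) * (`|x1| `^ (p - 1) + `|y1| `^ (p - 1) +
      (`|x2| `^ (p - 1) + `|y2| `^ (p - 1))))).
    by rewrite e4 -mulrA ler_wpM2l// mulrDr lerD.
  by rewrite ler_wpM2r// !addr_ge0// powR_ge0.
rewrite mulrCA ler_wpM2l ?powR_ge0//.
have -> : a - b = (x1 - x2) - (y1 - y2) by rewrite /a /b; ring.
apply: le_trans (powR_normB (p - 1) _ _ p10) _.
rewrite ler_wpM2r ?addr_ge0 ?powR_ge0//; apply: le_trans l4.
by rewrite e4 ler_peMl.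
Qed.

End pointwise_bounds.

Section nonlocal_form.
Context {R : realType} {n : nat}.
Local Notation mu := (@lebesgue_rV R n).
Variables (p s : R) (Om D : set 'rV[R]_n).
Implicit Types (g phi : 'rV[R]_n -> R) (z : 'rV[R]_n * 'rV[R]_n).
Hypothesis p2 : 2 < p.
Hypothesis s0 : 0 < s.
Hypothesis oOm : open Om.
Hypothesis bOm : bounded_set Om.
Hypothesis oD : open D.
Hypothesis OmD : compactly_contained Om D.

Local Notation wt := (tail_weight (s * p)).
Local Notation K := (frac_kernel s p).
Local Notation q := (p - 1).

Let mOm : measurable Om. Proof. exact: measurable_open_rV. Qed.
Let mD : measurable D. Proof. exact: measurable_open_rV. Qed.
Let q0 : 0 < q. Proof. by have := p2; lra. Qed.
Let p0 : 0 < p. Proof. by have := p2; lra. Qed.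
Let sp0 : 0 < s * p. Proof. exact: mulr_gt0. Qed.
Let wt0 (x : 'rV[R]_n) : 0 <= wt x. Proof. exact: tail_weight_ge0. Qed.
Let mwt : measurable_fun setT (wt : 'rV[R]_n -> R).
Proof. exact: measurable_tail_weight. Qed.
Let beta0 : 0 <= n%:R + s * p. Proof. by rewrite addr_ge0// ltW. Qed.
Let OmfD x : Om x -> D x.
Proof. by move=> Ox; apply: OmD.2; exact: subset_closure. Qed.

(** A point of Om and a point off D are at least some d > 0 apart, so |x - y| controls |y| and the
    kernel decays like the tail weight in y. *)
Lemma far_kernel_le : exists2 C1 : R, 0 <= C1 & forall x y, Om x -> ~ D y ->
  enorm (x - y) `^ (- (n%:R + s * p)) <= C1 * wt y.
Proof.
have [|d d0 hd] := compact_closed_dist _ (~` D) OmD.1 (open_closedC oD).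
  by rewrite -subset0 => x [/OmD.2 Dx].
have [M M0 OmM] := bounded_set_norm _ bOm.
set be := n%:R + s * p.
(* |y| <= M + |x - y| <= (M / d + 1) |x - y|; the factor n passes from the sup norm to [enorm]. *)
pose c : R := n%:R * (M / d + 1).
have c0 : 0 <= c by rewrite mulr_ge0// addr_ge0// divr_ge0// ltW.
(* One summand for each term of 1 + |y|^be in the weight. *)
exists (d `^ (- be) + c `^ be); first by rewrite addr_ge0// powR_ge0.
move=> x y Ox nDy; set r := enorm (x - y).
have dxy : d <= `|x - y| by apply: hd => //; exact: subset_closure.
have dr : d <= r by apply: le_trans dxy (norm_le_enorm _).
have r0 : 0 < r by exact: lt_le_trans dr.
have ec : enorm y <= c * r.
  apply: le_trans (enorm_le_norm y) _; rewrite /c -mulrA ler_wpM2l//.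
  apply: (@le_trans _ _ (M + `|x - y|)).
    have -> : y = x - (x - y) by rewrite opprB addrC subrK.
    apply: le_trans (ler_normB _ _) _.
    have -> : x - (x - (x - y)) = x - y by rewrite opprB addrC subrK.
    by rewrite lerD2r; exact: OmM.
  rewrite mulrDl mul1r lerD ?norm_le_enorm//.
  by rewrite mulrAC ler_pdivlMr// ler_wpM2l// ltW.
rewrite powRN /tail_weight -/be.
have pos : 0 < 1 + enorm y `^ be by rewrite ltr_wpDr// powR_ge0.
have re0 : 0 < r `^ be by exact: powR_gt0.
rewrite ler_pdivlMr; last exact: pos.
rewrite mulrC ler_pdivrMr; last exact: re0.
rewrite mulrDl; apply: lerD.
  by rewrite powRN mulrC ler_pdivlMr ?powR_gt0// mul1r le_powRl// ltW.
rewrite -powRM//; last exact: ltW.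
by apply: le_powRl => //; exact: enorm_ge0.
Qed.

(** A symmetric majorant, up to a constant, of the kernel on pairs with one point in Om and the
    other off D; it is a sum of tensor products so that Tonelli applies. *)
Definition far_weight z : R := \1_Om z.1 * wt z.2 + wt z.1 * \1_Om z.2.

Lemma far_weight_ge0 z : 0 <= far_weight z.
Proof. by rewrite addr_ge0// mulr_ge0. Qed.

Let mind : measurable_fun setT (\1_Om : 'rV[R]_n -> R).
Proof. exact: measurable_indic. Qed.

Lemma measurable_far_weight : measurable_fun setT far_weight.
Proof. by apply: measurable_funD; exact: measurable_fun_tensor. Qed.

Definition tail_pair g z : R := (`|g z.1| `^ q + `|g z.2| `^ q) * far_weight z.

Lemma tail_pair_ge0 g z : 0 <= tail_pair g z.
Proof. by rewrite mulr_ge0 ?far_weight_ge0// addr_ge0// powR_ge0. Qed.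

Let mpow g : measurable_fun setT g -> measurable_fun setT (fun x => `|g x| `^ q).
Proof. by move=> mg; apply: measurable_fun_powR; exact: measurableT_comp. Qed.

Lemma measurable_tail_pair g : measurable_fun setT g ->
  measurable_fun setT (tail_pair g).
Proof.
move=> mg; apply: measurable_funM; last exact: measurable_far_weight.
apply: measurable_funD.
  by apply: (measurableT_comp (mpow _ mg)); exact: measurable_fst.
by apply: (measurableT_comp (mpow _ mg)); exact: measurable_snd.
Qed.

(** Expanding gives four tensor products, which Tonelli factorises. As Om is bounded, its indicator
    is at most C3 [wt], and every factor reduces to the tail integral, the mass of [wt] or the
    measure of Om. *)
Lemma integral_tail_pair_le : exists2 C4 : R, 0 <= C4 &
  forall g, measurable_fun setT g ->
  (\int[(mu \x mu)%E]_z (tail_pair g z)%:E <= C4%:E * tail_power q (s * p) g)%E.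
Proof.
have [M M0 OmM] := bounded_set_norm _ bOm.
pose C3 : R := 1 + (n%:R * M) `^ (n%:R + s * p).
have C30 : 0 < C3 by rewrite ltr_wpDr// powR_ge0.
have indC3 x : \1_Om x <= C3 * wt x.
  rewrite indicE; have [|_] := boolP (x \in Om); last by rewrite mulr_ge0// ltW.
  rewrite inE => /OmM xM; rewrite /tail_weight ler_pdivlMr ?mul1r; last first.
    by rewrite ltr_wpDr// powR_ge0.
  rewrite lerD2l; apply: le_powRl => //; first exact: enorm_ge0.
  by apply: le_trans (enorm_le_norm x) _; rewrite ler_wpM2l.
pose W := (\int[mu]_x (wt x)%:E)%E.
have Wfin : W \is a fin_num.
  rewrite ge0_fin_numE; first exact: tail_weight_integrable.
  by apply: integral_ge0 => x _; rewrite lee_fin.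
have W0 : (0 <= W)%E by apply: integral_ge0 => x _; rewrite lee_fin.
have mufin : mu Om \is a fin_num.
  by rewrite ge0_fin_numE//; exact: bounded_set_finite_measure.
exists (2 * (C3 * fine W + fine (mu Om))).
  rewrite mulr_ge0// addr_ge0//; last exact: fine_ge0.
  by rewrite mulr_ge0 ?fine_ge0// ltW.
move=> g mg; set G := fun x => `|g x| `^ q.
have G0 x : 0 <= G x by exact: powR_ge0.
have mG : measurable_fun setT G by exact: mpow.
have mG1 : measurable_fun setT (fun x => G x * \1_Om x) by exact: measurable_funM.
have mGw : measurable_fun setT (fun x => G x * wt x) by exact: measurable_funM.
have G10 x : 0 <= G x * \1_Om x by rewrite mulr_ge0.
have Gw0 x : 0 <= G x * wt x by rewrite mulr_ge0.
pose f1 z : R := (G z.1 * \1_Om z.1) * wt z.2.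
pose f2 z : R := (G z.1 * wt z.1) * \1_Om z.2.
pose f3 z : R := \1_Om z.1 * (G z.2 * wt z.2).
pose f4 z : R := wt z.1 * (G z.2 * \1_Om z.2).
have -> : tail_pair g = fun z => (f1 z + f2 z) + (f3 z + f4 z).
  apply/funext => z; rewrite /tail_pair /far_weight /f1 /f2 /f3 /f4 -/(G z.1) -/(G z.2).
  move: (G z.1) (G z.2) (\1_Om z.1) (\1_Om z.2) (wt z.1) (wt z.2) => *; ring.
have mf1 : measurable_fun setT f1 := @measurable_fun_tensor _ _ _ _ _ _ _ mG1 mwt.
have mf2 : measurable_fun setT f2 := @measurable_fun_tensor _ _ _ _ _ _ _ mGw mind.
have mf3 : measurable_fun setT f3 := @measurable_fun_tensor _ _ _ _ _ _ _ mind mGw.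
have mf4 : measurable_fun setT f4 := @measurable_fun_tensor _ _ _ _ _ _ _ mwt mG1.
have f10 z : 0 <= f1 z by exact: mulr_ge0.
have f20 z : 0 <= f2 z by exact: mulr_ge0.
have f30 z : 0 <= f3 z by exact: mulr_ge0.
have f40 z : 0 <= f4 z by exact: mulr_ge0.
have e12 := @integralD_nonneg _ _ _ (mu \x mu)%E _ _ mf1 mf2 f10 f20.
have e34 := @integralD_nonneg _ _ _ (mu \x mu)%E _ _ mf3 mf4 f30 f40.
have f120 z : 0 <= f1 z + f2 z by exact: addr_ge0.
have f340 z : 0 <= f3 z + f4 z by exact: addr_ge0.
have := @integralD_nonneg _ _ _ (mu \x mu)%E _ _
  (measurable_funD mf1 mf2) (measurable_funD mf3 mf4) f120 f340.
rewrite e12 e34 => ->.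
have i0 (x : 'rV[R]_n) : 0 <= \1_Om x :> R by [].
have -> := @integral_tensor _ _ _ _ _ mu mu _ _ mG1 mwt G10 wt0.
have -> := @integral_tensor _ _ _ _ _ mu mu _ _ mGw mind Gw0 i0.
have -> := @integral_tensor _ _ _ _ _ mu mu _ _ mind mGw i0 Gw0.
have -> := @integral_tensor _ _ _ _ _ mu mu _ _ mwt mG1 wt0 G10.
have eOm : (\int[mu]_x (\1_Om x)%:E = mu Om)%E by rewrite integral_indic// setIT.
have I1 : (\int[mu]_x (G x * \1_Om x)%:E <= C3%:E * \int[mu]_x (G x * wt x)%:E)%E.
  rewrite -integralZ_nonneg//; last exact: ltW.
  apply: ge0_le_integral => //.
  - by move=> x _; rewrite lee_fin.
  - exact/measurable_EFinP.
  - by apply/measurable_EFinP; exact: measurable_funM.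
  - by move=> x _; rewrite lee_fin mulrCA ler_wpM2l.
rewrite eOm -/W.
have -> : tail_power q (s * p) g = (\int[mu]_x (G x * wt x)%:E)%E by [].
have T0 : (0 <= \int[mu]_x (G x * wt x)%:E)%E.
  by apply: integral_ge0 => x _; rewrite lee_fin.
have I0 : (0 <= \int[mu]_x (G x * \1_Om x)%:E)%E.
  by apply: integral_ge0 => x _; rewrite lee_fin.
move: I0 I1 T0; move: (\int[mu]_x (G x * \1_Om x)%:E)%E => I.
move: (\int[mu]_x (G x * wt x)%:E)%E => T I0 I1 T0.
have h : (I * W + T * mu Om <= (C3 * fine W + fine (mu Om))%:E * T)%E.
  rewrite EFinD EFinM ge0_muleDl ?lee_fin ?fine_ge0 ?mulr_ge0 ?fine_ge0 ?(ltW C30)//.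
  rewrite !fineK// [(mu Om * T)%E]muleC leeD2r// -muleA [(W * T)%E]muleC muleA.
  exact: lee_wpmul2r.
rewrite (muleC (mu Om)) (muleC W) [X in (_ + X)%E]addeC.
apply: le_trans (leeD h h) _.
rewrite -ge0_muleDl ?lee_fin ?addr_ge0 ?fine_ge0 ?mulr_ge0 ?fine_ge0 ?(ltW C30)//.
by rewrite -EFinD mulr_natl mulr2n.
Qed.

Definition near_pair g z : R := `|g z.1 - g z.2| `^ p * K z * \1_(D `*` D) z.

Let K0 z : 0 <= K z. Proof. exact: powR_ge0. Qed.
Let mK : measurable_fun setT (K : 'rV[R]_n * 'rV[R]_n -> R).
Proof. exact: measurable_frac_kernel. Qed.

Lemma near_pair_ge0 g z : 0 <= near_pair g z.
Proof. by apply: mulr_ge0 => //; apply: mulr_ge0 => //; exact: powR_ge0. Qed.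

Lemma measurable_gap g : measurable_fun setT g ->
  measurable_fun setT (fun z : 'rV[R]_n * 'rV[R]_n => g z.1 - g z.2).
Proof.
move=> mg; apply: measurable_funB.
  by apply: (measurableT_comp mg); exact: measurable_fst.
by apply: (measurableT_comp mg); exact: measurable_snd.
Qed.

Lemma measurable_near_pair g : measurable_fun setT g ->
  measurable_fun setT (near_pair g).
Proof.
move=> mg; apply: measurable_funM; last first.
  by apply: measurable_indic; exact: measurableX.
apply: measurable_funM => //; apply: measurable_fun_powR.
by apply: measurableT_comp => //; exact: measurable_gap.
Qed.

Lemma integral_near_pair g :
  (\int[(mu \x mu)%E]_z (near_pair g z)%:E = gagliardo s p D g)%E.
Proof.
rewrite /gagliardo [RHS]integral_mkcond; apply: eq_integral => z _.
rewrite /patch /near_pair indicE; case: ifPn => _; first by rewrite mulr1.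
by rewrite mulr0.
Qed.

(* [d] is the weight in Young's inequality; [d -> 0] makes the first group small. *)
Lemma form_integrand_le : exists2 C : R, 0 <= C & forall d g1 g2 phi z, 0 < d ->
  (forall x, ~ Om x -> phi x = 0) -> (forall x, 0 <= phi x <= 1) ->
  `|Jp p (g1 z.1 - g1 z.2) - Jp p (g2 z.1 - g2 z.2)| * `|phi z.1 - phi z.2| * K z <=
  C * (d * ((near_pair g1 z + tail_pair g1 z) + (near_pair g2 z + tail_pair g2 z) +
            near_pair phi z) +
       (d `^ (1 - p) + d `^ (2 - p)) *
         (near_pair (g1 \- g2) z + tail_pair (g1 \- g2) z)).
Proof.
have [C1 C10 hC1] := far_kernel_le.
pose c : R := (p - 1) * 4 `^ p.
have c0 : 0 <= c by rewrite mulr_ge0 ?powR_ge0// ltW.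
exists (c * (1 + C1)); first by rewrite mulr_ge0// addr_ge0.
move=> d g1 g2 phi z d0 phi0 phi1.
set a := g1 z.1 - g1 z.2; set b := g2 z.1 - g2 z.2; set cc := phi z.1 - phi z.2.
set h := g1 \- g2.
have n1 := near_pair_ge0 g1 z; have n2 := near_pair_ge0 g2 z.
have n3 := near_pair_ge0 phi z; have n4 := near_pair_ge0 h z.
have t1 := tail_pair_ge0 g1 z; have t2 := tail_pair_ge0 g2 z.
have t4 := tail_pair_ge0 h z.
set e1 := d `^ (1 - p); set e2 := d `^ (2 - p).
have e10 : 0 <= e1 by exact: powR_ge0.
have e20 : 0 <= e2 by exact: powR_ge0.
have d0' := ltW d0.
set RHS := d * _ + _.
have R0 : 0 <= RHS.
  apply: addr_ge0; first by apply: mulr_ge0 => //; rewrite !addr_ge0.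
  by apply: mulr_ge0; exact: addr_ge0.
have cc1 : `|cc| <= 1.
  have /andP[? ?] := phi1 z.1; have /andP[? ?] := phi1 z.2.
  by rewrite /cc ler_norml; apply/andP; split; lra.
(* Three cases: both points in D; one in Om and the other off D, where [far_kernel_le] applies; both
   off Om, where phi vanishes at both. *)
have [zD|zD] := pselect ((D `*` D) z).
  have npE g : near_pair g z = `|g z.1 - g z.2| `^ p * K z.
    by rewrite /near_pair indicE mem_set// mulr1.
  have near : `|Jp p a - Jp p b| * `|cc| * K z <= c * RHS.
    apply: (@le_trans _ _ (c * (d * (near_pair g1 z + near_pair g2 z + near_pair phi z) +
        e1 * near_pair h z))).
      have -> : c * (d * (near_pair g1 z + near_pair g2 z + near_pair phi z) +
          e1 * near_pair h z) =
        c * (d * (`|a| `^ p + `|b| `^ p + `|cc| `^ p) + e1 * `|a - b| `^ p) * K z.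
        have -> : a - b = h z.1 - h z.2 by rewrite /h /a /b /=; ring.
        rewrite !npE -/a -/b -/cc.
        move: (`|a| `^ p) (`|b| `^ p) (`|cc| `^ p) (`|h z.1 - h z.2| `^ p) (K z) => *.
        ring.
      by apply: ler_wpM2r => //; exact: Jp_near.
    apply: ler_wpM2l => //; apply: lerD.
      apply: ler_wpM2l => //; lra.
    by apply: ler_pM => //; rewrite lerDl.
  apply: le_trans near _; rewrite -mulrA; apply: ler_wpM2l => //.
  by rewrite -[leLHS]mul1r; apply: ler_wpM2r => //; rewrite lerDl.
have far : K z <= C1 * far_weight z ->
    `|Jp p a - Jp p b| * `|cc| * K z <= c * (1 + C1) * RHS.
  move=> hK.
  have tpE g : tail_pair g z = (`|g z.1| `^ q + `|g z.2| `^ q) * far_weight z by [].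
  apply: (@le_trans _ _ (c * (d * (tail_pair g1 z + tail_pair g2 z) +
      e2 * tail_pair h z) * C1)).
    have -> : c * (d * (tail_pair g1 z + tail_pair g2 z) + e2 * tail_pair h z) * C1 =
      c * (d * ((`|g1 z.1| `^ q + `|g1 z.2| `^ q) + (`|g2 z.1| `^ q + `|g2 z.2| `^ q)) +
      e2 * (`|g1 z.1 - g2 z.1| `^ q + `|g1 z.2 - g2 z.2| `^ q)) * (C1 * far_weight z).
      rewrite !tpE /h /=.
      move: (`|g1 z.1| `^ q) (`|g1 z.2| `^ q) (`|g2 z.1| `^ q) (`|g2 z.2| `^ q).
      move: (`|g1 z.1 - g2 z.1| `^ q) (`|g1 z.2 - g2 z.2| `^ q) (far_weight z) => *.
      ring.
    apply: ler_pM => //.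
    exact: Jp_far.
  have inner : d * (tail_pair g1 z + tail_pair g2 z) + e2 * tail_pair h z <= RHS.
    apply: lerD; first by apply: ler_wpM2l => //; lra.
    by apply: ler_pM => //; rewrite lerDr.
  have inner0 : 0 <= d * (tail_pair g1 z + tail_pair g2 z) + e2 * tail_pair h z.
    by apply: addr_ge0; apply: mulr_ge0 => //; exact: addr_ge0.
  rewrite -(mulrA c _ C1) -(mulrA c (1 + C1)); apply: ler_wpM2l => //.
  rewrite [leRHS]mulrC; apply: ler_pM => //.
  by rewrite lerDr.
have [z1|z1] := pselect (Om z.1).
  apply: far; have nD2 : ~ D z.2 by move=> D2; apply: zD; split => //; exact: OmfD.
  apply: le_trans (hC1 _ _ z1 nD2) _; apply: ler_wpM2l => //.
  by rewrite /far_weight indicE mem_set// mul1r lerDl mulr_ge0.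
have [z2|z2] := pselect (Om z.2).
  apply: far; have nD1 : ~ D z.1 by move=> D1; apply: zD; split => //; exact: OmfD.
  have := hC1 _ _ z2 nD1; rewrite -enormN opprB => /le_trans; apply.
  apply: ler_wpM2l => //.
  by rewrite /far_weight [\1_Om z.2]indicE mem_set// mulr1 lerDr mulr_ge0.
rewrite /cc phi0// phi0// subrr normr0 mulr0 mul0r.
by apply: mulr_ge0 => //; apply: mulr_ge0 => //; exact: addr_ge0.
Qed.

Lemma measurable_Jp : measurable_fun setT (Jp p : R -> R).
Proof.
apply: measurable_funM => //; apply: measurable_fun_powR.
exact: normr_measurable.
Qed.

(** Of mixed degree on purpose, p near and p - 1 far: these are the powers available for u and v and
    the ones that [form_integrand_le] produces. *)
Definition pair_power g : \bar R := (gagliardo s p D g + tail_power q (s * p) g)%E.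

(** The powers d^(1-p) and d^(2-p) come from the near and the far Young inequality. They multiply
    only the bound on g1 - g2, so d can be fixed first and the difference made small afterwards. *)
Lemma integral_form_le : exists2 C : R, 0 <= C &
  forall (d : R) g1 g2 phi (a1 a2 a3 a4 : R), 0 < d ->
  measurable_fun setT g1 -> measurable_fun setT g2 -> measurable_fun setT phi ->
  (forall x, ~ Om x -> phi x = 0) -> (forall x, 0 <= phi x <= 1) ->
  (pair_power g1 <= a1%:E)%E -> (pair_power g2 <= a2%:E)%E ->
  (gagliardo s p D phi <= a3%:E)%E -> (pair_power (g1 \- g2)%R <= a4%:E)%E ->
  (\int[(mu \x mu)%E]_z
    (`|Jp p (g1 z.1 - g1 z.2) - Jp p (g2 z.1 - g2 z.2)| * `|phi z.1 - phi z.2| * K z)%:E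
   <= (C * (d * (a1 + a2 + a3) + (d `^ (1 - p) + d `^ (2 - p)) * a4))%:E)%E.
Proof.
have [C C0 hC] := form_integrand_le.
have [C4 C40 hC4] := integral_tail_pair_le.
exists (C * (1 + C4)); first by rewrite mulr_ge0// addr_ge0.
move=> d g1 g2 phi a1 a2 a3 a4 d0 m1 m2 m3 phi0 phi1 h1 h2 h3 h4.
have m4 : measurable_fun setT (g1 \- g2) by exact: measurable_funB.
set e := d `^ (1 - p) + d `^ (2 - p).
have e0 : 0 <= e by rewrite addr_ge0// powR_ge0.
pose P g z := near_pair g z + tail_pair g z.
have mP g : measurable_fun setT g -> measurable_fun setT (P g).
  move=> mg; apply: measurable_funD; first exact: measurable_near_pair.
  exact: measurable_tail_pair.
have P0 g z : 0 <= P g z.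
  by apply: addr_ge0; [exact: near_pair_ge0|exact: tail_pair_ge0].
have iP g (a : R) : measurable_fun setT g -> (pair_power g <= a%:E)%E ->
    (\int[(mu \x mu)%E]_z (P g z)%:E <= ((1 + C4) * a)%:E)%E.
  move=> mg ga.
  rewrite (@integralD_nonneg _ _ _ (mu \x mu)%E _ _ (measurable_near_pair _ mg)
    (measurable_tail_pair _ mg) (near_pair_ge0 g) (tail_pair_ge0 g)).
  rewrite integral_near_pair.
  have := hC4 _ mg; move: ga; rewrite /pair_power.
  have := @gagliardo_ge0 R n s p D g.
  have := @tail_power_ge0 R n q (s * p) g.
  move: (gagliardo _ _ _ _) (tail_power _ _ _) => A B B0 A0 AB.
  have Afin : A \is a fin_num.
    by rewrite ge0_fin_numE//; apply: le_lt_trans (ltry a); apply: le_trans AB; rewrite leeDl.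
  have Bfin : B \is a fin_num.
    by rewrite ge0_fin_numE//; apply: le_lt_trans (ltry a); apply: le_trans AB; rewrite leeDr.
  move: A0 B0 AB; rewrite -(fineK Afin) -(fineK Bfin) -EFinD !lee_fin => A0 B0 AB hB.
  apply: le_trans (leeD (lexx _) hB) _; rewrite -EFinM -EFinD lee_fin.
  apply: (@le_trans _ _ ((1 + C4) * (fine A + fine B))); last first.
    by rewrite ler_wpM2l// addr_ge0.
  rewrite mulrDl mul1r !mulrDr -addrA lerD2l.
  by rewrite addrA lerDr addr_ge0 ?mulr_ge0.
have iN : (\int[(mu \x mu)%E]_z (near_pair phi z)%:E <= ((1 + C4) * a3)%:E)%E.
  rewrite integral_near_pair; apply: (le_trans h3); rewrite lee_fin.
  have a30 : 0 <= a3.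
    by rewrite -lee_fin; apply: le_trans h3; exact: gagliardo_ge0.
  by rewrite ler_peMl// lerDl.
have mN := measurable_near_pair _ m3; have N0 := near_pair_ge0 phi.
have mP1 := mP _ m1; have mP2 := mP _ m2; have mP4 := mP _ m4.
pose F1 z := (P g1 z + P g2 z) + near_pair phi z.
have mP12 := measurable_funD mP1 mP2.
have mF1 : measurable_fun setT F1 by exact: measurable_funD.
have P120 z : 0 <= P g1 z + P g2 z by exact: addr_ge0.
have F10 z : 0 <= F1 z by exact: addr_ge0.
have iF1 : (\int[(mu \x mu)%E]_z (F1 z)%:E <= ((1 + C4) * (a1 + a2 + a3))%:E)%E.
  have := @integralD_nonneg _ _ _ (mu \x mu)%E _ _ mP12 mN P120 N0.
  rewrite (@integralD_nonneg _ _ _ (mu \x mu)%E _ _ mP1 mP2 (P0 g1) (P0 g2)) => ->.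
  by rewrite !mulrDr !EFinD; apply: leeD => //; apply: leeD; exact: iP.
have iF2 := iP _ _ m4 h4.
pose F z := C * (d * F1 z + e * P (g1 \- g2) z).
have mdF1 : measurable_fun setT (fun z => d * F1 z).
  by apply: measurable_funM => //; exact: measurable_cst.
have meP : measurable_fun setT (fun z => e * P (g1 \- g2) z).
  by apply: measurable_funM => //; exact: measurable_cst.
have dF10 z : 0 <= d * F1 z by rewrite mulr_ge0// ltW.
have eP0 z : 0 <= e * P (g1 \- g2) z by rewrite mulr_ge0.
have mF' := measurable_funD mdF1 meP.
have F'0 z : 0 <= d * F1 z + e * P (g1 \- g2) z by exact: addr_ge0.
apply: (@le_trans _ _ (\int[(mu \x mu)%E]_z (F z)%:E)%E).
  apply: ae_ge0_le_integral_any => //.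
  - by move=> z _; rewrite lee_fin !mulr_ge0.
  - by move=> z _; rewrite lee_fin mulr_ge0.
  - by apply: aeW => z _; rewrite lee_fin; exact: hC.
rewrite (@integralZ_nonneg _ _ _ (mu \x mu)%E _ C mF' F'0 C0).
rewrite (@integralD_nonneg _ _ _ (mu \x mu)%E _ _ mdF1 meP dF10 eP0).
rewrite (@integralZ_nonneg _ _ _ (mu \x mu)%E _ d mF1 F10 (ltW d0)).
rewrite (@integralZ_nonneg _ _ _ (mu \x mu)%E _ e mP4 (P0 _) e0).
move: iF1 iF2; move: (\int[_]_z (F1 z)%:E)%E (\int[_]_z (P _ z)%:E)%E => I1 I2 iF1 iF2.
have -> : C * (1 + C4) * (d * (a1 + a2 + a3) + e * a4) =
  C * (d * ((1 + C4) * (a1 + a2 + a3)) + e * ((1 + C4) * a4)) by ring.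
rewrite EFinM; apply: lee_wpmul2l; first by rewrite lee_fin.
by rewrite [leRHS]EFinD (EFinM d) (EFinM e); apply: leeD; apply: lee_wpmul2l;
  rewrite ?lee_fin// ltW.
Qed.

End nonlocal_form.

Section form.
Context {R : realType} {n : nat}.
Local Notation mu := (@lebesgue_rV R n).
Variables (p s : R).
Implicit Types (g phi : 'rV[R]_n -> R).
Hypothesis p2 : 2 < p.
Local Notation K := (frac_kernel s p).

Definition form_integrand g phi (z : 'rV[R]_n * 'rV[R]_n) : R :=
  Jp p (g z.1 - g z.2) * (phi z.1 - phi z.2) * K z.

Definition nonlocal_form g phi : R := \int[(mu \x mu)%E]_z form_integrand g phi z.

Lemma measurable_form_integrand g phi : measurable_fun setT g ->
  measurable_fun setT phi -> measurable_fun setT (form_integrand g phi).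
Proof.
move=> mg mphi; apply: measurable_funM; last exact: measurable_frac_kernel.
apply: measurable_funM; last exact: measurable_gap.
exact: (measurableT_comp (measurable_Jp p) (measurable_gap _ mg)).
Qed.

Section bounds.
Variables (Om D : set 'rV[R]_n).
Hypothesis s0 : 0 < s.
Hypothesis oOm : open Om.
Hypothesis bOm : bounded_set Om.
Hypothesis oD : open D.
Hypothesis OmD : compactly_contained Om D.

Definition admissible phi := [/\ measurable_fun setT phi,
  (forall x, ~ Om x -> phi x = 0) & (forall x, 0 <= phi x <= 1)].

Lemma pair_power0 : pair_power p s D (fun=> 0) = 0%E.
Proof.
rewrite /pair_power /gagliardo /tail_power /weighted_power.
have e1 : (\int[mu \x mu]_(z in D `*` D)
    (`|(0 : R) - 0| `^ p * frac_kernel s p z)%:E = 0)%E.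
  apply: integral0_eq => z _; rewrite subrr normr0 powR0 ?mul0r//.
  by have := p2; lra.
have e2 : (\int[mu]_x (`|(0 : R)| `^ (p - 1) * tail_weight (s * p) x)%:E = 0)%E.
  apply: integral0_eq => z _; rewrite normr0 powR0 ?mul0r//.
  by have := p2; lra.
by rewrite e1 e2 adde0.
Qed.

(** The case g2 = 0, d = 1 of [integral_form_le]. *)
Lemma form_integrable g phi : admissible phi -> measurable_fun setT g ->
  (pair_power p s D g < +oo)%E -> (gagliardo s p D phi < +oo)%E ->
  (mu \x mu)%E.-integrable setT (EFin \o form_integrand g phi).
Proof.
move=> [mphi phi0 phi1] mg gfin pfin.
have [C _ hC] := integral_form_le p s Om D p2 s0 oOm bOm oD OmD.
have g0 : (0 <= pair_power p s D g)%E.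
  by apply: adde_ge0; [exact: gagliardo_ge0|exact: tail_power_ge0].
have gf : pair_power p s D g \is a fin_num by rewrite ge0_fin_numE.
have pf : gagliardo s p D phi \is a fin_num.
  by rewrite ge0_fin_numE//; exact: gagliardo_ge0.
have m0 : measurable_fun setT (fun _ : 'rV[R]_n => 0 : R) by exact: measurable_cst.
have := hC 1 g (fun=> 0) phi (fine (pair_power p s D g)) 0
  (fine (gagliardo s p D phi)) (fine (pair_power p s D g)) ltr01 mg m0 mphi phi0 phi1.
have -> : g \- (fun=> 0) = g by apply/funext => x /=; rewrite subr0.
rewrite !fineK// pair_power0 => /(_ (lexx _) (lexx _) (lexx _) (lexx _)) H.
apply/integrableP; split.
  by apply/measurable_EFinP; exact: measurable_form_integrand.
apply: le_lt_trans (ltry _); apply: le_trans H.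
apply: ae_ge0_le_integral_any => //.
- by move=> z _; rewrite lee_fin !mulr_ge0// frac_kernel_ge0.
- apply: aeW => z _ /=; rewrite lee_fin /form_integrand subrr Jp0 subr0 2!normrM.
  by rewrite (@ger0_norm _ (K z)) ?frac_kernel_ge0.
Qed.

Lemma form_diff_le : exists2 C : R, 0 <= C &
  forall (d : R) g1 g2 phi (a1 a2 a3 a4 : R), 0 < d ->
  measurable_fun setT g1 -> measurable_fun setT g2 -> admissible phi ->
  (pair_power p s D g1 <= a1%:E)%E -> (pair_power p s D g2 <= a2%:E)%E ->
  (gagliardo s p D phi <= a3%:E)%E -> (pair_power p s D (g1 \- g2)%R <= a4%:E)%E ->
  `|nonlocal_form g1 phi - nonlocal_form g2 phi| <=
  C * (d * (a1 + a2 + a3) + (d `^ (1 - p) + d `^ (2 - p)) * a4).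
Proof.
have [C C0 hC] := integral_form_le p s Om D p2 s0 oOm bOm oD OmD.
exists C => // d g1 g2 phi a1 a2 a3 a4 d0 m1 m2 aphi h1 h2 h3 h4.
have [mphi phi0 phi1] := aphi.
have H := hC d g1 g2 phi a1 a2 a3 a4 d0 m1 m2 mphi phi0 phi1 h1 h2 h3 h4.
have i1 := form_integrable _ _ aphi m1 (le_lt_trans h1 (ltry _)) (le_lt_trans h3 (ltry _)).
have i2 := form_integrable _ _ aphi m2 (le_lt_trans h2 (ltry _)) (le_lt_trans h3 (ltry _)).
rewrite /nonlocal_form -(@RintegralB _ _ _ (mu \x mu)%E _ _ _ measurableT i1 i2).
have i12 : (mu \x mu)%E.-integrable setT
    (EFin \o (fun z => form_integrand g1 phi z - form_integrand g2 phi z)).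
  exact: (integrableB measurableT i1 i2).
apply: le_trans (le_normr_Rintegral measurableT i12) _.
rewrite /Rintegral -lee_fin fineK; last first.
  exact: (integrable_fin_num measurableT (integrable_norm i12)).
apply: le_trans H; apply: ae_ge0_le_integral_any => //.
- by move=> z _; rewrite lee_fin !mulr_ge0// frac_kernel_ge0.
- apply: aeW => z _ /=; rewrite lee_fin /form_integrand -!mulrBl 2!normrM.
  by rewrite (@ger0_norm _ (K z)) ?frac_kernel_ge0.
Qed.

End bounds.
End form.

(** * Truncation and absorption *)

Section clip.
Context {R : realType}.
Implicit Types x y : R.

(** The cut at 1 keeps the test function bounded; being 1-Lipschitz, the truncation does not
    increase the Gagliardo seminorm. *)
Definition clip x : R := Num.min (Num.max x 0) 1.
(* The primitive of [clip] vanishing on the negative half-line. *)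
Definition clip_prim x : R := Num.max x 0 * clip x - clip x ^+ 2 / 2.

Lemma clipP x : [\/ x <= 0 /\ clip x = 0, (0 <= x <= 1) /\ clip x = x |
  1 <= x /\ clip x = 1].
Proof.
rewrite /clip; have [x0|x0] := leP x 0.
  by constructor 1; split=> //; apply/min_idPl.
have [x1|x1] := leP x 1; first by constructor 2; rewrite ltW.
by constructor 3; rewrite ltW.
Qed.

Lemma clip_primP x : [\/ [/\ x <= 0, clip x = 0 & clip_prim x = 0],
  [/\ 0 <= x, x <= 1, clip x = x & clip_prim x = x ^+ 2 / 2] |
  [/\ 1 <= x, clip x = 1 & clip_prim x = x - 1 / 2]].
Proof.
rewrite /clip_prim; case: (clipP x) => -[].
- by move=> x0 ->; constructor 1; split => //; rewrite mulr0 expr0n mul0r subr0.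
- move=> /andP[x0 x1] ->; constructor 2; split => //.
  by rewrite (max_idPl x0) -expr2; field.
- move=> x1 ->; constructor 3; split => //.
  by rewrite (max_idPl (le_trans ler01 x1)) mulr1 expr1n.
Qed.

Lemma clip_itv x : 0 <= clip x <= 1.
Proof. by case: (clipP x) => -[] => [_ ->|+ ->|_ ->] //; rewrite ?lexx ?ler01. Qed.

Lemma clip_mono x y : x <= y -> clip x <= clip y.
Proof.
move=> xy; case: (clipP x) => -[] => [x0 ->|/andP[x0 x1] ->|x1 ->];
case: (clipP y) => -[] => [y0 ->|/andP[y0 y1] ->|y1 ->] //; lra.
Qed.

Lemma clip_lip x y : `|clip x - clip y| <= `|x - y|.
Proof.
wlog xy : x y / x <= y => [H|].
  by have [xy|/ltW yx] := leP x y; [exact: H|rewrite distrC (distrC x); exact: H].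
rewrite (distrC _ (clip y)) (distrC x) !ger0_norm ?subr_ge0 ?clip_mono//.
case: (clipP x) => -[] => [x0 ->|/andP[x0 x1] ->|x1 ->];
case: (clipP y) => -[] => [y0 ->|/andP[y0 y1] ->|y1 ->] //; lra.
Qed.

Lemma clip_le0 x : x <= 0 -> clip x = 0.
Proof.
by move=> x0; case: (clipP x) => -[] => [_ ->//|/andP[x0' _] ->|]; lra.
Qed.

Lemma clip_prim_ge0 x : 0 <= clip_prim x.
Proof.
case: (clip_primP x) => -[] => [_ _ -> //|_ _ _ ->|x1 _ ->]; last by lra.
by rewrite divr_ge0// sqr_ge0.
Qed.

Lemma clip_prim_gt0 x : 0 < x -> 0 < clip_prim x.
Proof.
move=> x0; case: (clip_primP x) => -[] => [x1 _ _|_ _ _ ->|x1 _ ->]; last by lra.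
  by exfalso; lra.
by rewrite divr_gt0// exprn_gt0.
Qed.

(** The nondecreasing function [clip] is the derivative of [clip_prim], and this is the tangent
    inequality at y. *)
Lemma clip_prim_convex x y : clip_prim y - clip_prim x <= clip y * (y - x).
Proof.
(* Squares offered to [lra], which then has only linear work in the nine cases. *)
have h1 : 0 <= (y - x) * (y - x) by rewrite -expr2 sqr_ge0.
have h2 : 0 <= (1 - x) * (1 - x) by rewrite -expr2 sqr_ge0.
have h3 : 0 <= (1 - y) * (1 - y) by rewrite -expr2 sqr_ge0.
have h4 : 0 <= x * x by rewrite -expr2 sqr_ge0.
have h5 : 0 <= y * y by rewrite -expr2 sqr_ge0.
case: (clip_primP x) => -[] => [x0 _ ->|x0 x1 _ ->|x1 _ ->];
case: (clip_primP y) => -[] => [y0 -> ->|y0 y1 -> ->|y1 -> ->]; rewrite ?expr2.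
- by rewrite mul0r subrr.
- have : 0 <= y * (- x) by rewrite mulr_ge0// oppr_ge0.
  by lra.
- lra.
- lra.
- lra.
- lra.
- lra.
- have : 0 <= (1 - y) * (x - 1) by rewrite mulr_ge0// subr_ge0.
  by lra.
- lra.
Qed.

Lemma clip_prim_lip x y : `|clip_prim y - clip_prim x| <= `|y - x|.
Proof.
have gen a b : clip_prim b - clip_prim a <= `|b - a|.
  apply: le_trans (clip_prim_convex _ _) _; have /andP[c0 c1] := clip_itv b.
  apply: le_trans (ler_norm _) _; rewrite normrM ger0_norm//.
  by rewrite -[leRHS]mul1r ler_wpM2r.
rewrite ler_norml gen andbT lerNl opprB distrC; exact: gen.
Qed.

Lemma clip_prim_mono x y : x <= y -> clip_prim x <= clip_prim y.
Proof.
move=> xy; rewrite -subr_le0; apply: le_trans (clip_prim_convex _ _) _.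
by have /andP[c0 _] := clip_itv x; rewrite mulr_ge0_le0// subr_le0.
Qed.

Lemma clip_prim_le x : clip_prim x <= Num.max x 0.
Proof.
have := clip_prim_convex 0 x.
case: (clip_primP x) => -[] => [x0 _ ->|x0 x1 _ ->|x1 _ ->] _.
- by rewrite le_max lexx orbT.
- by rewrite le_max; apply/orP; left; nra.
- by rewrite le_max; apply/orP; left; lra.
Qed.

Lemma measurable_clip : measurable_fun setT (clip : R -> R).
Proof.
apply: measurable_minr; last exact: measurable_cst.
apply: measurable_maxr; [exact: measurable_id|exact: measurable_cst].
Qed.

Lemma measurable_clip_prim : measurable_fun setT (clip_prim : R -> R).
Proof.
apply: measurable_funB.
  apply: measurable_funM; last exact: measurable_clip.
  apply: measurable_maxr; [exact: measurable_id|exact: measurable_cst].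
apply: measurable_funM; last exact: measurable_cst.
by apply: measurable_funX; exact: measurable_clip.
Qed.

End clip.

Section absorption.
Context {R : realType} {n : nat}.
Local Notation mu := (@lebesgue_rV R n).
Variables (p s : R) (Om : set 'rV[R]_n).
Hypothesis n0 : (0 < n)%N.
Hypothesis p2 : 2 < p.
Hypothesis s0 : 0 < s.
Hypothesis oOm : open Om.
Hypothesis bOm : bounded_set Om.
Implicit Types u v w : 'rV[R]_n -> R.
Local Notation K := (frac_kernel s p).

Definition excess w (k : R) (x : 'rV[R]_n) : R := \1_Om x * clip (w x - k).

Lemma excess_itv w k x : 0 <= excess w k x <= 1.
Proof.
have /andP[c0 c1] := clip_itv (w x - k); rewrite /excess indicE.
by case: (x \in Om); rewrite ?mul1r ?mul0r ?c0 ?lexx ?ler01.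
Qed.

Lemma excess_out w k x : ~ Om x -> excess w k x = 0.
Proof. by move=> Ox; rewrite /excess indicE memNset// mul0r. Qed.

Lemma excess_in w k x : Om x -> excess w k x = clip (w x - k).
Proof. by move=> Ox; rewrite /excess indicE mem_set// mul1r. Qed.

Lemma measurable_excess w k : measurable_fun setT w ->
  measurable_fun setT (excess w k).
Proof.
move=> mw; apply: measurable_funM.
  by apply: measurable_indic; exact: measurable_open_rV.
apply: (measurableT_comp measurable_clip).
by apply: measurable_funB => //; exact: measurable_cst.
Qed.

Lemma excess_eq w k x : 0 <= k -> (Om x \/ w x = 0) -> excess w k x = clip (w x - k).
Proof.
move=> k0 [Ox|wx]; first exact: excess_in.
have [Ox|Ox] := pselect (Om x); first exact: excess_in.
by rewrite excess_out// clip_le0// wx sub0r oppr_le0.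
Qed.

(** The unit cube ]M, M + 1]^n lies just beyond the sup-norm ball of radius M that contains Om. Each
    of its points has all coordinates above M, and n > 0 provides one that shows it is off Om. *)
Lemma kernel_lower_bound : exists (M1 : R) (Q : set 'rV[R]_n),
  [/\ 0 < M1, measurable Q, mu Q = 1%E, (forall y, Q y -> ~ Om y) &
      forall x y, Om x -> Q y -> M1 <= K (x, y)].
Proof.
have [M M0 OmM] := bounded_set_norm _ bOm.
pose A (i : 'I_n) : set (measurableTypeR R) := `]M, (M + 1)]%classic.
have mA i : measurable (A i) by exact: measurable_itv.
pose Q := [set x : 'rV[R]_n | forall i, A i (coord_rV i x)].
(* Points of Om and Q are at sup-distance at most 2 M + 1; the factor n bounds [enorm]. *)
have M1 : 0 < n%:R * (2 * M + 1) :> R by rewrite mulr_gt0 ?ltr0n// addr_gt0// mulr_gt0.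
have Qi y i : Q y -> M < y ord0 i <= M + 1.
  by move=> /(_ i); rewrite /A /= in_itv.
have QOm y : Q y -> ~ Om y.
  move=> Qy /OmM; apply/negP; rewrite -ltNge.
  have /andP[h _] := Qi y (Ordinal n0) Qy.
  by apply: lt_le_trans (coord_le_norm y (Ordinal n0)); apply: lt_le_trans h (ler_norm _).
exists ((n%:R * (2 * M + 1)) `^ (- (n%:R + s * p))), Q; split => //.
- exact: powR_gt0.
- exact: measurable_box.
- rewrite /Q lebesgue_rV_box//; apply: big1 => i _.
  rewrite /A lebesgue_measure_itv/= lte_fin ltrDl ltr01 -EFinB.
  by congr EFin; ring.
move=> x y Ox Qy; rewrite /frac_kernel /=.
have be0 : 0 <= n%:R + s * p by rewrite addr_ge0// mulr_ge0 ?(ltW s0)//; have := p2; lra.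
have e0 : 0 < enorm (x - y).
  apply: lt_le_trans (norm_le_enorm _); rewrite normr_gt0 subr_eq0.
  by apply/eqP => xy; apply: (QOm y) => //; rewrite -xy.
rewrite !powRN lef_pV2 ?posrE ?powR_gt0//; apply: le_powRl => //; first exact: ltW.
apply: le_trans (enorm_le_norm _) _; rewrite ler_wpM2l//.
apply: le_trans (ler_normB _ _) _.
have -> : 2 * M + 1 = M + (M + 1) by ring.
apply: lerD; first exact: OmM.
apply: norm_le_coord => [|i]; first by rewrite addr_ge0// ltW.
have /andP[h1 h2] := Qi y i Qy.
by rewrite gtr0_norm//; apply: lt_trans h1.
Qed.

(** A property of c alone, so that the constant is fixed before D, f, u, v and k. *)
Definition absorbing (c : R) : Prop := forall u v k, 0 < k ->
  measurable_fun setT u -> measurable_fun setT v ->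
  {ae mu, forall x, ~ Om x -> v x - u x = 0} ->
  (mu \x mu)%E.-integrable setT (EFin \o form_integrand p s v (excess (v \- u) k)) ->
  (mu \x mu)%E.-integrable setT (EFin \o form_integrand p s u (excess (v \- u) k)) ->
  c * k `^ (p - 1) * \int[mu]_x excess (v \- u) k x <=
  nonlocal_form p s v (excess (v \- u) k) - nonlocal_form p s u (excess (v \- u) k).

(** Both [Jp p] and [clip] are nondecreasing, so the difference of the integrands is nonnegative
    almost everywhere. If the first point is in Om and the second in Q, then w = 0 at the second,
    and where w > k at the first the increments of v and u differ by more than k; strong
    monotonicity turns this into (k / 2)^(p-1). *)
Lemma form_absorption : exists2 c : R, 0 < c & absorbing c.
Proof.
have [M1 [Q [M10 mQ muQ QOm KM1]]] := kernel_lower_bound.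
exists (2^-1 `^ (p - 1) * M1); first by rewrite mulr_gt0// powR_gt0.
move=> u v k k0 mu_ mv w0 iv iu; set w := v \- u; set phi := excess w k.
have mw : measurable_fun setT w by exact: measurable_funB.
have mphi : measurable_fun setT phi by exact: measurable_excess.
have phi0 x : 0 <= phi x by have /andP[] := excess_itv w k x.
set c := _ * M1 * k `^ _.
have c0 : 0 <= c by rewrite !mulr_ge0 ?powR_ge0// ltW.
have mOm : measurable Om by exact: measurable_open_rV.
have mind : measurable_fun setT (\1_Q : 'rV[R]_n -> R) by exact: measurable_indic.
(* Q has measure 1, so the integral of [low] is exactly c times that of phi. *)
pose low (z : 'rV[R]_n * 'rV[R]_n) : R := c * (phi z.1 * \1_Q z.2).
have mten := @measurable_fun_tensor _ _ _ _ _ _ _ mphi mind.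
have ind0 (y : 'rV[R]_n) : 0 <= \1_Q y :> R by [].
have ten0 (z : 'rV[R]_n * 'rV[R]_n) : 0 <= phi z.1 * \1_Q z.2 by exact: mulr_ge0.
have iphi : (\int[mu]_x (phi x)%:E)%E \is a fin_num.
  rewrite ge0_fin_numE; last by apply: integral_ge0 => x _; rewrite lee_fin.
  apply: (@le_lt_trans _ _ (\int[mu]_x (\1_Om x)%:E)%E).
    apply: ge0_le_integral => //.
    - by move=> x _; rewrite lee_fin.
    - exact/measurable_EFinP.
    - by apply/measurable_EFinP; exact: measurable_indic.
    - move=> x _; rewrite lee_fin; have [Ox|Ox] := pselect (Om x).
        by rewrite indicE mem_set//; have /andP[] := excess_itv w k x.
      by rewrite /phi excess_out.
  by rewrite integral_indic// setIT; exact: bounded_set_finite_measure.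
have elow : (\int[(mu \x mu)%E]_z (low z)%:E = (c * \int[mu]_x phi x)%:E)%E.
  rewrite (@integralZ_nonneg _ _ _ (mu \x mu)%E _ c mten ten0 c0).
  rewrite (@integral_tensor _ _ _ _ _ mu mu _ _ mphi mind phi0 ind0).
  have -> : (\int[mu]_y (\1_Q y)%:E = 1)%E.
    by rewrite integral_indic// setIT; exact: muQ.
  by rewrite mule1 [RHS]EFinM /Rintegral fineK.
have i12 : (mu \x mu)%E.-integrable setT
    (EFin \o (fun z => form_integrand p s v phi z - form_integrand p s u phi z)).
  exact: (integrableB measurableT iv iu).
rewrite /nonlocal_form -(@RintegralB _ _ _ (mu \x mu)%E _ _ _ measurableT iv iu).
rewrite /Rintegral -lee_fin fineK; last exact: (integrable_fin_num measurableT i12).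
rewrite -elow.
(* The difference may be negative on a null set; its positive part is nonnegative everywhere and has
   the same integral. *)
pose pos z := Num.max (form_integrand p s v phi z - form_integrand p s u phi z) 0.
have good : {ae (mu \x mu)%E, forall z,
    low z <= form_integrand p s v phi z - form_integrand p s u phi z}.
  have := @ae_prod1 _ _ _ _ _ mu mu _ w0; have := @ae_prod2 _ _ _ _ _ mu mu _ w0.
  apply: filterS2 => z g2 g1.
  have or1 : Om z.1 \/ w z.1 = 0 by have [?|/g1] := pselect (Om z.1); [left|right].
  have or2 : Om z.2 \/ w z.2 = 0 by have [?|/g2] := pselect (Om z.2); [left|right].
  have k0' := ltW k0.
  have p1 : phi z.1 = clip (w z.1 - k) by exact: excess_eq.
  have p2_ : phi z.2 = clip (w z.2 - k) by exact: excess_eq.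
  have wz : (v z.1 - v z.2) - (u z.1 - u z.2) = w z.1 - w z.2 by rewrite /w /=; ring.
  rewrite /form_integrand -!mulrBl.
  have [[in1 Q2]|H] := pselect (Om z.1 /\ Q z.2); last first.
    have -> : low z = 0.
      rewrite /low; have [in1|in1] := pselect (Om z.1); last first.
        by rewrite /phi excess_out// mul0r mulr0.
      by rewrite indicE memNset ?mulr0// => Q2; apply: H.
    apply: mulr_ge0; last exact: frac_kernel_ge0.
    rewrite p1 p2_; have [w12|w12] := leP (w z.2) (w z.1).
      apply: mulr_ge0; rewrite subr_ge0; last by apply: clip_mono; rewrite lerD2r.
      by apply: Jp_mono => //; rewrite -subr_ge0 wz subr_ge0.
    apply: mulr_le0; rewrite subr_le0; last by apply: clip_mono; rewrite lerD2r ltW.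
    by apply: Jp_mono => //; rewrite -subr_le0 wz subr_le0 ltW.
  have nO2 := QOm _ Q2.
  have wz2 : w z.2 = 0 by case: or2.
  have phz2 : phi z.2 = 0 by rewrite /phi excess_out.
  rewrite phz2 subr0 /low indicE mem_set// mulr1.
  have KK : M1 <= K z by rewrite (surjective_pairing z); exact: KM1.
  have [wk|wk] := leP (w z.1) k.
    by rewrite p1 clip_le0 ?subr_le0// !(mulr0, mul0r).
  have JJ : 2^-1 `^ (p - 1) * k `^ (p - 1) <= Jp p (v z.1 - v z.2) - Jp p (u z.1 - u z.2).
    have wpos : u z.1 - u z.2 <= v z.1 - v z.2.
      by rewrite -subr_ge0 wz wz2 subr0 ltW// (lt_trans k0).
    apply: le_trans (Jp_strong_mono _ _ _ p2 wpos).
    rewrite -powRM ?invr_ge0 ?(ltW k0)//.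
    apply: le_powRl.
    - by have := p2; lra.
    - by rewrite mulr_ge0// invr_ge0.
    - by rewrite wz wz2 subr0 mulrC ler_wpM2r ?invr_ge0// ltW.
  have -> : c * phi z.1 = 2^-1 `^ (p - 1) * k `^ (p - 1) * phi z.1 * M1.
    by rewrite /c; ring.
  apply: ler_pM => //; [|exact: ltW|].
  - by rewrite mulr_ge0// mulr_ge0 ?powR_ge0.
  - by rewrite ler_wpM2r.
apply: (@le_trans _ _ (\int[(mu \x mu)%E]_z (pos z)%:E)%E).
  apply: ae_ge0_le_integral_any => //.
  - by move=> z _; rewrite lee_fin mulr_ge0.
  - by move=> z _; rewrite lee_fin le_max lexx orbT.
  - by apply: ae_imply good => z h _; rewrite lee_fin le_max h.
rewrite le_eqVlt; apply/orP; left; apply/eqP; apply: ae_eq_integral => //.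
- apply/measurable_EFinP; apply: measurable_maxr; last exact: measurable_cst.
  by apply: measurable_funB; exact: measurable_form_integrand.
- exact: (measurable_int _ i12).
apply: ae_imply good => z h _; rewrite /pos; congr EFin; apply/max_idPl.
by apply: le_trans h; rewrite mulr_ge0.
Qed.

End absorption.

(** * Trajectories, constant test paths and L^2 facts *)

Section trajectories.
Context {R : realType} {n : nat}.
Local Notation mu := (@lebesgue_rV R n).
Local Notation leb := (@lebesgue_measure R).
Variables (p s : R) (D : set 'rV[R]_n).
Hypothesis p2 : 2 < p.
Hypothesis oD : open D.
Implicit Types (u : R -> 'rV[R]_n -> R).

Let mD : measurable D. Proof. exact: measurable_open_rV. Qed.
Let p0 : 0 < p. Proof. by have := p2; lra. Qed.
Let p1 : 1 < p. Proof. by have := p2; lra. Qed.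
Let q0 : 0 < p - 1. Proof. by have := p2; lra. Qed.

Let one_le (q : R) : 0 < q -> 1 <= 2 `^ q.
Proof. by move=> q0'; rewrite -[X in X <= _](powRr0 2) ler_powR ?ler1n// ltW. Qed.

Lemma pair_power_le g : (pair_power p s D g <=
  fs_norm (sobolev s p D) g `^ p + fs_norm (tail_space (p - 1) (s * p)) g `^ (p - 1))%E.
Proof.
rewrite (sobolev_normX s p p1) (tail_normX _ _ q0) /pair_power.
apply: leeD => //; rewrite /sobolev_power; apply: leeDl.
by apply: integral_ge0 => x _; rewrite lee_fin powR_ge0.
Qed.

(** The Sobolev and the tail trajectory come with different exponents, so [bochner_bound] is applied
    to each and the majorants are added. *)
Lemma pair_power_bound u (a b : R) :
  bochner_Lp p `[a, b] (sobolev s p D) u ->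
  bochner_Lp (p - 1) `[a, b] (tail_space (p - 1) (s * p)) u ->
  exists e : measurableTypeR R -> R,
  [/\ measurable_fun setT e, forall t, 0 <= e t,
      (\int[leb]_(t in `[a, b]) (e t)%:E < +oo)%E &
      {ae leb, forall t, `[a, b]%classic t ->
         measurable_fun setT (u t) /\ (pair_power p s D (u t) <= (e t)%:E)%E}].
Proof.
move=> Su Tu.
have [e1 [m1 e10 i1 H1]] := @bochner_bound _ _ (sobolev s p D) p (2 `^ p) p0
  (one_le _ p0) (sobolev0_mem s p p1 D)
  (fun a f g => @sobolev_lin _ _ s p p1 D a f g mD) (sobolev_ge0 s p D)
  (sobolev_norm0 s p p1 D) (sobolev_normN s p D) (fun f h => h.2)
  (fun f g => @sobolev_normD _ _ s p p1 D f g mD) _ _ _ Su.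
have [e2 [m2 e20 i2 H2]] := @bochner_bound _ _ (tail_space (p - 1) (s * p)) (p - 1)
  (2 `^ (p - 1)) q0 (one_le _ q0) (tail0_mem _ _ q0)
  (fun a f g => @tail_lin _ _ _ (s * p) q0 a f g) (fun f => poweR_ge0 _ _)
  (tail_norm0 _ _ q0) (tail_normN _ _) (fun f h => (let: And3 _ _ h3 := h in h3))
  (fun f g => @tail_normD _ _ _ (s * p) q0 f g) _ _ _ Tu.
exists (fun t => e1 t + e2 t); split.
- exact: measurable_funD.
- by move=> t; exact: addr_ge0.
- under eq_integral do rewrite EFinD.
  rewrite ge0_integralD//; first exact: lte_add_pinfty.
  + by move=> t _; rewrite lee_fin.
  + by apply/measurable_EFinP; exact: measurable_funTS.
  + by move=> t _; rewrite lee_fin.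
  + by apply/measurable_EFinP; exact: measurable_funTS.
- apply: (ae_imply2 _ _ _ _ _ _ _ _ H1 H2) => t h1 h2 Jt.
  have [_ q1] := h1 Jt; have [[mu_ _ _] q2] := h2 Jt; split => //.
  by apply: le_trans (pair_power_le _) _; rewrite EFinD; exact: leeD.
Qed.

Lemma pair_power_modulus u (a b eps : R) : 0 < eps ->
  bochner_Lp p `[a, b] (sobolev s p D) u ->
  bochner_Lp (p - 1) `[a, b] (tail_space (p - 1) (s * p)) u ->
  exists (e : measurableTypeR R -> R) (h0 : R) (S : set (measurableTypeR R)),
  [/\ 0 < h0, measurable_fun setT e /\ (forall t, 0 <= e t),
      (\int[leb]_(t in `[a, b]) (e t)%:E <= eps%:E)%E,
      {ae leb, forall t, `[a, b]%classic t -> S t} &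
      forall r t, `[a, b]%classic r -> `[a, b]%classic t -> S r -> S t ->
        `|r - t| <= h0 -> (pair_power p s D (u r \- u t)%R <= (e r + e t)%:E)%E].
Proof.
move=> eps0 Su Tu.
have eps20 : 0 < eps / 2 by exact: divr_gt0.
have [e1 [h1 [S1 [h10 [m1 e10] i1 A1 H1]]]] := @bochner_modulus _ _ (sobolev s p D) p
  (2 `^ p) p0
  (one_le _ p0) (sobolev0_mem s p p1 D)
  (fun a f g => @sobolev_lin _ _ s p p1 D a f g mD) (sobolev_ge0 s p D)
  (sobolev_norm0 s p p1 D) (sobolev_normN s p D) (fun f h => h.2)
  (fun f g => @sobolev_normD _ _ s p p1 D f g mD) _ _ _ _ eps20 Su.
have [e2 [h2 [S2 [h20 [m2 e20] i2 A2 H2]]]] := @bochner_modulus _ _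
  (tail_space (p - 1) (s * p)) (p - 1)
  (2 `^ (p - 1)) q0 (one_le _ q0) (tail0_mem _ _ q0)
  (fun a f g => @tail_lin _ _ _ (s * p) q0 a f g) (fun f => poweR_ge0 _ _)
  (tail_norm0 _ _ q0) (tail_normN _ _) (fun f h => (let: And3 _ _ h3 := h in h3))
  (fun f g => @tail_normD _ _ _ (s * p) q0 f g) _ _ _ _ eps20 Tu.
exists (fun t => e1 t + e2 t), (Num.min h1 h2), (S1 `&` S2); split.
- by rewrite lt_min h10.
- by split; [exact: measurable_funD|move=> t; exact: addr_ge0].
- under eq_integral do rewrite EFinD.
  rewrite ge0_integralD//.
  + by rewrite (splitr eps) EFinD; exact: leeD.
  + by move=> t _; rewrite lee_fin.
  + by apply/measurable_EFinP; exact: measurable_funTS.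
  + by move=> t _; rewrite lee_fin.
  + by apply/measurable_EFinP; exact: measurable_funTS.
- apply: (ae_imply2 _ _ _ _ _ _ _ _ A1 A2) => t h1' h2' Jt.
  by split; [exact: h1'|exact: h2'].
- move=> r t Jr Jt [r1 r2] [t1 t2]; rewrite le_min => /andP[rt1 rt2].
  apply: le_trans (pair_power_le _) _.
  have -> : e1 r + e2 r + (e1 t + e2 t) = (e1 r + e1 t) + (e2 r + e2 t) by ring.
  by rewrite EFinD; apply: leeD; [exact: H1|exact: H2].
Qed.

End trajectories.

Section constant_paths.
Context {R : realType} {V : lmodType R}.
Variable E : normed_fun_space V.
Hypothesis N0 : fs_norm E 0 = 0%E.

Lemma bochner_Lp_cst (q a b : R) (c : V) : E c -> (fs_norm E c < +oo)%E ->
  (0 <= fs_norm E c)%E -> bochner_Lp q `[a, b] E (fun=> c).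
Proof.
move=> Ec Nc N0c; split.
  exists (fun _ _ => c); split.
    move=> k; exists 1%N, (fun=> setT), (fun=> c); split => // t.
    by rewrite big_ord1 indicT scale1r.
  apply: aeW => t _; split => //.
  by under eq_fun do rewrite subrr N0; exact: cvg_cst.
have fq : (fs_norm E c `^ q)%E \is a fin_num.
  by apply: fin_num_poweR; rewrite ge0_fin_numE.
have fJ : (lebesgue_measure `[a, b] < +oo :> \bar R)%E.
  by rewrite lebesgue_measure_itv/=; case: ifPn => _; rewrite -?EFinB ltry.
rewrite -(fineK fq) integral_cst//.
by apply: lte_mul_pinfty; rewrite ?lee_fin ?fine_ge0 ?poweR_ge0.
Qed.

Lemma C1_on_cst (J : set R) (c : V) : E c -> E 0 -> C1_on J E (fun=> c) (fun=> 0).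
Proof.
move=> Ec E0; split.
- move=> t _; split => //.
  by under eq_fun do rewrite subrr N0; exact: cvg_cst.
- move=> t _; split => //.
  by under eq_fun do rewrite subrr N0; exact: cvg_cst.
- move=> t _.
  by under eq_fun do rewrite subrr scaler0 subrr N0; exact: cvg_cst.
Qed.

End constant_paths.

Section L2_facts.
Context {R : realType} {n : nat}.
Local Notation mu := (@lebesgue_rV R n).
Variable Om : set 'rV[R]_n.
Hypothesis mOm : measurable Om.
Hypothesis fOm : (mu Om < +oo)%E.
Implicit Types u v w : 'rV[R]_n -> R.

Lemma L2_normX u : (Lnorm_on Om 2%:E u `^ 2 = \int[mu]_(x in Om) (`|u x| `^ 2)%:E)%E.
Proof.
have two0 : (2 : R) != 0 by [].
rewrite /Lnorm_on (powR_Lnorm _ _ two0).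
rewrite [RHS]integral_mkcond; apply: eq_integral => x _ /=.
by rewrite /patch; case: ifPn => // _; rewrite normr0 powR0.
Qed.

Lemma L2_sqr_lty u : (Lnorm_on Om 2%:E u < +oo)%E ->
  (\int[mu]_(x in Om) (`|u x| `^ 2)%:E < +oo)%E.
Proof. by move=> h; rewrite -L2_normX; exact: poweR_lty. Qed.

Lemma L2_norm0 : Lnorm_on Om 2%:E (0 : 'rV[R]_n -> R) = 0%E.
Proof.
rewrite /Lnorm_on (_ : _ \o _ = cst 0%E) ?Lnorm0//.
by apply/funext => x /=; rewrite /patch; case: ifP.
Qed.

Let sqr_measurable u : measurable_fun Om u ->
  measurable_fun Om (fun x => (`|u x| `^ 2)%:E).
Proof.
move=> mu_; apply/measurable_EFinP; apply: measurable_fun_powR.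
exact: measurableT_comp.
Qed.

(** Pointwise |u| <= e + u^2 / e; the free e takes the place of the Cauchy-Schwarz inequality. *)
Lemma L1_le_L2 u (e : R) : 0 < e -> measurable_fun Om u ->
  (\int[mu]_(x in Om) `|u x|%:E <=
   e%:E * mu Om + e^-1%:E * \int[mu]_(x in Om) (`|u x| `^ 2)%:E)%E.
Proof.
move=> e0 mu_.
rewrite -integral_cst// -ge0_integralZl_EFin//; last 2 first.
- exact: sqr_measurable.
- by rewrite invr_ge0 ltW.
rewrite -ge0_integralD//; last 3 first.
- by move=> x _; rewrite lee_fin ltW.
- by move=> x _; rewrite mule_ge0// lee_fin ?powR_ge0// invr_ge0 ltW.
- by apply: measurable_funeM; exact: sqr_measurable.
apply: ge0_le_integral => //.
- by apply/measurable_EFinP; exact: measurableT_comp.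
- apply: emeasurable_funD; first exact: measurable_cst.
  by apply: measurable_funeM; exact: sqr_measurable.
- move=> x _; rewrite -EFinM -EFinD lee_fin powR_mulrn//.
  have [h|h] := leP `|u x| e.
    by apply: (le_trans h); rewrite lerDl mulr_ge0 ?sqr_ge0// invr_ge0 ltW.
  apply: (@le_trans _ _ (e^-1 * `|u x| ^+ 2)); last by rewrite lerDr ltW.
  rewrite mulrC ler_pdivlMr// expr2; apply: ler_wpM2l => //; exact: ltW.
Qed.

Lemma L2_integrable u : L2 Om u -> mu.-integrable Om (EFin \o u).
Proof.
move=> [mu_ fu]; apply/integrableP; split; first exact/measurable_EFinP.
apply: le_lt_trans (L1_le_L2 _ _ ltr01 mu_) _; rewrite mul1e invr1 mul1e.
by apply: lte_add_pinfty => //; exact: L2_sqr_lty.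
Qed.

Lemma L2_cvg_L1 (T : Type) (F : set_system T) (f : T -> 'rV[R]_n -> R) : Filter F ->
  (\forall r \near F, measurable_fun Om (f r)) ->
  Lnorm_on Om 2%:E (f r) @[r --> F] --> 0%E ->
  forall e : R, 0 < e ->
    \forall r \near F, (\int[mu]_(x in Om) `|f r x|%:E <= e%:E)%E.
Proof.
move=> FF mf f0 e e0.
pose M := fine (mu Om).
have M0 : 0 <= M by exact: fine_ge0.
(* Chosen so that d M <= e / 2; the next constant c satisfies c^2 / d = e / 2. *)
pose d := e / (2 * (M + 1)).
have d0 : 0 < d by rewrite divr_gt0// mulr_gt0// ltr_wpDl.
pose c := Num.sqrt (d * (e / 2)).
have c0 : 0 < c by rewrite sqrtr_gt0 mulr_gt0// divr_gt0.
have /fine_cvgP[ffin /cvgrPdist_le/(_ _ c0) fe] := f0.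
apply: filterS3 ffin fe mf => r fr; rewrite sub0r normrN => hr mfr.
apply: le_trans (L1_le_L2 _ _ d0 mfr) _.
have h2 : (\int[mu]_(x in Om) (`|f r x| `^ 2)%:E <= (c ^+ 2)%:E)%E.
  have L0 : 0 <= fine (Lnorm_on Om 2%:E (f r)) by apply: fine_ge0; exact: Lnorm_ge0.
  rewrite -L2_normX -(fineK fr) poweR_EFin lee_fin powR_mulrn//.
  rewrite lerXn2r ?nnegrE ?(ltW c0)//.
  exact: le_trans (ler_norm _) hr.
apply: (@le_trans _ _ (d%:E * M%:E + d^-1%:E * (c ^+ 2)%:E)%E).
  apply: leeD; first by rewrite /M fineK// ge0_fin_numE.
  by apply: lee_wpmul2l => //; rewrite lee_fin invr_ge0 ltW.
rewrite -[leLHS]/((d * M + d^-1 * c ^+ 2)%:E) lee_fin.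
rewrite sqr_sqrtr; last by rewrite ltW// mulr_gt0// divr_gt0.
rewrite mulKf ?gt_eqF//.
have : d * M <= e / 2.
  have -> : d * M = e / 2 * (M / (M + 1)) by rewrite /d; field; rewrite gt_eqF// ltr_wpDl.
  rewrite -[leRHS]mulr1 ler_wpM2l ?divr_ge0 ?(ltW e0)//.
  by rewrite ler_pdivrMr ?ltr_wpDl// mul1r lerDl.
by lra.
Qed.

End L2_facts.

Section test_functions.
Context {R : realType} {n : nat}.
Local Notation mu := (@lebesgue_rV R n).
Variables (p s : R) (Om D : set 'rV[R]_n).
Hypothesis p2 : 2 < p.
Hypothesis s0 : 0 < s.
Hypothesis oOm : open Om.
Hypothesis bOm : bounded_set Om.
Hypothesis oD : open D.
Hypothesis bD : bounded_set D.
Implicit Types (u v w phi : 'rV[R]_n -> R).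

Let mD : measurable D. Proof. exact: measurable_open_rV. Qed.
Let mOm : measurable Om. Proof. exact: measurable_open_rV. Qed.
Let p0 : 0 < p. Proof. by have := p2; lra. Qed.
Let p1 : 1 < p. Proof. by have := p2; lra. Qed.
Let q0 : 0 < p - 1. Proof. by have := p2; lra. Qed.

Let powR_itv01 (q x : R) : 0 <= q -> 0 <= x <= 1 -> `|x| `^ q <= 1.
Proof.
move=> qq /andP[x0 x1]; rewrite ger0_norm//.
apply: le_trans (le_powRl _ _ _ qq x0 x1) _; by rewrite powR1.
Qed.

(** Values in [0, 1] give all the L^q and tail conditions, the latter through
    [tail_weight_integrable]; only the seminorm has to be supplied. *)
Lemma admissible_X0 phi : admissible Om phi -> (gagliardo s p D phi < +oo)%E ->
  X0 s p Om D phi.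
Proof.
move=> [mphi phi0 phi1] gphi.
have bounded_int (A : set 'rV[R]_n) (q : R) : 0 <= q -> measurable A ->
    (mu A < +oo)%E -> (\int[mu]_(x in A) (`|phi x| `^ q)%:E < +oo)%E.
  move=> qq mA fA; apply: (@le_lt_trans _ _ (\int[mu]_(x in A) cst 1 x)%E).
    apply: ae_ge0_le_integral_any.
    - by [].
    - by move=> x _; rewrite lee_fin powR_ge0.
    - by move=> x _; exact: lee01.
    - by apply: aeW => x _; rewrite lee_fin; exact: powR_itv01.
  by rewrite integral_cst// mul1e.
split.
- apply/(sobolevP s p p1); split; first exact: measurable_funTS.
  apply: lte_add_pinfty => //; apply: bounded_int => //; first exact: ltW.
  exact: bounded_set_finite_measure.
- split => //.
  + move=> A cA.
    have mA : measurable A.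
      apply: closed_measurable_rV; apply: compact_closed => //; exact: norm_hausdorff.
    apply: bounded_int => //; first exact: ltW.
    by apply: bounded_set_finite_measure => //; exact: compact_bounded.
  + apply: poweR_lty.
    apply: (@le_lt_trans _ _ (\int[mu]_x ((1 + enorm x `^ (n%:R + s * p))^-1)%:E)%E).
      apply: ae_ge0_le_integral_any.
      - by [].
      - by move=> x _; rewrite lee_fin mulr_ge0 ?powR_ge0 ?tail_weight_ge0.
      - by move=> x _; rewrite lee_fin tail_weight_ge0.
      - apply: aeW => x _; rewrite lee_fin -[leRHS]mul1r.
        apply: ler_wpM2r; first exact: tail_weight_ge0.
        by apply: powR_itv01; [exact: ltW|exact: phi1].
    by apply: tail_weight_integrable; exact: mulr_gt0.
- by apply: aeW => x; exact: phi0.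
Qed.

Lemma admissible_L2 phi : admissible Om phi -> L2 Om phi.
Proof.
move=> [mphi phi0 phi1]; split; first exact: measurable_funTS.
have fOm : (mu Om < +oo)%E by exact: bounded_set_finite_measure.
have h : (Lnorm_on Om 2%:E phi `^ 2 < +oo)%E.
  rewrite L2_normX.
  apply: (@le_lt_trans _ _ (\int[mu]_(x in Om) cst 1 x)%E).
    apply: ae_ge0_le_integral_any.
    - by [].
    - by move=> x _; rewrite lee_fin powR_ge0.
    - by move=> x _; exact: lee01.
    - by apply: aeW => x _; rewrite lee_fin; exact: powR_itv01.
  by rewrite integral_cst// mul1e.
by apply: lty_poweRy h.
Qed.

(** Off a null set [excess] is the truncation of w - k, and [clip] is 1-Lipschitz. *)
Lemma gagliardo_excess_le w k : 0 <= k ->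
  {ae mu, forall x, ~ Om x -> w x = 0} ->
  (gagliardo s p D (excess Om w k) <= gagliardo s p D w)%E.
Proof.
move=> k0 w0; apply: ae_ge0_le_integral_any.
- exact: measurableX.
- by move=> z _; rewrite lee_fin mulr_ge0 ?powR_ge0.
- by move=> z _; rewrite lee_fin mulr_ge0 ?powR_ge0.
have := @ae_prod1 _ _ _ _ _ mu mu _ w0; have := @ae_prod2 _ _ _ _ _ mu mu _ w0.
apply: ae_imply2 => z g2 g1 _.
have or1 : Om z.1 \/ w z.1 = 0 by have [?|/g1] := pselect (Om z.1); [left|right].
have or2 : Om z.2 \/ w z.2 = 0 by have [?|/g2] := pselect (Om z.2); [left|right].
rewrite lee_fin ler_wpM2r ?powR_ge0// !(excess_eq _ _ _ _ k0)//.
apply: le_powRl => //; first exact: ltW.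
apply: le_trans (clip_lip _ _) _.
by have -> : w z.1 - k - (w z.2 - k) = w z.1 - w z.2 by ring.
Qed.

(** Test functions vanish off Om, so the integral of |w|^p over the complement is at most that of
    |phi k - w|^p, which tends to 0. *)
Lemma sobolev0_ae_zero w : sobolev0 s p Om w -> {ae mu, forall x, ~ Om x -> w x = 0}.
Proof.
move=> [[mw _] [phi [tphi cphi]]].
have phi0 k x : ~ Om x -> phi k x = 0.
  move=> Ox; have [_ [_ sub]] := tphi k; apply/eqP; apply: contrapT => /negP H.
  by apply: Ox; apply: sub; apply: subset_closure.
have mC : measurable (~` Om) by exact: measurableC.
have mwC : measurable_fun (~` Om) w by exact: measurable_funTS.
have m2 : measurable_fun (~` Om) (fun x => (`|w x| `^ p)%:E).
  apply/measurable_EFinP; apply: measurable_fun_powR; exact: measurableT_comp.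
have le1 k : (\int[mu]_(x in ~` Om) (`|w x| `^ p)%:E <=
    sobolev_norm s p setT (phi k - w)%R `^ p)%E.
  have := sobolev_normX s p p1 (@setT 'rV[R]_n) (phi k - w).
  move=> /= ->; rewrite /sobolev_power.
  apply: (@le_trans _ _ (\int[mu]_x (`|(phi k - w)%R x| `^ p)%:E)%E); last first.
    by apply: leeDr; exact: gagliardo_ge0.
  rewrite [leLHS]integral_mkcond; apply: ae_ge0_le_integral_any.
  - by [].
  - by move=> x _; rewrite /patch; case: ifP => // _; rewrite lee_fin powR_ge0.
  - by move=> x _; rewrite lee_fin powR_ge0.
  - apply: aeW => x _; rewrite /patch; case: ifPn => xO; last by rewrite lee_fin powR_ge0.
    rewrite inE in xO.
    have -> : (phi k - w) x = - w x.
      by rewrite -[LHS]/(phi k x - w x) phi0// sub0r.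
    by rewrite normrN.
have I0 : (\int[mu]_(x in ~` Om) (`|w x| `^ p)%:E = 0)%E.
  apply/eqP; rewrite eq_le; apply/andP; split; last first.
    by apply: integral_ge0 => x _; rewrite lee_fin powR_ge0.
  apply/lee_addgt0Pr => e e0; rewrite add0e.
  have e1 : 0 < e `^ p^-1 by exact: powR_gt0.
  have [k _ hk] := cvge0_le_near _ _ e1 cphi.
  apply: (le_trans (le1 k)).
  have -> : e = (e `^ p^-1) `^ p by rewrite -powRrM mulVf ?gt_eqF// powRr1// ltW.
  rewrite -poweR_EFin; apply: gt0_ler_poweR; rewrite ?in_itv/= ?leey ?andbT.
  - exact: ltW.
  - exact: poweR_ge0.
  - by rewrite lee_fin ltW.
  - exact: (hk k (leqnn k)).
have I0' : (\int[mu]_(x in ~` Om) `|(`|w x| `^ p)%:E| = 0)%E.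
  by under eq_integral do rewrite /= ger0_norm ?powR_ge0//.
have [H _] := @ae_eq_integral_abs _ _ _ mu (~` Om) mC _ m2.
apply: ae_imply (H I0') => x hx Ox; have := hx Ox => -[] /eqP.
by rewrite powR_eq0 normr_eq0 => /andP[/eqP].
Qed.

End test_functions.

(** * Energy decay *)

Section barrier.
Context {R : realType}.
Implicit Types (p al c x y : R).

(** r^(-al) = exp(- al ln r) >= 1 - al ln r >= 1 - al (r - 1) for r = y / x, rescaled by x^(-al). *)
Lemma powRN_convex al x y : 0 < al -> 0 < x -> x <= y ->
  x `^ (- al) - y `^ (- al) <= al * (y - x) * x `^ (- (al + 1)).
Proof.
move=> al0 x0 xy; have y0 : 0 < y by exact: lt_le_trans xy.
pose r := y / x.
have r0 : 0 < r by exact: divr_gt0.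
have yr : y `^ (- al) = x `^ (- al) * r `^ (- al).
  rewrite -powRM; [|exact: ltW..].
  by rewrite /r mulrC divfK// gt_eqF.
have ral : 1 - al * (r - 1) <= r `^ (- al).
  rewrite /powR gt_eqF//; apply: le_trans (expR_ge1Dx _).
  rewrite mulNr lerD2l lerN2 ler_wpM2l ?(ltW al0)//.
  have -> : ln r = ln (1 + (r - 1)) by congr ln; ring.
  by apply: le_ln1Dx; lra.
have -> : x `^ (- (al + 1)) = x `^ (- al) / x.
  rewrite opprD powRD; last by rewrite (gt_eqF x0) implybT.
  by rewrite powR_inv1// ltW.
rewrite yr -{1}[x `^ (- al)]mulr1 -mulrBr.
have -> : al * (y - x) * (x `^ (- al) / x) = x `^ (- al) * (al * (r - 1)).
  by rewrite /r; field; rewrite gt_eqF.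
by apply: ler_wpM2l; [exact: powR_ge0|lra].
Qed.

(* [A t ^ (-1/(p-2))] solves [k' <= - c k ^ (p-1)] in the implicit sense needed
   along a partition of mesh at most the distance to the singularity. *)
Lemma barrier_decay p c : 2 < p -> 0 < c -> exists2 A : R, 0 < A &
  forall x y, 0 < x -> x <= y -> y <= 2 * x ->
  A * x `^ (- (p - 2)^-1) - A * y `^ (- (p - 2)^-1) <=
  (y - x) * (c * (A * y `^ (- (p - 2)^-1)) `^ (p - 1)).
Proof.
move=> p2 c0; have p20 : 0 < p - 2 by lra.
set al := (p - 2)^-1; have al0 : 0 < al by rewrite invr_gt0.
(* With A = B^al one has A^(p-2) = B. The value c B = al 2^(al+1) is forced by the slope al of the
   power together with the cost 2^(al+1) of passing from x to y <= 2 x at the exponent -(al + 1). *)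
pose B := al * 2 `^ (al + 1) / c.
have B0 : 0 < B by rewrite divr_gt0// mulr_gt0// powR_gt0.
exists (B `^ al); first exact: powR_gt0.
move=> x y x0 xy y2x; set A := B `^ al.
have A0 : 0 < A by exact: powR_gt0.
have y0 : 0 < y by exact: lt_le_trans xy.
have e : (A * y `^ (- al)) `^ (p - 1) = A * B * y `^ (- (al + 1)).
  rewrite powRM ?powR_ge0 ?(ltW A0)//.
  have -> : A `^ (p - 1) = A * B.
    have -> : p - 1 = p - 2 + 1 by ring.
    rewrite powRS ?(ltW A0) ?(ltW p20)//; congr (_ * _).
    by rewrite /A -powRrM mulVf ?gt_eqF// powRr1// ltW.
  (* al (p - 1) = al + 1, because al (p - 2) = 1. *)
  rewrite -powRrM; congr (_ * _ `^ _).
  by rewrite /al; field; rewrite gt_eqF.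
rewrite e -mulrBr.
apply: (@le_trans _ _ (A * (al * (y - x) * x `^ (- (al + 1))))).
  by rewrite ler_wpM2l ?(ltW A0)// powRN_convex.
have -> : (y - x) * (c * (A * B * y `^ (- (al + 1)))) =
    A * (al * (y - x) * (2 `^ (al + 1) * y `^ (- (al + 1)))).
  by rewrite /B; field; rewrite gt_eqF.
rewrite ler_wpM2l ?(ltW A0)// ler_wpM2l ?mulr_ge0 ?(ltW al0) ?subr_ge0//.
have al10 : 0 <= al + 1 by rewrite addr_ge0// ltW.
rewrite !powRN ler_pdivlMr ?powR_gt0// mulrC ler_pdivrMr ?powR_gt0//.
by rewrite -powRM ?(ltW x0)//; apply: le_powRl => //; exact: ltW.
Qed.

End barrier.

Section form_in_time.
Context {R : realType} {n : nat}.
Local Notation mu := (@lebesgue_rV R n).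
Local Notation leb := (@lebesgue_measure R).
Variables (p s : R) (Om D : set 'rV[R]_n).
Hypothesis p2 : 2 < p.
Hypothesis s0 : 0 < s.
Hypothesis oOm : open Om.
Hypothesis bOm : bounded_set Om.
Hypothesis oD : open D.
Hypothesis OmD : compactly_contained Om D.
Variables (u v : R -> 'rV[R]_n -> R) (a b : R).
Hypothesis Su : bochner_Lp p `[a, b] (sobolev s p D) u.
Hypothesis Sv : bochner_Lp p `[a, b] (sobolev s p D) v.
Hypothesis Tu : bochner_Lp (p - 1) `[a, b] (tail_space (p - 1) (s * p)) u.
Hypothesis Tv : bochner_Lp (p - 1) `[a, b] (tail_space (p - 1) (s * p)) v.
Hypothesis W0 : {ae leb, forall t, `[a, b]%classic t ->
  {ae mu, forall x, ~ Om x -> v t x - u t x = 0}}.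

Let p0 : 0 < p. Proof. by have := p2; lra. Qed.
Let p1 : 1 < p. Proof. by have := p2; lra. Qed.
Let mD : measurable D. Proof. exact: measurable_open_rV. Qed.

Lemma gagliardoB_le (f g : 'rV[R]_n -> R) : measurable_fun setT f ->
  measurable_fun setT g ->
  (gagliardo s p D (f \- g)%R <=
    (2 `^ p)%:E * (gagliardo s p D f + gagliardo s p D g))%E.
Proof.
move=> mf mg.
have mf' : measurable_fun D f by exact: measurable_funTS.
have mg' : measurable_fun D g by exact: measurable_funTS.
have mNg : measurable_fun D (fun x => -1 * g x).
  by apply: measurable_funM => //; exact: measurable_cst.
have := gagliardoD s p p1 D f _ mD mf' mNg.
rewrite (gagliardoZ s p D g (-1) mD mg') normrN1 powR1 mul1e.
have -> // : (f \- g)%R = fun x => f x + -1 * g x.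
by apply/funext => x /=; rewrite mulN1r.
Qed.

Lemma form_time_modulus eta : 0 < eta ->
  exists (G : measurableTypeR R -> R) (h0 : R) (S : set (measurableTypeR R)),
  [/\ 0 < h0, measurable_fun setT G /\ (forall t, 0 <= G t),
      (\int[leb]_(t in `[a, b]) (G t)%:E <= eta%:E)%E,
      {ae leb, forall t, `[a, b]%classic t -> S t} &
      (forall t, S t -> [/\ measurable_fun setT (u t), measurable_fun setT (v t),
         (pair_power p s D (u t) < +oo)%E, (pair_power p s D (v t) < +oo)%E &
         {ae mu, forall x, ~ Om x -> v t x - u t x = 0}]) /\
      forall r t k, `[a, b]%classic r -> `[a, b]%classic t -> S r -> S t ->
        `|r - t| <= h0 -> 0 <= k ->
        let phi := excess Om (v t \- u t) k in
        `|nonlocal_form p s (u r) phi - nonlocal_form p s (u t) phi| <= G r + G t /\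
        `|nonlocal_form p s (v r) phi - nonlocal_form p s (v t) phi| <= G r + G t].
Proof.
move=> eta0; set J := `[a, b]%classic.
have mJ : measurable (J : set (measurableTypeR R)) by exact: measurable_itv.
have [C C0 hC] := form_diff_le p s p2 Om D s0 oOm bOm oD OmD.
have [mU [mmU mU0 imU HU]] := pair_power_bound p s D p2 oD u a b Su Tu.
have [mV [mmV mV0 imV HV]] := pair_power_bound p s D p2 oD v a b Sv Tv.
pose P2 : R := 2 `^ p.
have P20 : 0 <= P2 by exact: powR_ge0.
pose m t := mU t + mV t.
have m0 t : 0 <= m t by exact: addr_ge0.
have mm : measurable_fun setT m by exact: measurable_funD.
have imfin : (\int[leb]_(t in J) (m t)%:E < +oo)%E.
  under eq_integral do rewrite EFinD.
  rewrite ge0_integralD//; first exact: lte_add_pinfty.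
  - by move=> t _; rewrite lee_fin.
  - by apply/measurable_EFinP; exact: measurable_funTS.
  - by move=> t _; rewrite lee_fin.
  - by apply/measurable_EFinP; exact: measurable_funTS.
pose M := fine (\int[leb]_(t in J) (m t)%:E)%E.
have M0 : 0 <= M by apply: fine_ge0; apply: integral_ge0 => t _; rewrite lee_fin.
have ME : (\int[leb]_(t in J) (m t)%:E = M%:E)%E.
  by rewrite /M fineK// ge0_fin_numE//; apply: integral_ge0 => t _; rewrite lee_fin.
(* Chosen against the total mass M of the majorants, so that x1 M <= eta / 2; the added 1s keep the
   denominators positive. *)
pose d := eta / (2 * ((C + 1) * (1 + P2) * (M + 1))).
have C1 : 0 < C + 1 by rewrite ltr_wpDl.
have P21 : 0 < 1 + P2 by rewrite ltr_wpDr.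
have M1 : 0 < M + 1 by rewrite ltr_wpDl.
have den0 : 0 < (C + 1) * (1 + P2) * (M + 1).
  by rewrite !mulr_gt0.
have d0 : 0 < d by rewrite divr_gt0// mulr_gt0.
pose Cd := d `^ (1 - p) + d `^ (2 - p).
have Cd0 : 0 <= Cd by rewrite addr_ge0// powR_ge0.
(* Chosen after d: the negative powers of d in Cd are now constants, and the two moduli together
   cost x2 (2 eps) <= eta / 2. *)
pose eps := eta / (4 * ((C + 1) * (Cd + 1))).
have den1 : 0 < (C + 1) * (Cd + 1) by rewrite mulr_gt0// ltr_wpDl.
have eps0 : 0 < eps by rewrite divr_gt0// mulr_gt0.
have [eU [hU [SU [hU0 [meU eU0] ieU AU EU]]]] :=
  pair_power_modulus p s D p2 oD u a b eps eps0 Su Tu.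
have [eV [hV [SV [hV0 [meV eV0] ieV AV EV]]]] :=
  pair_power_modulus p s D p2 oD v a b eps eps0 Sv Tv.
pose e t := eU t + eV t.
have e0 t : 0 <= e t by exact: addr_ge0.
have me : measurable_fun setT e by exact: measurable_funD.
have ieE : (\int[leb]_(t in J) (e t)%:E <= (eps + eps)%:E)%E.
  under eq_integral do rewrite EFinD.
  rewrite ge0_integralD//; first by rewrite EFinD; exact: leeD.
  - by move=> t _; rewrite lee_fin.
  - by apply/measurable_EFinP; exact: measurable_funTS.
  - by move=> t _; rewrite lee_fin.
  - by apply/measurable_EFinP; exact: measurable_funTS.
pose x1 := C * (d * (1 + P2)); pose x2 := C * Cd.
have x10 : 0 <= x1 by rewrite mulr_ge0// mulr_ge0// ltW.
have x20 : 0 <= x2 by rewrite mulr_ge0.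
pose G t := x1 * m t + x2 * e t.
have mxm : measurable_fun setT (fun t : measurableTypeR R => x1 * m t).
  by apply: measurable_funM => //; exact: measurable_cst.
have mxe : measurable_fun setT (fun t : measurableTypeR R => x2 * e t).
  by apply: measurable_funM => //; exact: measurable_cst.
pose S t := [/\ SU t, SV t,
  measurable_fun setT (u t) /\ (pair_power p s D (u t) <= (mU t)%:E)%E,
  measurable_fun setT (v t) /\ (pair_power p s D (v t) <= (mV t)%:E)%E &
  {ae mu, forall x, ~ Om x -> v t x - u t x = 0}].
exists G, (Num.min hU hV), S; split.
- by rewrite lt_min hU0.
- split; first exact: measurable_funD.
  by move=> t; apply: addr_ge0; exact: mulr_ge0.
- have -> : (\int[leb]_(t in J) (G t)%:E = x1%:E * (\int[leb]_(t in J) (m t)%:E) +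
      x2%:E * (\int[leb]_(t in J) (e t)%:E))%E.
    rewrite -(ge0_integralZl_EFin leb mJ _ _ x10); last 2 first.
    + by move=> t _; rewrite lee_fin.
    + by apply/measurable_EFinP; exact: measurable_funTS.
    rewrite -(ge0_integralZl_EFin leb mJ _ _ x20); last 2 first.
    + by move=> t _; rewrite lee_fin.
    + by apply/measurable_EFinP; exact: measurable_funTS.
    rewrite -ge0_integralD//.
    + by move=> t _; rewrite lee_fin mulr_ge0.
    + by apply/measurable_EFinP; exact: measurable_funTS.
    + by move=> t _; rewrite lee_fin mulr_ge0.
    + by apply/measurable_EFinP; exact: measurable_funTS.
  rewrite ME; apply: (@le_trans _ _ (x1%:E * M%:E + x2%:E * (eps + eps)%:E)%E).
    by apply: leeD => //; apply: lee_wpmul2l.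
  rewrite -[leLHS]/((x1 * M + x2 * (eps + eps))%:E) lee_fin.
  have h1 : x1 * M <= eta / 2.
    have -> : x1 * M = eta / 2 * (C * (1 + P2) * M / ((C + 1) * (1 + P2) * (M + 1))).
      by rewrite /x1 /d; field; rewrite !gt_eqF.
    rewrite -[leRHS]mulr1 ler_wpM2l ?divr_ge0 ?(ltW eta0)//.
    rewrite ler_pdivrMr// mul1r; apply: ler_pM => //.
    + by rewrite mulr_ge0 ?addr_ge0.
    + by rewrite ler_wpM2r ?addr_ge0// lerDl.
    + by rewrite lerDl.
  have h2 : x2 * (eps + eps) <= eta / 2.
    have -> : x2 * (eps + eps) = eta / 2 * (C * Cd / ((C + 1) * (Cd + 1))).
      by rewrite /x2 /eps; field; rewrite !gt_eqF// ltr_wpDl.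
    rewrite -[leRHS]mulr1 ler_wpM2l ?divr_ge0 ?(ltW eta0)//.
    by rewrite ler_pdivrMr// mul1r; apply: ler_pM => //; rewrite lerDl.
  by lra.
- have A1 : {ae leb, forall t, J t -> SU t /\ SV t}.
    by apply: (ae_imply2 _ _ _ _ _ _ _ _ AU AV) => t h k Jt; split; [exact: h|exact: k].
  have A2 : {ae leb, forall t, J t ->
      (measurable_fun setT (u t) /\ (pair_power p s D (u t) <= (mU t)%:E)%E) /\
      (measurable_fun setT (v t) /\ (pair_power p s D (v t) <= (mV t)%:E)%E)}.
    by apply: (ae_imply2 _ _ _ _ _ _ _ _ HU HV) => t h k Jt; split; [exact: h|exact: k].
  have A3 : {ae leb, forall t, J t -> (SU t /\ SV t) /\
      ((measurable_fun setT (u t) /\ (pair_power p s D (u t) <= (mU t)%:E)%E) /\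
      (measurable_fun setT (v t) /\ (pair_power p s D (v t) <= (mV t)%:E)%E))}.
    by apply: (ae_imply2 _ _ _ _ _ _ _ _ A1 A2) => t h k Jt; split; [exact: h|exact: k].
  apply: (ae_imply2 _ _ _ _ _ _ _ _ A3 W0) => t h1 h3 Jt.
  have [[? ?] [? ?]] := h1 Jt; split => //; exact: h3.
- split.
    move=> t [_ _ [? hu] [? hv] ?]; split => //.
    + exact: le_lt_trans hu (ltry _).
    + exact: le_lt_trans hv (ltry _).
  move=> r t k Jr Jt [r1 r2 [ru1 ru2] [rv1 rv2] _] [t1 t2 [tu1 tu2] [tv1 tv2] tw].
  rewrite le_min => /andP[rtU rtV] k0 phi.
  have mw : measurable_fun setT (v t \- u t) by exact: measurable_funB.
  have aphi : admissible Om phi.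
    split; first exact: measurable_excess.
    - by move=> x; exact: excess_out.
    - by move=> x; exact: excess_itv.
  have gphi : (gagliardo s p D phi <= (P2 * m t)%:E)%E.
    apply: le_trans (gagliardo_excess_le p s Om D p2 oD _ _ k0 tw) _.
    apply: le_trans (gagliardoB_le _ _ tv1 tu1) _.
    rewrite EFinM; apply: lee_wpmul2l; first by rewrite lee_fin.
    have gp g (y : R) : (pair_power p s D g <= y%:E)%E -> (gagliardo s p D g <= y%:E)%E.
      move=> h; apply: le_trans h; rewrite /pair_power.
      by have := @tail_power_ge0 R n (p - 1) (s * p) g;
        move: (tail_power _ _ _) (gagliardo _ _ _ _) => A B A0; rewrite leeDl.
    by rewrite /m [mU t + _]addrC EFinD; apply: leeD; exact: gp.
  (* The majorants at r and t and the seminorm of phi at t fit into (1 + P2) (m r + m t), so one G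
     serves both u and v. *)
  have concl X Y : X <= (1 + P2) * m r + (1 + P2) * m t -> Y <= e r + e t ->
      C * (d * X + Cd * Y) <= G r + G t.
    move=> hX hY; have -> : G r + G t =
        C * (d * ((1 + P2) * m r + (1 + P2) * m t) + Cd * (e r + e t)).
      by rewrite /G /x1 /x2; ring.
    apply: ler_wpM2l => //; apply: lerD; apply: ler_wpM2l => //; exact: ltW.
  have Pm := mulr_ge0 P20 (m0 r).
  have em : (1 + P2) * m r + (1 + P2) * m t = m r + P2 * m r + m t + P2 * m t by ring.
  split.
    have H := hC d (u r) (u t) phi (mU r) (mU t) (P2 * m t) (eU r + eU t) d0
      ru1 tu1 aphi ru2 tu2 gphi (EU r t Jr Jt r1 t1 rtU).
    apply: (le_trans H); apply: concl; last first.
      by have := eV0 r; have := eV0 t; rewrite /e; lra.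
    rewrite em; have := mV0 r; have := mV0 t; move: Pm.
    by move: (P2 * m r) (P2 * m t); rewrite /m => ? ?; lra.
  have H := hC d (v r) (v t) phi (mV r) (mV t) (P2 * m t) (eV r + eV t) d0
    rv1 tv1 aphi rv2 tv2 gphi (EV r t Jr Jt r2 t2 rtV).
  apply: (le_trans H); apply: concl; last first.
    by have := eU0 r; have := eU0 t; rewrite /e; lra.
  rewrite em; have := mU0 r; have := mU0 t; move: Pm.
  by move: (P2 * m r) (P2 * m t); rewrite /m => ? ?; lra.
Qed.

End form_in_time.

(** Here h stands for the form along a trajectory, whose measurability in time is unknown. It lies
    almost everywhere between F - g - G and F + g + G, which are integrable, so [Rintegral_sandwich]
    applies. *)
Lemma Rintegral_near_cst (R : realType) (G h : R -> R) (r t F g : R) : r <= t ->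
  (@lebesgue_measure R).-integrable `[r, t] (EFin \o G) ->
  {ae @lebesgue_measure R, forall x, `[r, t]%classic x -> `|h x - F| <= G x + g} ->
  `|\int[@lebesgue_measure R]_(x in `[r, t]) h x - (t - r) * F| <=
    \int[@lebesgue_measure R]_(x in `[r, t]) G x + (t - r) * g.
Proof.
move=> rt iG hF; set J := `[r, t]%classic.
have mJ : measurable (J : set (measurableTypeR R)) by exact: measurable_itv.
have lJ : fine (lebesgue_measure J) = t - r.
  rewrite lebesgue_measure_itv/= lte_fin; case: ltP => // tr.
  have -> : t = r by apply/eqP; rewrite eq_le rt tr.
  by rewrite /= subrr.
have icst (y : R) : (@lebesgue_measure R).-integrable J (EFin \o cst y).
  apply/integrableP; split; first exact/measurable_EFinP.
  rewrite /= integral_cst//.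
  have fJ : (lebesgue_measure J < +oo :> \bar R)%E.
    by rewrite /J lebesgue_measure_itv/=; case: ifPn => _; rewrite -?EFinB ltry.
  exact: lte_mul_pinfty.
have i1 := integrableB mJ (icst (F - g)) iG.
have i2 := integrableD mJ (icst (F + g)) iG.
pose IH := \int[@lebesgue_measure R]_(x in J) h x.
pose IG := \int[@lebesgue_measure R]_(x in J) G x.
have /andP[h1 h2] : (F - g) * (t - r) - IG <= IH <= (F + g) * (t - r) + IG.
  rewrite -lJ -!(Rintegral_cst lebesgue_measure mJ).
  rewrite -(RintegralB mJ (icst (F - g)) iG) -(RintegralD mJ (icst (F + g)) iG).
  apply: (Rintegral_sandwich _ _ _ (@lebesgue_measure R) J h
    (fun x => F - g - G x) (fun x => F + g + G x) mJ i1 i2).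
  apply: ae_imply hF => x hx Jx; have := hx Jx; rewrite ler_norml => /andP[? ?].
  by apply/andP; split; lra.
rewrite -/IH -/IG; move: IH IG h1 h2 => I1 I2.
have -> : (F - g) * (t - r) = (t - r) * F - (t - r) * g by ring.
have -> : (F + g) * (t - r) = (t - r) * F + (t - r) * g by ring.
move: ((t - r) * F) ((t - r) * g) => y1 y2 h1 h2.
by rewrite ler_norml; apply/andP; split; lra.
Qed.

(** * Energy inequality for a moving level *)

Section energy.
Context {R : realType} {n : nat}.
Local Notation mu := (@lebesgue_rV R n).
Local Notation leb := (@lebesgue_measure R).
Variables (p s : R) (Om D : set 'rV[R]_n).
Hypothesis p2 : 2 < p.
Hypothesis s0 : 0 < s.
Hypothesis oOm : open Om.
Hypothesis bOm : bounded_set Om.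
Hypothesis oD : open D.
Hypothesis bD : bounded_set D.
Hypothesis OmD : compactly_contained Om D.

Let p1 : 1 < p. Proof. by have := p2; lra. Qed.
Let p0 : 0 < p. Proof. by have := p2; lra. Qed.
Let mOm : measurable Om. Proof. exact: measurable_open_rV. Qed.
Let fOm : (mu Om < +oo)%E. Proof. exact: bounded_set_finite_measure. Qed.

Lemma integrable_mul_admissible (h phi : 'rV[R]_n -> R) :
  mu.-integrable Om (EFin \o h) -> admissible Om phi ->
  mu.-integrable Om (EFin \o (fun x => h x * phi x)).
Proof.
move=> ih [mphi phi0 phi1].
apply: (@le_integrable _ _ _ _ _ mOm _ (EFin \o h)); last exact: ih.
  apply/measurable_EFinP; apply: measurable_funM.
    by case/integrableP: ih => /measurable_EFinP.
  exact: measurable_funTS.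
move=> x _; rewrite /= lee_fin normrM; have /andP[a b] := phi1 x.
by rewrite -[leRHS]mulr1 ler_wpM2l// ger0_norm.
Qed.

Lemma integrable_clip_prim (h : 'rV[R]_n -> R) (y : R) :
  mu.-integrable Om (EFin \o h) ->
  mu.-integrable Om (EFin \o (fun x => clip_prim (h x - y))).
Proof.
move=> ih.
have iy : mu.-integrable Om (EFin \o cst `|y|).
  apply/integrableP; split; first exact/measurable_EFinP.
  by rewrite /= integral_cst// lte_mul_pinfty.
have iw := integrable_norm ih.
apply: (@le_integrable _ _ _ _ _ mOm _ _ _ _ (integrableD mOm iw iy)).
  apply/measurable_EFinP; apply: (measurableT_comp measurable_clip_prim).
  apply: measurable_funB; last exact: measurable_cst.
  by case/integrableP: ih => /measurable_EFinP.
move=> x _ /=; rewrite lee_fin [leRHS]ger0_norm ?addr_ge0//.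
have cp0 : clip_prim (0 : R) = 0.
  by apply/eqP; rewrite eq_le clip_prim_ge0 andbT; have := clip_prim_le (0 : R); rewrite maxxx.
have := clip_prim_lip 0 (h x - y); rewrite cp0 !subr0 => hh.
exact: le_trans hh (ler_normB _ _).
Qed.

(** A constant path has derivative 0, so the first term of the weak form drops out. *)
Lemma weak_solution_cst f u r t phi : weak_solution s p Om D f u ->
  0 < r -> r < t -> admissible Om phi -> (gagliardo s p D phi < +oo)%E ->
  \int[leb]_(x in `[r, t]) nonlocal_form p s (u x) phi =
  \int[mu]_(x in Om) (u r x * phi x) - \int[mu]_(x in Om) (u t x * phi x) +
  \int[leb]_(x in `[r, t]) f x phi.
Proof.
move=> wu r0 rt aphi gphi; have [_ _ _ eq] := wu r t r0 rt.
have Xphi := admissible_X0 p s Om D p2 s0 oD bD phi aphi gphi.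
have Lphi := admissible_L2 Om oOm bOm phi aphi.
have N0 : fs_norm (X0 s p Om D) 0 = 0%E by exact: (sobolev_norm0 s p p1 D).
have B := bochner_Lp_cst (X0 s p Om D) N0 p r t phi Xphi.
have [[_ Xfin] _ _] := Xphi.
have Xpos : (0 <= fs_norm (X0 s p Om D) phi)%E by exact: poweR_ge0.
have L20 : L2 Om 0.
  split; first exact: measurable_cst.
  by rewrite L2_norm0.
have C1 := C1_on_cst (L2 Om) (L2_norm0 Om) `[r, t]%classic phi Lphi L20.
have := eq _ _ (B Xfin Xpos) C1.
have -> : \int[leb]_(t0 in `[r, t]) \int[mu]_(x in Om) (u t0 x * (0 : 'rV[R]_n -> R) x) = 0.
  rewrite (@eq_Rintegral _ _ _ leb _ (fun=> 0)).
    by rewrite Rintegral_cst// mul0r.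
  move=> x _; rewrite (@eq_Rintegral _ _ _ mu _ (fun=> 0)).
    by rewrite Rintegral_cst// mul0r.
  by move=> y _; rewrite -[(0 : 'rV[R]_n -> R) y]/(0 : R) mulr0.
by rewrite oppr0 add0r.
Qed.

Variables (f : R -> ('rV[R]_n -> R) -> R^o) (u v : R -> 'rV[R]_n -> R).
Hypothesis wu : weak_solution s p Om D f u.
Hypothesis wv : weak_solution s p Om D f v.

Let L2u t : 0 < t -> L2 Om (u t).
Proof.
move=> t0; have t1 : t < t + 1 by rewrite ltrDl.
have [_ _ C _] := wu _ _ t0 t1; have [] // := C t _.
by rewrite /= in_itv/= lexx ltW.
Qed.

Let L2v t : 0 < t -> L2 Om (v t).
Proof.
move=> t0; have t1 : t < t + 1 by rewrite ltrDl.
have [_ _ C _] := wv _ _ t0 t1; have [] // := C t _.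
by rewrite /= in_itv/= lexx ltW.
Qed.

Let w t := v t \- u t.

Let w_integrable t : 0 < t -> mu.-integrable Om (EFin \o w t).
Proof.
move=> t0; have iu := L2_integrable _ mOm fOm _ (L2u _ t0).
have iv := L2_integrable _ mOm fOm _ (L2v _ t0).
exact: (integrableB mOm iv iu).
Qed.

(** The terms with f are the same real number in both equations and cancel by subtraction. *)
Lemma weak_difference r t phi : 0 < r -> r < t -> admissible Om phi ->
  (gagliardo s p D phi < +oo)%E ->
  \int[mu]_(x in Om) ((w t x - w r x) * phi x) =
  \int[leb]_(x in `[r, t]) nonlocal_form p s (u x) phi -
  \int[leb]_(x in `[r, t]) nonlocal_form p s (v x) phi.
Proof.
move=> r0 rt aphi gphi; have t0 := lt_trans r0 rt.
rewrite (weak_solution_cst _ _ _ _ _ wu r0 rt aphi gphi).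
rewrite (weak_solution_cst _ _ _ _ _ wv r0 rt aphi gphi).
have iu := integrable_mul_admissible _ _ (L2_integrable _ mOm fOm _ (L2u _ r0)) aphi.
have iv := integrable_mul_admissible _ _ (L2_integrable _ mOm fOm _ (L2v _ r0)) aphi.
have ju := integrable_mul_admissible _ _ (L2_integrable _ mOm fOm _ (L2u _ t0)) aphi.
have jv := integrable_mul_admissible _ _ (L2_integrable _ mOm fOm _ (L2v _ t0)) aphi.
have I1 := integrableB mOm jv ju; have I2 := integrableB mOm iv iu.
rewrite (@eq_Rintegral _ _ _ mu _ (fun x =>
   (v t x * phi x - u t x * phi x) - (v r x * phi x - u r x * phi x))); last first.
  by move=> x _; rewrite /w /=; ring.
rewrite (RintegralB mOm I1 I2) (RintegralB mOm jv ju) (RintegralB mOm iv iu).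
by ring.
Qed.

Variables (a b c kap : R) (k : R -> R).
Hypothesis a0 : 0 < a.
Hypothesis ab : a < b.
Hypothesis kap0 : 0 < kap.
Hypothesis c_abs : absorbing p s Om c.
Hypothesis c0 : 0 < c.
Hypothesis k0 : forall t, a <= t -> 0 < k t.
Hypothesis k_mono : forall r t, a <= r -> r <= t -> k t <= k r.
Hypothesis k_decay : forall r t, a <= r -> r <= t -> t - r <= kap ->
  k r - k t <= (t - r) * (c * k t `^ (p - 1)).
Hypothesis W0 : {ae leb, forall t, `[a, b]%classic t ->
  {ae mu, forall x, ~ Om x -> v t x - u t x = 0}}.

Let E t := \int[mu]_(x in Om) clip_prim (w t x - k t).
Let m := fine (mu Om).

Let E_integrable t : 0 < t -> mu.-integrable Om (EFin \o (fun x => clip_prim (w t x - k t))).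
Proof. by move=> t0; apply: integrable_clip_prim; exact: w_integrable. Qed.

Let dw_integrable r t : 0 < r -> 0 < t ->
  mu.-integrable Om (EFin \o (fun x => w t x - w r x)).
Proof. by move=> r0 t0; exact: (integrableB mOm (w_integrable _ t0) (w_integrable _ r0)). Qed.

(** Serves only at the ends, to pass between a, b and nearby times of the full-measure set. *)
Let E_lip r t : 0 < r -> 0 < t ->
  E t <= E r + \int[mu]_(x in Om) `|w t x - w r x| + `|k t - k r| * m.
Proof.
move=> r0 t0.
have id := integrable_norm (dw_integrable _ _ r0 t0).
have ik : mu.-integrable Om (EFin \o cst (`|k t - k r|)).
  apply/integrableP; split; first exact/measurable_EFinP.
  by rewrite /= integral_cst// lte_mul_pinfty.
have iE := E_integrable _ r0; have iE' := E_integrable _ t0.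
rewrite -(Rintegral_cst mu mOm) -addrA -(RintegralD mOm id ik).
have idk := integrableD mOm id ik.
rewrite -(RintegralD mOm iE idk).
apply: le_Rintegral => //; first exact: (integrableD mOm iE idk).
move=> x _ /=; rewrite -lerBlDl; apply: le_trans (ler_norm _) _.
apply: le_trans (clip_prim_lip _ _) _.
have -> : w t x - k t - (w r x - k r) = (w t x - w r x) - (k t - k r) by ring.
exact: ler_normB.
Qed.

Let excess_integral t : \int[mu]_(x in Om) excess Om (w t) (k t) x =
  \int[mu]_x excess Om (w t) (k t) x.
Proof.
rewrite Rintegral_mkcond; apply: eq_Rintegral => x _; rewrite /patch.
by case: ifPn => // /negP; rewrite inE => /excess_out ->.
Qed.

(** The tangent inequality is taken at the later time t, so that its slope is the very test function
    for which absorption holds; the falling level contributes the second term. *)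
Let E_convex r t : 0 < r -> 0 < t -> admissible Om (excess Om (w t) (k t)) ->
  E t - E r <= \int[mu]_(x in Om) ((w t x - w r x) * excess Om (w t) (k t) x) +
    (k r - k t) * \int[mu]_x excess Om (w t) (k t) x.
Proof.
move=> r0 t0 aphi; set phi := excess _ _ _.
have iE := E_integrable _ r0; have iE' := E_integrable _ t0.
have id := integrable_mul_admissible _ _ (dw_integrable _ _ r0 t0) aphi.
have ik : mu.-integrable Om (EFin \o cst (k r - k t)).
  apply/integrableP; split; first exact/measurable_EFinP.
  by rewrite /= integral_cst// lte_mul_pinfty.
have i1 : mu.-integrable Om (EFin \o phi).
  apply: L2_integrable => //; exact: admissible_L2.
have ikphi := integrable_mul_admissible _ _ ik aphi.
rewrite -excess_integral -/phi -(RintegralZl _ mOm i1).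
rewrite -(RintegralB mOm iE' iE) -(RintegralD mOm id ikphi).
apply: le_Rintegral => //.
- exact: (integrableB mOm iE' iE).
- exact: (integrableD mOm id ikphi).
move=> x Ox /=; apply: le_trans (clip_prim_convex _ _) _.
rewrite /phi (excess_in _ _ _ _ Ox).
by rewrite [leRHS](_ : _ = clip (w t x - k t) * (w t x - k t - (w r x - k r)))//; ring.
Qed.

(** On the set Om of finite measure, continuity in L^2 gives continuity in L^1, which is the norm
    that [E_lip] needs. *)
Let L1_continuous (l : R -> 'rV[R]_n -> R) t e : C0_on `[a, b]%classic (L2 Om) l ->
  `[a, b]%classic t -> 0 < e ->
  exists2 d : R, 0 < d & forall r, `[a, b]%classic r -> `|r - t| < d ->
    \int[mu]_(x in Om) `|l r x - l t x| <= e.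
Proof.
move=> C Jt e0; have [Lt ct] := C t Jt.
have F : Filter (within `[a, b]%classic (nbhs t)) by exact: within_filter.
have mf : nbhs t (fun r => `[a, b]%classic r -> measurable_fun Om (l r - l t)%R).
  apply: (@filterE _ (nbhs t) (nbhs_filter t)) => r Jr; have [[mr _] _] := C r Jr.
  exact: measurable_funB mr Lt.1.
have /nbhs_ballP[d d0 hd] := L2_cvg_L1 _ mOm fOm _ _ _ F mf ct _ e0.
exists d => // r Jr rt.
have /= := hd r _ Jr; rewrite /ball/= distrC => /(_ rt).
have : (0 <= \int[mu]_(x in Om) (`|l r x - l t x|)%:E)%E by exact: integral_ge0.
rewrite /Rintegral.
have -> : (\int[mu]_(x in Om) (`|(l r - l t) x|)%:E =
  \int[mu]_(x in Om) (`|l r x - l t x|)%:E)%E by [].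
by move: (\int[mu]_(x in Om) _)%E => [y| |]; rewrite ?lee_fin.
Qed.

Let w_continuous t e : `[a, b]%classic t -> 0 < e ->
  exists2 d : R, 0 < d & forall r, `[a, b]%classic r -> `|r - t| < d ->
    \int[mu]_(x in Om) `|w r x - w t x| <= e.
Proof.
move=> Jt e0; have e20 : 0 < e / 2 by rewrite divr_gt0.
have [_ _ Cu _] := wu a b a0 ab; have [_ _ Cv _] := wv a b a0 ab.
have [du du0 hu] := L1_continuous u t _ Cu Jt e20.
have [dv dv0 hv] := L1_continuous v t _ Cv Jt e20.
exists (Num.min du dv); first by rewrite lt_min du0.
move=> r Jr; rewrite lt_min => /andP[rdu rdv].
have pos x : `[a, b]%classic x -> 0 < x.
  by rewrite /= in_itv/= => /andP[ax _]; exact: lt_le_trans ax.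
have r0 := pos _ Jr; have t0 := pos _ Jt.
have iu := integrable_norm (integrableB mOm (L2_integrable _ mOm fOm _ (L2u _ r0))
  (L2_integrable _ mOm fOm _ (L2u _ t0))).
have iv := integrable_norm (integrableB mOm (L2_integrable _ mOm fOm _ (L2v _ r0))
  (L2_integrable _ mOm fOm _ (L2v _ t0))).
apply: (@le_trans _ _ (\int[mu]_(x in Om) (`|v r x - v t x| + `|u r x - u t x|))).
  apply: le_Rintegral => //.
  - exact: integrable_norm (dw_integrable _ _ t0 r0).
  - exact: (integrableD mOm iv iu).
  move=> x _; have -> : w r x - w t x = (v r x - v t x) - (u r x - u t x).
    by rewrite /w /=; ring.
  exact: ler_normB.
rewrite (RintegralD mOm iv iu).
by have := hu r Jr rdu; have := hv r Jr rdv; lra.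
Qed.

(** Absorption at time t gains (t - r) c k(t)^(p-1) times the integral of phi, and [k_decay] keeps
    the cost of the falling level below that. Only the freezing errors remain, one for u and one for
    v, hence the factor 2 on G. *)
Let E_step (G : R -> R) (h0 : R) (S : set (measurableTypeR R)) :
  measurable_fun setT (G : measurableTypeR R -> R) -> (forall t, 0 <= G t) ->
  (\int[leb]_(t in `[a, b]) (G t)%:E < +oo)%E ->
  {ae leb, forall t, `[a, b]%classic t -> S t} ->
  (forall t, S t -> [/\ measurable_fun setT (u t), measurable_fun setT (v t),
     (pair_power p s D (u t) < +oo)%E, (pair_power p s D (v t) < +oo)%E &
     {ae mu, forall x, ~ Om x -> v t x - u t x = 0}]) ->
  (forall r t k, `[a, b]%classic r -> `[a, b]%classic t -> S r -> S t ->
    `|r - t| <= h0 -> 0 <= k ->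
    let phi := excess Om (v t \- u t) k in
    `|nonlocal_form p s (u r) phi - nonlocal_form p s (u t) phi| <= G r + G t /\
    `|nonlocal_form p s (v r) phi - nonlocal_form p s (v t) phi| <= G r + G t) ->
  forall r t, a <= r -> r < t -> t <= b -> S r -> S t -> t - r <= Num.min h0 kap ->
  E t <= E r + \int[leb]_(x in `[r, t]) (2 * G x) + (t - r) * (2 * G t).
Proof.
move=> mG G0 iG aeS HS HG r t ar rt tb Sr St; rewrite le_min => /andP[trh trk].
have r0 : 0 < r by exact: lt_le_trans ar.
have t0 : 0 < t by exact: lt_trans rt.
have a_t : a <= t by exact: le_trans ar (ltW rt).
have rb : r <= b by exact: le_trans (ltW rt) tb.
have Jt : `[a, b]%classic t by rewrite /= in_itv/= a_t.
have [mut mvt fut fvt wt] := HS t St.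
set phi := excess Om (w t) (k t).
have aphi : admissible Om phi.
  split; first by apply: measurable_excess => //; exact: measurable_funB.
  - by move=> x; exact: excess_out.
  - by move=> x; exact: excess_itv.
have kt0 := k0 _ a_t.
have gp g : (pair_power p s D g < +oo)%E -> (gagliardo s p D g < +oo)%E.
  apply: le_lt_trans; rewrite /pair_power.
  by have := @tail_power_ge0 R n (p - 1) (s * p) g;
    move: (tail_power _ _ _) (gagliardo _ _ _ _) => A B A0; rewrite leeDl.
have gphi : (gagliardo s p D phi < +oo)%E.
  apply: le_lt_trans (gagliardo_excess_le p s Om D p2 oD _ _ (ltW kt0) wt) _.
  apply: le_lt_trans (gagliardoB_le p s D p2 oD _ _ mvt mut) _.
  apply: lte_mul_pinfty; rewrite ?lee_fin ?powR_ge0//.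
  by apply: lte_add_pinfty; exact: gp.
have iGrt := integrable_subitv G a b mG G0 iG r t ar tb.
have near g (l : R -> 'rV[R]_n -> R) : (forall x, `[a, b]%classic x -> S x -> `|x - t| <= h0 ->
    `|nonlocal_form p s (l x) phi - g| <= G x + G t) ->
    `|\int[leb]_(x in `[r, t]) nonlocal_form p s (l x) phi - (t - r) * g| <=
    \int[leb]_(x in `[r, t]) G x + (t - r) * G t.
  move=> hg; apply: Rintegral_near_cst; [exact: ltW|exact: iGrt|].
  apply: ae_imply aeS => x Sx; rewrite /= in_itv/= => /andP[rx xt].
  have Jx : `[a, b]%classic x.
    by rewrite /= in_itv/= (le_trans ar rx) (le_trans xt tb).
  apply: hg => //; first exact: Sx.
  rewrite distrC ger0_norm ?subr_ge0//; apply: le_trans trh.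
  by rewrite lerD2l lerN2.
have nu := near (nonlocal_form p s (u t) phi) u
  (fun x Jx Sx xt => (HG x t (k t) Jx Jt Sx St xt (ltW kt0)).1).
have nv := near (nonlocal_form p s (v t) phi) v
  (fun x Jx Sx xt => (HG x t (k t) Jx Jt Sx St xt (ltW kt0)).2).
have iu := form_integrable p s p2 Om D s0 oOm bOm oD OmD _ _ aphi mut fut gphi.
have iv := form_integrable p s p2 Om D s0 oOm bOm oD OmD _ _ aphi mvt fvt gphi.
have ab_le := c_abs _ _ _ kt0 mut mvt wt iv iu.
have conv := E_convex _ _ r0 t0 aphi.
rewrite (weak_difference _ _ _ r0 rt aphi gphi) in conv.
have dec := k_decay _ _ ar (ltW rt) trk.
have Phi0 : 0 <= \int[mu]_x phi x.
  by apply: Rintegral_ge0 => x _; have /andP[] := excess_itv Om (w t) (k t) x.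
have mJ : measurable (`[r, t]%classic : set (measurableTypeR R)) by exact: measurable_itv.
rewrite (RintegralZl _ mJ iGrt).
move: nu nv ab_le conv; rewrite -/(w t) -/phi.
move: (\int[leb]_(x in `[r, t]) nonlocal_form p s (u x) phi) => Iu.
move: (\int[leb]_(x in `[r, t]) nonlocal_form p s (v x) phi) => Iv.
move: (nonlocal_form p s (u t) phi) (nonlocal_form p s (v t) phi) => Fu Fv.
move: (\int[mu]_x phi x) Phi0 (\int[leb]_(x in `[r, t]) G x) => Phi Phi0 IG.
move=> nu nv ab_le conv.
have tr0 : 0 < t - r by rewrite subr_gt0.
have d1 := ler_wpM2r Phi0 dec.
have d2 := ler_wpM2l (ltW tr0) ab_le.
have := ler_norm (Iu - (t - r) * Fu); have := ler_norm (- (Iv - (t - r) * Fv)).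
rewrite normrN => n1 n2; have n3 := le_trans n2 nu; have n4 := le_trans n1 nv.
have e1 : (t - r) * (c * k t `^ (p - 1)) * Phi = (t - r) * (c * k t `^ (p - 1) * Phi) by ring.
have e2 : (t - r) * (Fv - Fu) = (t - r) * Fv - (t - r) * Fu by ring.
have e3 : (t - r) * (2 * G t) = 2 * ((t - r) * G t) by ring.
rewrite e1 in d1; rewrite e2 in d2; rewrite e3.
move: ((t - r) * (c * k t `^ (p - 1) * Phi)) ((t - r) * Fv) ((t - r) * Fu)
  ((t - r) * G t) ((k r - k t) * Phi) n3 n4 d1 d2 conv => x1 x2 x3 x4 x5.
by move: (E t) (E r) => E1 E2 *; lra.
Qed.

Lemma energy_le : \int[mu]_(x in Om) clip_prim (v b x - u b x - k b) <=
  \int[mu]_(x in Om) clip_prim (v a x - u a x - k a).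
Proof.
rewrite -[leLHS]/(E b) -[leRHS]/(E a); have b0 : 0 < b by exact: lt_trans ab.
apply/ler_addgt0Pr => e e0.
(* The descent costs 5 (2 eta); the ends cost 4 eta, namely two L^1 distances and two variations of
   k. *)
pose eta := e / 14; have eta0 : 0 < eta by rewrite divr_gt0.
have [Su Tu _ _] := wu a b a0 ab; have [Sv Tv _ _] := wv a b a0 ab.
have [G [h0 [S [h00 [mG G0] iG aeS [HS HG]]]]] :=
  form_time_modulus p s Om D p2 s0 oOm bOm oD OmD u v a b Su Sv Tu Tv W0 eta eta0.
have iGoo : (\int[leb]_(t in `[a, b]) (G t)%:E < +oo)%E by exact: le_lt_trans iG (ltry _).
have mJ : measurable (`[a, b]%classic : set (measurableTypeR R)) by exact: measurable_itv.
have mG2 : measurable_fun setT (fun t : measurableTypeR R => 2 * G t).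
  by apply: measurable_funM => //; exact: measurable_cst.
have G20 t : 0 <= 2 * G t by rewrite mulr_ge0.
have iG2 : (\int[leb]_(t in `[a, b]) (2 * G t)%:E < +oo)%E.
  under eq_integral do rewrite EFinM.
  rewrite (ge0_integralZl_EFin leb mJ).
  - by apply: lte_mul_pinfty.
  - by move=> t _; rewrite lee_fin.
  - by apply/measurable_EFinP; exact: measurable_funTS.
  - by [].
have ieta : \int[leb]_(t in `[a, b]) (2 * G t) <= 2 * eta.
  rewrite (RintegralZl _ mJ (integrable_subitv G a b mG G0 iGoo a b (lexx _) (lexx _))).
  rewrite ler_wpM2l// /Rintegral.
  have : (0 <= \int[leb]_(t in `[a, b]) (G t)%:E)%E.
    by apply: integral_ge0 => t _; rewrite lee_fin.
  by move: iG; move: (\int[leb]_(t in `[a, b]) (G t)%:E)%E => [y| |]; rewrite ?lee_fin.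
have m0 : 0 <= m by exact: fine_ge0.
(* Bounds the slope of k at all times from a on, since k is nonincreasing. *)
pose K := c * k a `^ (p - 1).
have K0 : 0 <= K by rewrite mulr_ge0 ?powR_ge0// ltW.
have m1 : 0 < K * m + 1 by rewrite ltr_wpDl// mulr_ge0.
have Ja : `[a, b]%classic a by rewrite /= in_itv/= lexx ltW.
have Jb : `[a, b]%classic b by rewrite /= in_itv/= lexx andbT ltW.
have [da da0 hda] := w_continuous a _ Ja eta0.
have [db db0 hdb] := w_continuous b _ Jb eta0.
(* The halves make d < da and d < db strict; kap admits [k_decay], eta / (K m + 1) bounds the change
   of k times the measure of Om, and b - a keeps r and t in [a, b]. *)
pose d := Num.min (Num.min (da / 2) (db / 2)) (Num.min kap (Num.min (eta / (K * m + 1)) (b - a))).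
have d0 : 0 < d by rewrite !lt_min kap0 !divr_gt0 ?subr_gt0.
have [dda ddb] : d < da /\ d < db.
  have h : d <= da / 2 /\ d <= db / 2 by rewrite /d !ge_min !lexx !orbT.
  by case: h => h1 h2; split; [apply: le_lt_trans h1 _|apply: le_lt_trans h2 _];
    rewrite ltr_pdivrMr// ltr_pMr// ltr1n.
have [dkap dK dba] : [/\ d <= kap, d <= eta / (K * m + 1) & d <= b - a].
  by rewrite /d !ge_min !lexx !orbT.
have mh : 0 < Num.min h0 kap by rewrite lt_min h00.
have eta20 : 0 < 2 * eta by rewrite mulr_gt0.
have [r [t [/andP[ar rd] /andP[dt tb] Ert]]] := descent_along_grid _ S a b mG2 G20 iG2 aeS
  E (Num.min h0 kap) (2 * eta) mh eta20 ieta (E_step G h0 S mG G0 iGoo aeS HS HG) d ab d0.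
have rb : r <= b by apply: le_trans rd _; rewrite -lerBrDl.
have a_t : a <= t by apply: le_trans dt; rewrite lerBrDr -lerBrDl.
have Jr : `[a, b]%classic r by rewrite /= in_itv/= ar.
have Jt : `[a, b]%classic t by rewrite /= in_itv/= a_t.
have r0 : 0 < r by exact: lt_le_trans ar.
have t0 : 0 < t by exact: lt_le_trans a_t.
have kK x : a <= x -> c * k x `^ (p - 1) <= K.
  move=> ax; rewrite ler_wpM2l ?(ltW c0)//; apply: le_powRl.
  - by rewrite subr_ge0 ltW.
  - exact: ltW (k0 _ ax).
  - exact: k_mono.
have kvar x y : a <= x -> x <= y -> y - x <= d -> `|k y - k x| * m <= eta.
  move=> ax xy yx.
  rewrite distrC ger0_norm; last by rewrite subr_ge0; exact: k_mono.
  have h1 := k_decay _ _ ax xy (le_trans yx dkap).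
  have h2 : k x - k y <= d * K.
    apply: (le_trans h1); apply: ler_pM; rewrite ?subr_ge0//.
    - by rewrite mulr_ge0 ?powR_ge0// ltW.
    - by apply: kK; exact: le_trans xy.
  apply: (@le_trans _ _ (d * K * m)); first exact: ler_wpM2r.
  apply: (@le_trans _ _ (eta / (K * m + 1) * (K * m + 1))); last by rewrite divfK// gt_eqF.
  rewrite -mulrA; apply: ler_pM => //; first exact: ltW.
  - by rewrite mulr_ge0.
  - by rewrite lerDl.
have E1 := E_lip _ _ a0 r0.
have E2 := E_lip _ _ t0 b0.
have rda : r - a <= d by rewrite lerBlDl.
have btd : b - t <= d by rewrite lerBlDl -lerBlDr.
have ra : `|r - a| < da.
  by rewrite ger0_norm ?subr_ge0//; exact: le_lt_trans dda.
have bt : `|t - b| < db.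
  by rewrite distrC ger0_norm ?subr_ge0//; exact: le_lt_trans ddb.
have I1 := hda r Jr ra.
have I2 := hdb t Jt bt.
have sw : \int[mu]_(x in Om) `|w b x - w t x| = \int[mu]_(x in Om) `|w t x - w b x|.
  by apply: eq_Rintegral => x _; rewrite distrC.
rewrite sw in E2.
have k1 : `|k r - k a| * m <= eta by exact: kvar.
have k2 : `|k b - k t| * m <= eta by exact: kvar.
have ee : e = 14 * eta by rewrite /eta; field.
rewrite ee; move: (\int[mu]_(x in Om) `|w r x - w a x|) (\int[mu]_(x in Om) `|w t x - w b x|)
  (`|k r - k a| * m) (`|k b - k t| * m) I1 I2 E1 E2 k1 k2 Ert => i1 i2 i3 i4.
by move: (E a) (E b) (E r) (E t) => e1 e2 e3 e4 *; lra.
Qed.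

End energy.

(** * Decay of the difference *)

Section decay.
Context {R : realType} {n : nat}.
Local Notation mu := (@lebesgue_rV R n).
Local Notation leb := (@lebesgue_measure R).
Variables (p s : R) (Om D : set 'rV[R]_n).
Hypothesis p2 : 2 < p.
Hypothesis s0 : 0 < s.
Hypothesis oOm : open Om.
Hypothesis bOm : bounded_set Om.
Hypothesis oD : open D.
Hypothesis bD : bounded_set D.
Hypothesis OmD : compactly_contained Om D.

Let mOm : measurable Om. Proof. exact: measurable_open_rV. Qed.
Let fOm : (mu Om < +oo)%E. Proof. exact: bounded_set_finite_measure. Qed.
Local Notation al := ((p - 2)^-1).
Let al0 : 0 < al. Proof. by rewrite invr_gt0 subr_gt0. Qed.

Variables (f : R -> ('rV[R]_n -> R) -> R^o) (u v : R -> 'rV[R]_n -> R).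
Hypothesis wu : weak_solution s p Om D f u.
Hypothesis wv : weak_solution s p Om D f v.
Variables (c A a b : R).
Hypothesis c0 : 0 < c.
Hypothesis c_abs : absorbing p s Om c.
Hypothesis A0 : 0 < A.
Hypothesis A_decay : forall x y, 0 < x -> x <= y -> y <= 2 * x ->
  A * x `^ (- al) - A * y `^ (- al) <= (y - x) * (c * (A * y `^ (- al)) `^ (p - 1)).
Hypothesis a0 : 0 < a.
Hypothesis ab : a < b.
Hypothesis W0 : {ae leb, forall t, `[a, b]%classic t ->
  {ae mu, forall x, ~ Om x -> v t x - u t x = 0}}.

Let L2_at (l : R -> 'rV[R]_n -> R) t : weak_solution s p Om D f l -> 0 < t -> L2 Om (l t).
Proof.
move=> wl t0; have t1 : t < t + 1 by rewrite ltrDl.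
have [_ _ C _] := wl _ _ t0 t1; have [] // := C t _.
by rewrite /= in_itv/= lexx ltW.
Qed.

Let powN_mono x y : 0 < x -> x <= y -> y `^ (- al) <= x `^ (- al).
Proof.
move=> x0 xy; rewrite !powRN lef_pV2 ?posrE ?powR_gt0//; last exact: lt_le_trans xy.
by apply: le_powRl => //; exact: ltW.
Qed.

Let Q := \int[mu]_(x in Om) (`|v a x| `^ 2 + `|u a x| `^ 2).

(** Shifting the singularity of the barrier to a - kap makes [k a] = A kap^(-al) finite but large.
    The energy at a is at most 2 / k a times Q, an L^2 quantity independent of kap. *)
Let energy_bound kap : 0 < kap ->
  \int[mu]_(x in Om) clip_prim (v b x - u b x - A * (b - a) `^ (- al)) <=
  2 * kap `^ al / A * Q.
Proof.
move=> kap0; pose k t := A * (t - a + kap) `^ (- al).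
have pos t : a <= t -> 0 < t - a + kap by move=> a_t; rewrite ltr_wpDl// subr_ge0.
have k0 t : a <= t -> 0 < k t.
  by move=> a_t; rewrite mulr_gt0// powR_gt0// pos.
have k_mono r t : a <= r -> r <= t -> k t <= k r.
  move=> ar rt; rewrite ler_wpM2l ?(ltW A0)// powN_mono ?pos//.
  by rewrite lerD2r lerD2r.
have k_decay r t : a <= r -> r <= t -> t - r <= kap ->
    k r - k t <= (t - r) * (c * k t `^ (p - 1)).
  (* The condition y <= 2 x of the barrier holds because t - r <= kap <= r - a + kap. *)
  move=> ar rt trk; have := A_decay (r - a + kap) (t - a + kap) (pos _ ar).
  have -> : t - a + kap - (r - a + kap) = t - r by ring.
  by apply; lra.
have b0 : 0 < b by exact: lt_trans ab.
have Lua := L2_at u a wu a0; have Lva := L2_at v a wv a0.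
have Lub := L2_at u b wu b0; have Lvb := L2_at v b wv b0.
have iw l1 l2 : L2 Om l1 -> L2 Om l2 -> mu.-integrable Om (EFin \o (l1 \- l2)).
  move=> h1 h2; exact: (integrableB mOm (L2_integrable _ mOm fOm _ h1)
    (L2_integrable _ mOm fOm _ h2)).
have icp l1 l2 (y : R) : L2 Om l1 -> L2 Om l2 ->
    mu.-integrable Om (EFin \o (fun x => clip_prim (l1 x - l2 x - y))).
  move=> h1 h2; exact: (integrable_clip_prim Om oOm bOm _ y (iw _ _ h1 h2)).
have isq (l : 'rV[R]_n -> R) : L2 Om l -> mu.-integrable Om (EFin \o (fun x => `|l x| `^ 2)).
  move=> [ml fl]; apply/integrableP; split.
    apply/measurable_EFinP; apply: measurable_fun_powR; exact: measurableT_comp.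
  under eq_integral do rewrite /= ger0_norm ?powR_ge0//.
  exact: L2_sqr_lty.
have h1 : \int[mu]_(x in Om) clip_prim (v b x - u b x - A * (b - a) `^ (- al)) <=
    \int[mu]_(x in Om) clip_prim (v b x - u b x - k b).
  apply: le_Rintegral => //; [exact: icp|exact: icp|].
  move=> x _; apply: clip_prim_mono; rewrite lerD2l lerN2 ler_wpM2l ?(ltW A0)//.
  by apply: powN_mono; rewrite ?subr_gt0// lerDl ltW.
apply: (le_trans h1).
apply: le_trans (energy_le p s Om D p2 s0 oOm bOm oD bD OmD f u v wu wv a b c kap k
  a0 ab kap0 c_abs c0 k0 k_mono k_decay W0) _.
have iq := integrableD mOm (isq _ Lva) (isq _ Lua).
rewrite /Q -(RintegralZl _ mOm iq).
apply: le_Rintegral => //; first exact: icp.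
  have iz := integrableZl mOm (2 * kap `^ al / A) iq.
  exact: iz.
move=> x _; apply: le_trans (clip_prim_le _) _.
have ka : k a = A / kap `^ al by rewrite /k subrr add0r powRN.
have ka0 : 0 < k a by exact: k0.
have -> : 2 * kap `^ al / A = 2 / k a.
  by rewrite ka; field; rewrite !gt_eqF// powR_gt0.
rewrite !powR_mulrn// !real_normK ?num_real//.
move: (v a x) (u a x) (k a) ka0 => y z q q0.
have -> : 2 / q * (y ^+ 2 + z ^+ 2) = 2 * (y ^+ 2 + z ^+ 2) / q by ring.
rewrite ge_max; apply/andP; split; last first.
  by rewrite divr_ge0 ?(ltW q0)// mulr_ge0// addr_ge0// sqr_ge0.
rewrite ler_pdivlMr// -subr_ge0.
(* A sum of squares certificate for q (y - z - q) <= 2 (y^2 + z^2). *)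
rewrite [leRHS](_ : _ = (y + z) ^+ 2 + ((y - z - q) ^+ 2 + ((y - z) ^+ 2 + q ^+ 2)) / 2).
  by rewrite addr_ge0 ?sqr_ge0// divr_ge0// !addr_ge0 ?sqr_ge0.
by field.
Qed.

(** Only the right-hand side of [energy_bound] depends on kap, so the energy at b is 0; since
    [clip_prim] is positive on positive arguments, the level is not exceeded. *)
Lemma decay_one_sided :
  {ae mu, forall x, Om x -> v b x - u b x <= A * (b - a) `^ (- al)}.
Proof.
set K := A * _.
have b0 : 0 < b by exact: lt_trans ab.
have Lub := L2_at u b wu b0; have Lvb := L2_at v b wv b0.
have iw := integrableB mOm (L2_integrable _ mOm fOm _ Lvb) (L2_integrable _ mOm fOm _ Lub).
have icp := integrable_clip_prim Om oOm bOm _ K iw.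
have Q0 : 0 <= Q by apply: Rintegral_ge0 => x _; rewrite addr_ge0// powR_ge0.
have I0 : \int[mu]_(x in Om) clip_prim (v b x - u b x - K) = 0.
  apply/eqP; rewrite eq_le; apply/andP; split; last first.
    by apply: Rintegral_ge0 => x _; exact: clip_prim_ge0.
  apply/ler_addgt0Pr => e e0; rewrite add0r.
  (* With kap = y^(p-2) one has kap^al = y, and the bound becomes e Q / (Q + 1). *)
  pose y := e * A / (2 * (Q + 1)).
  have Q1 : 0 < Q + 1 by rewrite ltr_wpDl.
  have y0 : 0 < y by rewrite divr_gt0 ?mulr_gt0.
  have kap0 : 0 < y `^ (p - 2) by exact: powR_gt0.
  apply: le_trans (energy_bound _ kap0) _.
  rewrite -powRrM mulfV ?gt_eqF ?subr_gt0// powRr1; last exact: ltW.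
  have -> : 2 * y / A * Q = e * (Q / (Q + 1)) by rewrite /y; field; rewrite !gt_eqF.
  rewrite -[leRHS]mulr1; apply: ler_wpM2l; first exact: ltW.
  by rewrite ler_pdivrMr// mul1r lerDl.
have I1 : (\int[mu]_(x in Om) `|(clip_prim (v b x - u b x - K))%:E| = 0)%E.
  under eq_integral do rewrite /= ger0_norm ?clip_prim_ge0//.
  have := integrable_fin_num mOm icp.
  by move: I0; rewrite /Rintegral => h /fineK <-; rewrite h.
have mcp : measurable_fun Om (fun x => (clip_prim (v b x - u b x - K))%:E).
  by case/integrableP: icp.
have [H _] := @ae_eq_integral_abs _ _ _ mu Om mOm _ mcp.
apply: ae_imply (H I1) => x hx Ox; have := hx Ox => -[] h.
rewrite leNgt; apply/negP => lt; have := clip_prim_gt0 (v b x - u b x - K).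
by rewrite subr_gt0 h ltxx => /(_ lt).
Qed.

End decay.

Theorem theorem2p1 (R : realType) (n : nat) (hn : (0 < n)%N) (p s : R)
    (hp : 2 < p) (hs : 0 < s < 1) (Om : set 'rV[R]_n)
    (hOm : domain Om) (bOm : bounded_set Om) :
  exists C : R,
    forall (Om' : set 'rV[R]_n), open Om' -> bounded_set Om' ->
      compactly_contained Om Om' ->
    forall f : R -> ('rV[R]_n -> R) -> R^o,
      bochner_Lp_loc (p / (p - 1)) (dual (X0 s p Om Om')) f ->
    forall u v : R -> 'rV[R]_n -> R,
      weak_solution s p Om Om' f u -> weak_solution s p Om Om' f v ->
      bochner_Lp_loc p (sobolev0 s p Om) (u - v) ->
    forall T : R, 0 < T ->
      (ereal_sup [set Lnorm_on Om +oo (v t - u t)%R | t in [set t : R | (T <= t)%R]]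
         <= (C * T `^ (- (p - 2)^-1))%R%:E)%E.
Proof.
have [s0 _] := andP hs; have [oOm _ _] := hOm.
have [c c0 c_abs] := form_absorption p s Om hn hp s0 oOm bOm.
have [A A0 A_decay] := barrier_decay p c hp c0.
set al := (p - 2)^-1; have al0 : 0 < al by rewrite invr_gt0 subr_gt0.
(* The factor 2^al comes from b - b / 2 = b / 2; c and A were obtained before D, f, u and v are
   introduced. *)
exists (A * 2 `^ al) => D oD bD OmD f _ u v wu wv Wuv T T0.
apply: ge_ereal_sup => _ [b /= Tb <-].
have b0 : 0 < b by exact: lt_le_trans Tb.
have a0 : 0 < b / 2 by rewrite divr_gt0.
have ab : b / 2 < b by rewrite ltr_pdivrMr// ltr_pMr// ltr1n.
(* This places u - v in [sobolev0] at almost every time only. That suffices for the bound at the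
   given time b, because the energy argument reaches its end times by continuity. *)
have [[g [_ aeW]] _] := Wuv _ _ a0 ab.
have W1 : {ae @lebesgue_measure R, forall t, `[b / 2, b]%classic t ->
    {ae @lebesgue_rV R n, forall x, ~ Om x -> u t x - v t x = 0}}.
  apply: ae_imply aeW => t ht Jt; have [h _] := ht Jt.
  exact: (sobolev0_ae_zero p s Om hp oOm _ h).
have W2 : {ae @lebesgue_measure R, forall t, `[b / 2, b]%classic t ->
    {ae @lebesgue_rV R n, forall x, ~ Om x -> v t x - u t x = 0}}.
  apply: ae_imply W1 => t ht Jt; apply: ae_imply (ht Jt) => x hx Ox.
  by rewrite -opprB hx ?oppr0.
have H1 := decay_one_sided p s Om D hp s0 oOm bOm oD bD OmD f u v wu wv c A (b / 2) b
  c0 c_abs A0 A_decay a0 ab W2.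
have H2 := decay_one_sided p s Om D hp s0 oOm bOm oD bD OmD f v u wv wu c A (b / 2) b
  c0 c_abs A0 A_decay a0 ab W1.
set K := (A * 2 `^ al * T `^ (- al)).
have K0 : 0 <= K by rewrite !mulr_ge0 ?powR_ge0// ltW.
have leK : A * (b - b / 2) `^ (- al) <= K.
  have -> : b - b / 2 = 2^-1 * b by field.
  rewrite powRM ?invr_ge0 ?(ltW b0)// /K -mulrA ler_wpM2l ?(ltW A0)//.
  have -> : (2^-1 : R) `^ (- al) = 2 `^ al.
    by rewrite powRN -(powR_inv1 (ltW (ltr0Sn R 1))) -powRrM mulN1r powRN invrK.
  rewrite ler_wpM2l ?powR_ge0// !powRN lef_pV2 ?posrE ?powR_gt0//.
  by apply: le_powRl => //; exact: ltW.
(* The norm at [+oo] is defined by cases on the measure of the whole space; in the degenerate case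
   it is 0. *)
rewrite /Lnorm_on unlock /=; case: ifPn => _; last by rewrite lee_fin.
apply/ess_sup_inf.ess_supP; apply: ae_imply2 H1 H2 => x h1 h2 /=.
rewrite /patch; case: ifPn => xO; last by rewrite normr0 lee_fin.
rewrite inE in xO.
rewrite lee_fin ler_norml; apply/andP; split.
  by rewrite lerNl opprB; apply: le_trans (h2 xO) leK.
exact: le_trans (h1 xO) leK.
Qed.
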